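(* Let $\tau\in[0,1]$, and let $\gamma=\gamma_\tau$ be the curve in the $xz$-plane given parametrically for $u\in[-\tau,\tau]$ by $$x=x_\tau(u):=\frac{u\sqrt{1-(\tau-|u|)^2}}{\sqrt{1-u^2(\tau-|u|)^2}},\qquad z=z_\tau(u):=\int\frac{dz}{dx}\,dx=\int\frac{u}{\sqrt{1-u^2}}\,\frac{du}{\kappa_\tau(u)},$$ where $$\kappa_\tau(u):=\frac{\sqrt{\big(1-u^2(\tau-|u|)^2\big)^3\big(1-(\tau-|u|)^2\big)}}{1-(\tau-|u|)^2+(\tau-|u|)|u|(1-u^2)}$$ and the constant of integration for $z$ is chosen so that $z_\tau(0)+z_\tau(\tau)=-\sqrt{1-\tau^2}$. Let $\tilde\gamma$ be the image of $\gamma$ under the symmetry $(x,0,z)\mapsto(0,x,-z)$. Then the union of $\gamma$ and $\tilde\gamma$ (each extended by straight segments to the constraint planes) is a $\tau$-clasp that is strongly critical for link-ropelength. The curvature of $\gamma$ is $\kappa_\tau(u)$, and the total length of the curved part of $\gamma$ is $$\int_{-\tau}^{\tau}\frac{du}{\kappa_\tau(u)\sqrt{1-u^2}}.$$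
   Context: Parametrization: $u=\sin\phi$, where $\phi$ is the angle of the tangent vector of $\gamma$ above the horizontal ($x$-direction). Integrands are interpreted via $1/\kappa_\tau$ (which is finite) where $\kappa_\tau$ is infinite. The $\tau$-clasp problem: let $n_\pm=(\pm\sqrt{1-\tau^2},0,\tau)$, $\tilde n_\pm=(0,\pm\sqrt{1-\tau^2},-\tau)$, and let $C$ be a sufficiently large constant. There are two arcs. The first has its two endpoints constrained to the planes $\langle p,n_+\rangle=C$ and $\langle p,n_-\rangle=C$ respectively, and the second has its endpoints constrained to $\langle p,\tilde n_\pm\rangle=C$. Each arc is constrained to stay in the wedge bounded by the planes containing the endpoints of the other (obstacles $g=C-\langle p,\tilde n_\pm\rangle<0$ for the first arc, $g=C-\langle p,n_\pm\rangle<0$ for the second). The two arcs are clasped: for $\tau=1$, where the four planes reduce to $z=\pm C$, closing each arc in the plane of its endpoints gives a Hopf link; for $\tau<1$ the linking is analogous. In the configuration of the theorem, each component is the curved arc continued at both ends ($u=\pm\tau$) by straight segments tangent to it, which meet the constraint planes perpendicularly. Strong criticality. This two-component curve $L$ with its constraints is a generalized link. The link-thickness $\mathrm{LThi}(L)$ is the minimum distance between points on different components. With $s$ arclength and $T$ the unit tangent, for a vector field $\xi\colon L\to\mathbb{R}^3$ put $\delta_\xi\mathrm{Len}(L)=\int_L\langle T,d\xi/ds\rangle\,ds$, $\delta^+_\xi\mathrm{LThi}(L)=\frac{d}{dt^+}|_{t=0}\mathrm{LThi}(L+t\xi)$, and let $\delta^+_\xi O(L)$ be the minimum of $\langle\xi_x,\nabla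 g(x)\rangle$ over all points $x\in L$ and obstacle functions $g$ for the component of $x$ with $g(x)=0$ (this term being $+\infty$ if there are none). $\xi$ is compatible if at each endpoint it is tangent to the corresponding constraint plane. $L$ is strongly critical for link-ropelength if there is $\varepsilon>0$ such that $\min(\delta^+_\xi\mathrm{LThi}(L),\delta^+_\xi O(L))\le-\varepsilon$ for all compatible $\xi$ that are smooth functions of arclength with $\delta_\xi\mathrm{Len}(L)=-1$. *)

(* Defs.v *)
From Stdlib Require Import Reals List.
From Coquelicot Require Import Coquelicot.
Import ListNotations.
Open Scope R_scope.

(** * Vectors in Euclidean 3-space *)

Notation R3 := (R * R * R)%type.

Definition xc (p : R3) : R := fst (fst p).
Definition yc (p : R3) : R := snd (fst p).
Definition zc (p : R3) : R := snd p.

Definition dot (p q : R3) : R := xc p * xc q + yc p * yc q + zc p * zc q.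
Definition enorm (p : R3) : R := sqrt (dot p p).
Definition dist3 (p q : R3) : R := enorm (minus p q).

Definition velocity (c : R -> R3) (s : R) : R3 :=
  (Derive (fun r => xc (c r)) s,
   Derive (fun r => yc (c r)) s,
   Derive (fun r => zc (c r)) s).

Definition grad (g : R3 -> R) (p : R3) : R3 :=
  (Derive (fun r => g (r, yc p, zc p)) (xc p),
   Derive (fun r => g (xc p, r, zc p)) (yc p),
   Derive (fun r => g (xc p, yc p, r)) (zc p)).

Definition smooth_field (xi : R -> R3) : Prop :=
  forall (n : nat) (s : R),
    ex_derive_n (fun r => xc (xi r)) n s /\
    ex_derive_n (fun r => yc (xi r)) n s /\
    ex_derive_n (fun r => zc (xi r)) n s.

(** * Length, arclength parametrization, curvature *)

(** [d] is the length of a polygon inscribed in [c] over [[a, b]], with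
    vertices [c (p 0), ..., c (p (S n))]. *)
Definition inscribed_length (c : R -> R3) (a b d : R) : Prop :=
  exists (n : nat) (p : nat -> R),
    p 0%nat = a /\ p (S n) = b /\
    (forall i, (i <= n)%nat -> p i <= p (S i)) /\
    d = sum_f_R0 (fun i => dist3 (c (p i)) (c (p (S i)))) n.

Definition arc_length (c : R -> R3) (a b : R) : Rbar :=
  Lub_Rbar (inscribed_length c a b).

(** For a continuous rectifiable [c] on [[a, b]] of length [l] the infimum below
    is attained, so this is the arclength parametrization on [[0, l]].
    Values outside [[0, l]] are irrelevant. *)
Definition by_arclength (c : R -> R3) (a b s : R) : R3 :=
  c (real (Glb_Rbar (fun u => a <= u <= b /\ Rbar_le s (arc_length c a u)))).

(** Curvature, at arclength [s], of a curve [c] parametrized by arclength on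
    [[0, l]]: the limit of |T(r) - T(s)| / |r - s|, possibly infinite.  Limits are
    taken within [[0, l]], hence are one-sided at the endpoints. *)
Definition has_curvature (c : R -> R3) (l s : R) (k : Rbar) : Prop :=
  exists T : R -> R3,
    (forall r, 0 <= r <= l ->
       filterlim (fun q => scal (/ (q - r)) (minus (c q) (c r)) : R3)
         (within (fun q => 0 <= q <= l) (locally' r)) (locally (T r))) /\
    filterlim (fun r => dist3 (T r) (T s) / Rabs (r - s))
      (within (fun r => 0 <= r <= l) (locally' s)) (Rbar_locally k).

(** * Generalized links with two components, and strong criticality *)

(** The plane of points [p] with [dot p normal = height]. *)
Record plane := Plane { normal : R3; height : R }.

Definition on_plane (P : plane) (p : R3) : Prop := dot p (normal P) = height P.

(** An arc parametrized by [[0, len]], with its endpoint planes; it must avoid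
    the regions where an obstacle function is negative. *)
Record component := Component {
  len : R;
  pos : R -> R3;
  start_plane : plane;
  end_plane : plane;
  obstacles : list (R3 -> R) }.

Definition link := (component * component)%type.

Definition satisfies_constraints (K : component) : Prop :=
  on_plane (start_plane K) (pos K 0) /\
  on_plane (end_plane K) (pos K (len K)) /\
  forall g s, In g (obstacles K) -> 0 <= s <= len K -> 0 <= g (pos K s).

Definition admissible (L : link) : Prop :=
  satisfies_constraints (fst L) /\ satisfies_constraints (snd L).

Definition perturb (K : component) (xi : R -> R3) (t : R) : component :=
  Component (len K) (fun s => plus (pos K s) (scal t (xi s)) : R3)
    (start_plane K) (end_plane K) (obstacles K).

Definition LThi (L : link) : R :=
  real (Glb_Rbar (fun d => exists s1 s2,
    0 <= s1 <= len (fst L) /\ 0 <= s2 <= len (snd L) /\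
    d = dist3 (pos (fst L) s1) (pos (snd L) s2))).

Definition is_right_derive (f : R -> R) (x l : R) : Prop :=
  filterlim (fun h => (f (x + h) - f x) / h) (at_right 0) (locally l).

(** In the following four definitions [pos] is an arclength parametrization
    and [xi] is a vector field along the component as a function of arclength. *)

Definition dLen (K : component) (xi : R -> R3) : R :=
  RInt (fun s => dot (velocity (pos K) s) (velocity xi s)) 0 (len K).

Definition compatible (K : component) (xi : R -> R3) : Prop :=
  dot (xi 0) (normal (start_plane K)) = 0 /\
  dot (xi (len K)) (normal (end_plane K)) = 0.

Definition contact_rate (K : component) (xi : R -> R3) (d : R) : Prop :=
  exists s g, 0 <= s <= len K /\ In g (obstacles K) /\ g (pos K s) = 0 /\
    d = dot (xi s) (grad g (pos K s)).

(** This is [p_infty] when there are no contacts. *)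
Definition dObst (L : link) (xi1 xi2 : R -> R3) : Rbar :=
  Glb_Rbar (fun d => contact_rate (fst L) xi1 d \/ contact_rate (snd L) xi2 d).

(** A smooth field on [[0, len]] is the restriction of a smooth field on the
    whole line, so [xi1] and [xi2] may be taken smooth everywhere. *)
Definition strongly_critical (L : link) : Prop :=
  exists eps : R, 0 < eps /\
  forall xi1 xi2 : R -> R3,
    smooth_field xi1 -> smooth_field xi2 ->
    compatible (fst L) xi1 -> compatible (snd L) xi2 ->
    dLen (fst L) xi1 + dLen (snd L) xi2 = -1 ->
    exists dThi : R,
      is_right_derive
        (fun t => LThi (perturb (fst L) xi1 t, perturb (snd L) xi2 t)) 0 dThi /\
      Rbar_le (Rbar_min dThi (dObst L xi1 xi2)) (- eps).

(** * Clasps *)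

(** [n_vec tau 1] and [n_vec tau (-1)] are n_+ and n_-; similarly for
    [nt_vec] and the normals of the other arc. *)
Definition n_vec (tau e : R) : R3 := (e * sqrt (1 - tau ^ 2), 0, tau).
Definition nt_vec (tau e : R) : R3 := (0, e * sqrt (1 - tau ^ 2), - tau).

Definition wall (C : R) (n : R3) (p : R3) : R := C - dot p n.

Definition clasp_link (tau C l1 : R) (c1 : R -> R3) (l2 : R) (c2 : R -> R3)
    : link :=
  (Component l1 c1 (Plane (n_vec tau (-1)) C) (Plane (n_vec tau 1) C)
     [wall C (nt_vec tau 1); wall C (nt_vec tau (-1))],
   Component l2 c2 (Plane (nt_vec tau (-1)) C) (Plane (nt_vec tau 1) C)
     [wall C (n_vec tau 1); wall C (n_vec tau (-1))]).

(** The symmetry exchanging the two arcs; on the xz-plane it is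
    (x, 0, z) |-> (0, x, -z). *)
Definition sym (p : R3) : R3 := (yc p, xc p, - zc p).

(** A C^1 isotopy [F (t, s)] (time [t], parameter [s]) of regular embedded arcs.
    Merely continuous isotopies would allow local knots to be shrunk away. *)
Definition unit_square (q : R * R) : Prop := 0 <= fst q <= 1 /\ 0 <= snd q <= 1.

Definition C1_isotopy (F : R * R -> R3) : Prop :=
  (exists F' : R * R -> R3,
     continuous_on unit_square F /\ continuous_on unit_square F' /\
     (forall t s, 0 <= t <= 1 -> 0 < s < 1 ->
        is_derive (fun r => F (t, r)) s (F' (t, s))) /\
     (forall q, unit_square q -> F' q <> (0, 0, 0))) /\
  (forall t s s', 0 <= t <= 1 -> 0 <= s <= 1 -> 0 <= s' <= 1 ->
     F (t, s) = F (t, s') -> s = s').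

(** Model clasp: the parabolic arc z = tau x^2 - 1, y = 0, |x| <= a, hooked with
    its image under [sym].  For tau = 1, closing the two arcs by segments in the
    planes z = C and z = -C (with C > 1) gives a Hopf link. *)
Definition model_arc (tau a s : R) : R3 :=
  let x := a * (2 * s - 1) in (x, 0, tau * x ^ 2 - 1).

(** Two arcs are clasped when they can be deformed to the model, staying
    disjoint and respecting the endpoint and obstacle constraints throughout. *)
Definition clasped (tau C l1 : R) (c1 : R -> R3) (l2 : R) (c2 : R -> R3)
    : Prop :=
  exists (F G : R * R -> R3) (a : R),
    0 < a /\ C1_isotopy F /\ C1_isotopy G /\
    (forall t, 0 <= t <= 1 ->
       admissible
         (clasp_link tau C 1 (fun s => F (t, s)) 1 (fun s => G (t, s)))) /\
    (forall t s s', 0 <= t <= 1 -> 0 <= s <= 1 -> 0 <= s' <= 1 ->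
       F (t, s) <> G (t, s')) /\
    (forall s, 0 <= s <= 1 ->
       F (0, s) = c1 (l1 * s) /\ G (0, s) = c2 (l2 * s) /\
       F (1, s) = model_arc tau a s /\ G (1, s) = sym (model_arc tau a s)).

Definition is_tau_clasp (tau C l1 : R) (c1 : R -> R3) (l2 : R) (c2 : R -> R3)
    : Prop :=
  admissible (clasp_link tau C l1 c1 l2 c2) /\ clasped tau C l1 c1 l2 c2.

(** * The curve gamma *)

(** For 0 <= tau <= 1 and |u| <= tau the denominator vanishes only for tau = 1,
    u = 0, where the numerator vanishes too and the curvature is infinite. *)
Definition kappa (tau u : R) : Rbar :=
  let a := tau - Rabs u in
  let den := 1 - a ^ 2 + a * Rabs u * (1 - u ^ 2) in
  if Req_EM_T den 0 then p_infty
  else Finite (sqrt ((1 - u ^ 2 * a ^ 2) ^ 3 * (1 - a ^ 2)) / den).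

Definition inv_kappa (tau u : R) : R := real (Rbar_inv (kappa tau u)).

(** Endpoint filter for the integrals below, whose integrands blow up at
    u = 1 and u = -1: there the integrals are improper (needed for tau = 1);
    elsewhere this is the neighbourhood filter. *)
Definition towards (u : R) : (R -> Prop) -> Prop :=
  within (fun v => -1 < v < 1) (locally u).

Definition x_gamma (tau u : R) : R :=
  let a := tau - Rabs u in
  u * sqrt (1 - a ^ 2) / sqrt (1 - u ^ 2 * a ^ 2).

Definition z_int (tau u : R) : R :=
  RInt_gen (fun v => v / sqrt (1 - v ^ 2) * inv_kappa tau v)
    (at_point 0) (towards u).

(** The additive constant makes z(0) + z(tau) = - sqrt (1 - tau^2). *)
Definition z_gamma (tau u : R) : R :=
  z_int tau u + (- sqrt (1 - tau ^ 2) - z_int tau 0 - z_int tau tau) / 2.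

Definition gamma (tau u : R) : R3 := (x_gamma tau u, 0, z_gamma tau u).

(** Length of the straight segment from gamma (e * tau) in the direction
    [n_vec tau e] to the plane with that normal, for e = 1 or -1. *)
Definition gap (tau C e : R) : R := C - dot (gamma tau (e * tau)) (n_vec tau e).

(** Gamma with its two straight segments, over
    [[- tau - gap tau C (-1), tau + gap tau C 1]]. *)
Definition gamma_ext (tau u : R) : R3 :=
  if Rle_dec u (- tau)
  then plus (gamma tau (- tau)) (scal (- tau - u) (n_vec tau (-1)))
  else if Rle_dec tau u
  then plus (gamma tau tau) (scal (u - tau) (n_vec tau 1))
  else gamma tau u.

Definition lo (tau C : R) : R := - tau - gap tau C (-1).
Definition hi (tau C : R) : R := tau + gap tau C 1.

Definition arc1 (tau C : R) : R -> R3 :=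
  by_arclength (gamma_ext tau) (lo tau C) (hi tau C).
Definition len1 (tau C : R) : R :=
  real (arc_length (gamma_ext tau) (lo tau C) (hi tau C)).

Definition arc2 (tau C : R) : R -> R3 :=
  by_arclength (fun u => sym (gamma_ext tau u)) (lo tau C) (hi tau C).
Definition len2 (tau C : R) : R :=
  real (arc_length (fun u => sym (gamma_ext tau u)) (lo tau C) (hi tau C)).

(* Main.v *)
Require Import Defs.
From Stdlib Require Import Reals Lra Lia Psatz ClassicalEpsilon.
From Coquelicot Require Import Coquelicot.
Open Scope R_scope.

(** Measure each arc by arclength s from its tip and write w for the angle of the
    tangent, u = sin w.  The given formulas say that the point of the first arc with
    sine u and the two points of the second arc with sines v and -v, where
    v = tau - |u|, are joined by segments normal to both arcs and of length 1
    ([strut_normal], [strut_unit]); these segments are the struts.  Only x is given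
    in closed form.  Along the family of struts the squared length is constant, and
    with normality at both ends this determines the derivative of the height of the
    strut; so the integral defining z has the right value for every u once it has it
    for u = 0, which is what the constant of integration is for ([strut_z]).

    No two points are closer than a strut.  Fix a point of the second arc with sine v
    and move a point of sine u along the first one.  The squared distance has a
    derivative with the sign of z(v) - z(tau - u), because the strut at u would end
    at height z(tau - u); here u, v >= 0, which is enough by symmetry.  As z increases
    with the sine, the distance decreases until u = tau - v and increases afterwards;
    along the straight ends it increases ([sep_sq_curved], [sep_sq_ge_1]).

    Strong criticality is a balance.  After integration by parts the variation of
    length is an integral over the curved parts of the normal component of the field
    ([length_variation]).  The two struts at a point of an arc have a resultant along
    the normal, and since u + v = tau makes du and dv equal up to sign, one density on
    the set of struts produces the variation of length of both arcs at once
    ([four_struts]).  Its total mass is finite, so if length decreases at unit rate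
    then some strut shrinks at a rate bounded below ([balance]).  The minimum distance
    shrinks at least as fast, by Danskin's theorem
    ([perturbed_distance_right_derive]); and for large C the obstacles are never
    touched.

    The computations are made in terms of w, not u: ds/dw = 1 / kappa is continuous
    up to the ends even for tau = 1, when ds/du is infinite at u = 1 and the curvature
    is infinite at u = 0.  The curve is rebuilt as the primitive of the unit vector of
    angle w(s), where w(s) inverts the primitive of 1 / kappa ([clasp_arc]); it is
    therefore C^1 with unit speed, also where the curvature is infinite, and its
    length and curvature follow. *)

(** * Elementary geometry and calculus *)

Lemma dist3_sqrt p q :
  dist3 p q = sqrt ((xc p - xc q) ^ 2 + (yc p - yc q) ^ 2 + (zc p - zc q) ^ 2).
Proof.
  destruct p as [[x y] z], q as [[x' y'] z'].
  unfold dist3, enorm, dot, xc, yc, zc; cbn. f_equal. ring.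
Qed.

Lemma dist3_sq p q :
  dist3 p q ^ 2 = (xc p - xc q) ^ 2 + (yc p - yc q) ^ 2 + (zc p - zc q) ^ 2.
Proof. rewrite dist3_sqrt. apply pow2_sqrt.
  repeat apply Rplus_le_le_0_compat; apply pow2_ge_0.
Qed.

Lemma vector_eq (p q : R3) : xc p = xc q -> yc p = yc q -> zc p = zc q -> p = q.
Proof.
  destruct p as [[x y] z], q as [[x' y'] z']. unfold xc, yc, zc; simpl. now intros -> -> ->.
Qed.

Lemma dist3_pos p q : 0 <= dist3 p q.
Proof. apply sqrt_pos. Qed.

Lemma dist3_sym_sym p q : dist3 (sym p) (sym q) = dist3 p q.
Proof. rewrite !dist3_sqrt. f_equal. unfold sym, xc, yc, zc; simpl. ring. Qed.

Lemma continuity_pt_continuous (f : R -> R) x : continuous f x -> continuity_pt f x.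
Proof. apply continuity_pt_filterlim. Qed.

Lemma cont_comp {U : UniformSpace} (f : U -> R) (x : U) (h : R -> R) :
  continuous f x -> continuous h (f x) -> continuous (fun y => h (f y)) x.
Proof. exact (continuous_comp f h x). Qed.

Section RealContinuity.
Context {U : UniformSpace} (f g : U -> R) (x : U).
Hypotheses (Hf : continuous f x) (Hg : continuous g x).

Lemma cont_plus : continuous (fun y => f y + g y) x.
Proof. exact (continuous_plus (V := R_NormedModule) f g x Hf Hg). Qed.

Lemma cont_minus : continuous (fun y => f y - g y) x.
Proof. exact (continuous_minus (V := R_NormedModule) f g x Hf Hg). Qed.

Lemma cont_opp : continuous (fun y => - f y) x.
Proof. exact (continuous_opp (V := R_NormedModule) f x Hf). Qed.

Lemma cont_mult : continuous (fun y => f y * g y) x.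
Proof. exact (continuous_mult (K := R_AbsRing) f g x Hf Hg). Qed.

Lemma cont_inv : f x <> 0 -> continuous (fun y => / f y) x.
Proof.
  intros H. apply (cont_comp f x Rinv Hf), continuity_pt_filterlim.
  apply (continuity_pt_inv id); [apply derivable_continuous_pt, derivable_pt_id | exact H].
Qed.
End RealContinuity.

Lemma cont_div {U : UniformSpace} (f g : U -> R) x :
  continuous f x -> continuous g x -> g x <> 0 -> continuous (fun y => f y / g y) x.
Proof. intros. apply cont_mult; [assumption | now apply cont_inv]. Qed.

Lemma cont_pow {U : UniformSpace} (f : U -> R) n x :
  continuous f x -> continuous (fun y => f y ^ n) x.
Proof.
  intros H. induction n as [|n IH]; simpl; [apply continuous_const|].
  now apply cont_mult.
Qed.

(* Only the syntactic head of the goal is matched: unification up to conversion would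
   unfold the functions being composed. *)
Ltac cont :=
  repeat first [ assumption
    | match goal with
      | |- continuous (fun _ => ?c) _ => apply continuous_const
      | |- continuous (fun x => x) _ => apply continuous_id
      | |- continuous Rabs _ => apply continuous_Rabs
      | |- continuous sin _ => apply continuous_sin
      | |- continuous cos _ => apply continuous_cos
      | |- continuous (fun x => _ + _) _ => apply cont_plus
      | |- continuous (fun x => _ - _) _ => apply cont_minus
      | |- continuous (fun x => - _) _ => apply cont_opp
      | |- continuous (fun x => _ * _) _ => apply cont_mult
      | |- continuous (fun x => _ / _) _ => apply cont_div
      | |- continuous (fun x => _ ^ _) _ => apply cont_pow
      | |- continuous (fun x => cos _) _ => refine (cont_comp _ _ cos _ (continuous_cos _))
      | |- continuous (fun x => sin _) _ => refine (cont_comp _ _ sin _ (continuous_sin _))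
      | |- continuous (fun x => sqrt _) _ => apply continuous_sqrt_comp
      | |- continuous (fun x => Rabs _) _ => apply continuous_Rabs_comp
      end ].

Lemma ex_RInt_cont (f : R -> R) a b : (forall r, continuous f r) -> ex_RInt f a b.
Proof.
  intros Hf. apply (ex_RInt_continuous (V := R_CompleteNormedModule)). intros; apply Hf.
Qed.

Section RealDerivatives.
Variables (f g : R -> R) (x a b : R).
Hypotheses (Hf : is_derive f x a) (Hg : is_derive g x b).

Lemma der_plus : is_derive (fun y => f y + g y) x (a + b).
Proof. exact (is_derive_plus f g x a b Hf Hg). Qed.

Lemma der_minus : is_derive (fun y => f y - g y) x (a - b).
Proof. exact (is_derive_minus f g x a b Hf Hg). Qed.

Lemma der_opp : is_derive (fun y => - f y) x (- a).
Proof. exact (is_derive_opp f x a Hf). Qed.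

Lemma der_mult : is_derive (fun y => f y * g y) x (a * g x + f x * b).
Proof. apply (is_derive_mult f g x a b Hf Hg). intros; apply Rmult_comm. Qed.

End RealDerivatives.

Lemma der_comp (f : R -> R) (x a : R) (h : R -> R) (c : R) :
  is_derive f x a -> is_derive h (f x) c -> is_derive (fun y => h (f y)) x (a * c).
Proof. intros Hf Hh. exact (is_derive_comp h f x c a Hh Hf). Qed.

Lemma der_const (c x : R) : is_derive (fun _ => c) x 0.
Proof. apply is_derive_Reals, derivable_pt_lim_const. Qed.

Lemma der_scal (k : R) (f : R -> R) (x a : R) :
  is_derive f x a -> is_derive (fun y => k * f y) x (k * a).
Proof. exact (is_derive_scal f x k a). Qed.

Lemma der_id (x : R) : is_derive (fun y => y) x 1.
Proof. apply is_derive_Reals, derivable_pt_lim_id. Qed.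

Lemma der_neg (x : R) : is_derive (fun y => - y) x (- (1)).
Proof. exact (der_opp (fun y => y) x 1 (der_id x)). Qed.

Lemma der_eq (f : R -> R) (x a b : R) : is_derive f x a -> a = b -> is_derive f x b.
Proof. now intros ? <-. Qed.

Lemma is_derive_primitive (f : R -> R) a s :
  (forall r, continuous f r) -> is_derive (fun x => RInt f a x) s (f s).
Proof.
  intros Hf. apply (is_derive_RInt f (fun x => RInt f a x) a s).
  - apply filter_forall. intros b.
    apply (RInt_correct (V := R_CompleteNormedModule)). now apply ex_RInt_cont.
  - apply Hf.
Qed.

Lemma derive_continuous (f : R -> R) x l : is_derive f x l -> continuous f x.
Proof. intros H. apply (ex_derive_continuous f). now exists l. Qed.

(** Differentiability is asked for in the open interval only: for tau = 1 the functions
    of u below have an infinite derivative at u = 1. *)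
Lemma mean_value (f df : R -> R) a b : a < b ->
  (forall x, a < x < b -> is_derive f x (df x)) ->
  (forall x, a <= x <= b -> continuous f x) ->
  exists c, a < c < b /\ f b - f a = df c * (b - a).
Proof.
  intros Hab Hd Hc.
  assert (pr1 : forall c, a < c < b -> derivable_pt f c).
  { intros c H. exists (df c). apply is_derive_Reals. now apply Hd. }
  destruct (MVT f id a b pr1 (fun c _ => derivable_pt_id c) Hab) as (c & P & E).
  - intros c H. apply continuity_pt_filterlim. now apply Hc.
  - intros c H. apply derivable_continuous_pt, derivable_pt_id.
  - exists c. split; [exact P|].
    assert (Ed : derive_pt f c (pr1 c P) = df c).
    { apply derive_pt_eq_0, is_derive_Reals. now apply Hd. }
    rewrite Ed, derive_pt_id in E. unfold id in E. lra.
Qed.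

Lemma le_of_derive_nonneg (f df : R -> R) a b : a <= b ->
  (forall x, a < x < b -> is_derive f x (df x)) ->
  (forall x, a <= x <= b -> continuous f x) ->
  (forall x, a < x < b -> 0 <= df x) -> f a <= f b.
Proof.
  intros [Hab | ->] Hd Hc Hp; [|lra].
  destruct (mean_value f df a b Hab Hd Hc) as (c & Hab' & E).
  specialize (Hp c Hab'). nra.
Qed.

Lemma eq_of_derive_zero (f : R -> R) a b : a <= b ->
  (forall x, a < x < b -> is_derive f x 0) ->
  (forall x, a <= x <= b -> continuous f x) -> f a = f b.
Proof.
  intros [Hab | ->] Hd Hc; [|lra].
  destruct (mean_value f (fun _ => 0) a b Hab Hd Hc) as (c & Hab' & E). lra.
Qed.

(** A monotone function can be discontinuous only by jumping over values.  This makes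
    inverse functions continuous, also where they are not differentiable. *)
Lemma monotone_surjective_continuous (g : R -> R) :
  (forall x y, x <= y -> g x <= g y) ->
  (forall a b y, g a <= y <= g b -> exists x, g x = y) ->
  forall x, continuous g x.
Proof.
  intros Hm Hs x0. apply continuity_pt_filterlim. intros eps Heps.
  assert (Hr : exists d, 0 < d /\ forall x, x < x0 + d -> g x < g x0 + eps).
  { destruct (classic (exists x1, g x0 < g x1)) as [[x1 H1]|H1].
    - destruct (Hs x0 x1 (Rmin (g x1) (g x0 + eps / 2))) as [x2 E].
      { split; [|apply Rmin_l]. apply Rmin_glb; lra. }
      assert (g x0 < g x2) by (rewrite E; apply Rmin_glb_lt; lra).
      assert (g x2 <= g x0 + eps / 2) by (rewrite E; apply Rmin_r).
      exists (x2 - x0). split.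
      + destruct (Rle_lt_dec x2 x0) as [L|L]; [apply Hm in L; lra | lra].
      + intros x Hx. assert (g x <= g x2) by (apply Hm; lra). lra.
    - exists 1. split; [lra|]. intros x _.
      destruct (Rle_lt_dec (g x) (g x0)) as [L|L]; [lra|].
      exfalso; apply H1; now exists x. }
  assert (Hl : exists d, 0 < d /\ forall x, x0 - d < x -> g x0 - eps < g x).
  { destruct (classic (exists x1, g x1 < g x0)) as [[x1 H1]|H1].
    - destruct (Hs x1 x0 (Rmax (g x1) (g x0 - eps / 2))) as [x2 E].
      { split; [apply Rmax_l|]. apply Rmax_lub; lra. }
      assert (g x2 < g x0) by (rewrite E; apply Rmax_lub_lt; lra).
      assert (g x0 - eps / 2 <= g x2) by (rewrite E; apply Rmax_r).
      exists (x0 - x2). split.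
      + destruct (Rle_lt_dec x0 x2) as [L|L]; [apply Hm in L; lra | lra].
      + intros x Hx. assert (g x2 <= g x) by (apply Hm; lra). lra.
    - exists 1. split; [lra|]. intros x _.
      destruct (Rle_lt_dec (g x0) (g x)) as [L|L]; [lra|].
      exfalso; apply H1; now exists x. }
  destruct Hr as (d1 & Hd1 & H1), Hl as (d2 & Hd2 & H2).
  exists (Rmin d1 d2). split; [apply Rmin_glb_lt; lra|].
  intros x [_ Hx]. unfold dist in *; simpl in *. unfold R_dist in *.
  assert (Rmin d1 d2 <= d1) by apply Rmin_l.
  assert (Rmin d1 d2 <= d2) by apply Rmin_r.
  apply Rabs_def2 in Hx. apply Rabs_def1.
  - specialize (H1 x). lra.
  - specialize (H2 x). lra.
Qed.

Lemma asin_increasing x y : -1 <= x -> x < y -> y <= 1 -> asin x < asin y.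
Proof.
  intros. destruct (Rlt_le_dec (asin x) (asin y)) as [L|L]; [exact L|].
  pose proof (asin_bound x). pose proof (asin_bound y).
  assert (sin (asin y) <= sin (asin x)) by (apply sin_incr_1; lra).
  rewrite !sin_asin in *; lra.
Qed.

Lemma asin_le x y : -1 <= x -> x <= y -> y <= 1 -> asin x <= asin y.
Proof.
  intros ? [?| ->] ?; [|lra]. left. now apply asin_increasing.
Qed.

Lemma continuous_asin x : continuous asin x.
Proof.
  assert (Hlo : forall y, y <= -1 -> asin y = - (PI / 2)).
  { intros y Hy. unfold asin. destruct (Rle_dec y (-1)); lra. }
  assert (Hhi : forall y, 1 <= y -> asin y = PI / 2).
  { intros y Hy. unfold asin. destruct (Rle_dec y (-1)); [lra|].
    destruct (Rle_dec 1 y); lra. }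
  apply monotone_surjective_continuous.
  - intros y z Hyz. pose proof (asin_bound y). pose proof (asin_bound z).
    destruct (Rle_lt_dec y (-1)); [rewrite (Hlo y); lra|].
    destruct (Rle_lt_dec 1 z); [rewrite (Hhi z); lra|].
    apply asin_le; lra.
  - intros a b y H. exists (sin y). apply asin_sin.
    pose proof (asin_bound a). pose proof (asin_bound b). lra.
Qed.

Lemma is_derive_asin x : -1 < x < 1 -> is_derive asin x (/ sqrt (1 - x ^ 2)).
Proof.
  intros Hx. apply is_derive_Reals.
  replace (/ sqrt (1 - x ^ 2)) with (1 / sqrt (1 - Rsqr x))
    by (unfold Rdiv, Rsqr; simpl; rewrite Rmult_1_l, Rmult_1_r; reflexivity).
  apply (derive_pt_eq_1 _ _ _ (derivable_pt_asin x Hx)), derive_pt_asin.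
Qed.

(** * Planar curves with prescribed turning angle *)

Definition curve_of_angle (Phi : R -> R) (z0 s : R) : R3 :=
  (RInt (fun r => cos (Phi r)) 0 s, 0, z0 + RInt (fun r => sin (Phi r)) 0 s).

Section UnitSpeed.

Variables (Phi : R -> R) (z0 : R).
Hypothesis HPhi : forall s, continuous Phi s.

Let P := curve_of_angle Phi z0.

Lemma curve_of_angle_derive_x s : is_derive (fun r => xc (P r)) s (cos (Phi s)).
Proof.
  apply (is_derive_primitive (fun r => cos (Phi r))).
  intros r. apply continuous_cos_comp, HPhi.
Qed.

Lemma curve_of_angle_derive_z s : is_derive (fun r => zc (P r)) s (sin (Phi s)).
Proof.
  unfold P, curve_of_angle, zc; simpl.
  rewrite <- (Rplus_0_l (sin (Phi s))).
  apply der_plus; [apply der_const|].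
  apply (is_derive_primitive (fun r => sin (Phi r))).
  intros r. apply continuous_sin_comp, HPhi.
Qed.

(** The mean value theorem for the projection of the curve on a direction. *)
Lemma chord_component a b s s' :
  exists c, Rmin s s' <= c <= Rmax s s' /\
    a * (xc (P s') - xc (P s)) + b * (zc (P s') - zc (P s)) =
    (a * cos (Phi c) + b * sin (Phi c)) * (s' - s).
Proof.
  destruct (MVT_gen (fun r => a * xc (P r) + b * zc (P r)) s s'
    (fun c => a * cos (Phi c) + b * sin (Phi c))) as (c & Hc & E).
  - intros x _. eapply der_eq.
    + apply der_plus; (apply der_mult; [apply der_const|]).
      * apply curve_of_angle_derive_x.
      * apply curve_of_angle_derive_z.
    + simpl. ring.
  - intros x _. apply continuity_pt_continuous.
    cont.
    + eapply derive_continuous, curve_of_angle_derive_x.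
    + eapply derive_continuous, curve_of_angle_derive_z.
  - exists c. split; [exact Hc|]. lra.
Qed.

Lemma dist3_curve_of_angle_sq s s' :
  dist3 (P s) (P s') ^ 2 = (xc (P s') - xc (P s)) ^ 2 + (zc (P s') - zc (P s)) ^ 2.
Proof. rewrite dist3_sq. unfold P, curve_of_angle, yc; simpl. ring. Qed.

(** Project on the direction of the chord itself: the tangent has at most its length
    as projection. *)
Lemma chord_le_arc s s' : dist3 (P s) (P s') <= Rabs (s' - s).
Proof.
  pose proof (dist3_pos (P s) (P s')) as Hd.
  pose proof (dist3_curve_of_angle_sq s s') as Hsq.
  set (dx := xc (P s') - xc (P s)) in *. set (dz := zc (P s') - zc (P s)) in *.
  destruct (chord_component dx dz s s') as (c & _ & E). fold dx dz in E.
  set (d := dist3 (P s) (P s')) in *.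
  assert (Hv : Rabs (dx * cos (Phi c) + dz * sin (Phi c)) <= d).
  { rewrite <- (Rabs_pos_eq d Hd). apply Rsqr_le_abs_0.
    unfold Rsqr. pose proof (sin2_cos2 (Phi c)) as T. unfold Rsqr in T.
    assert (0 <= (dx * sin (Phi c) - dz * cos (Phi c)) ^ 2) by apply pow2_ge_0.
    nra. }
  assert (H : d * d <= d * Rabs (s' - s)).
  { replace (d * d) with (Rabs (d * d)) by (apply Rabs_pos_eq; nra).
    replace (d * d) with ((dx * cos (Phi c) + dz * sin (Phi c)) * (s' - s)) by nra.
    rewrite Rabs_mult. apply Rmult_le_compat_r; [apply Rabs_pos | exact Hv]. }
  pose proof (Rabs_pos (s' - s)). nra.
Qed.

(** On a short piece of the curve the tangent hardly turns, so the component of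
    the chord along the tangent at its start is almost the length of the piece. *)
Lemma arc_le_short_chord a b eps : 0 < eps ->
  exists delta, 0 < delta /\
    forall s s', a <= s <= b -> a <= s' <= b -> s <= s' -> s' - s < delta ->
      (1 - eps) * (s' - s) <= dist3 (P s) (P s').
Proof.
  intros Heps.
  assert (Hmin : 0 < Rmin 1 eps) by (apply Rmin_glb_lt; lra).
  destruct (@Heine_cor2 (fun s => cos (Phi s)) a b) with (eps := mkposreal _ Hmin)
    as [d1 H1].
  { intros. apply continuity_pt_continuous. apply continuous_cos_comp, HPhi. }
  destruct (@Heine_cor2 (fun s => sin (Phi s)) a b) with (eps := mkposreal _ Hmin)
    as [d2 H2].
  { intros. apply continuity_pt_continuous. apply continuous_sin_comp, HPhi. }
  simpl in H1, H2.
  exists (Rmin d1 d2). split; [apply Rmin_glb_lt; apply cond_pos|].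
  intros s s' Hs Hs' Hle Hlt.
  assert (Rmin d1 d2 <= d1) by apply Rmin_l.
  assert (Rmin d1 d2 <= d2) by apply Rmin_r.
  assert (Rmin 1 eps <= 1) by apply Rmin_l.
  assert (Rmin 1 eps <= eps) by apply Rmin_r.
  destruct (chord_component (cos (Phi s)) (sin (Phi s)) s s') as (c & Hc & E).
  rewrite Rmin_left, Rmax_right in Hc by lra.
  specialize (H1 c s). specialize (H2 c s).
  rewrite (Rabs_pos_eq (c - s)) in H1, H2 by lra.
  assert (K1 : Rabs (cos (Phi c) - cos (Phi s)) < Rmin 1 eps) by (apply H1; lra).
  assert (K2 : Rabs (sin (Phi c) - sin (Phi s)) < Rmin 1 eps) by (apply H2; lra).
  apply Rabs_def2 in K1, K2.
  pose proof (sin2_cos2 (Phi c)) as T1. pose proof (sin2_cos2 (Phi s)) as T2.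
  unfold Rsqr in T1, T2.
  assert (Hcos : 1 - eps <= cos (Phi s) * cos (Phi c) + sin (Phi s) * sin (Phi c)).
  { assert (Q : forall d, d < Rmin 1 eps -> - Rmin 1 eps < d -> d ^ 2 <= eps).
    { clear - H1 H2 Hmin. intros d L1 L2. pose proof (Rmin_l 1 eps).
      pose proof (Rmin_r 1 eps). set (e := Rmin 1 eps) in *. clearbody e.
      assert (0 <= (e - d) * (e + d)) by (apply Rmult_le_pos; lra).
      assert (0 <= e * (1 - e)) by (apply Rmult_le_pos; lra). lra. }
    destruct K1 as [K1 K1'], K2 as [K2 K2'].
    pose proof (Q _ K1 K1') as Q1. pose proof (Q _ K2 K2') as Q2. lra. }
  pose proof (dist3_pos (P s) (P s')) as Hd.
  pose proof (dist3_curve_of_angle_sq s s') as Hsq.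
  set (dx := xc (P s') - xc (P s)) in *. set (dz := zc (P s') - zc (P s)) in *.
  apply Rle_trans with (cos (Phi s) * dx + sin (Phi s) * dz).
  - rewrite E. apply Rmult_le_compat_r; lra.
  - apply Rsqr_incr_0_var; [|exact Hd]. unfold Rsqr.
    assert (0 <= (cos (Phi s) * dz - sin (Phi s) * dx) ^ 2) by apply pow2_ge_0.
    replace (dist3 (P s) (P s') * dist3 (P s) (P s'))
      with ((dx ^ 2 + dz ^ 2) * (sin (Phi s) * sin (Phi s) + cos (Phi s) * cos (Phi s)))
      by (rewrite T2, <- Hsq; ring). lra.
Qed.

End UnitSpeed.

Lemma sum_telescope (f : nat -> R) n :
  sum_f_R0 (fun i => f (S i) - f i) n = f (S n) - f 0%nat.
Proof. induction n as [|n IH]; simpl; [|rewrite IH]; ring. Qed.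

Lemma chain_monotone (p : nat -> R) n i j :
  (forall k, (k <= n)%nat -> p k <= p (S k)) -> (i <= j)%nat -> (j <= S n)%nat ->
  p i <= p j.
Proof.
  intros Hp Hij. induction Hij as [|j Hij IH]; intros Hj; [lra|].
  apply Rle_trans with (p j); [apply IH | apply Hp]; lia.
Qed.

Section ArcLength.

Variables (Phi : R -> R) (z0 : R).
Hypothesis HPhi : forall s, continuous Phi s.

Let P := curve_of_angle Phi z0.

Variables (c : R -> R3) (sigma inv : R -> R) (a b : R).
Hypothesis Hc : forall u, a <= u <= b -> c u = P (sigma u).
Hypothesis Hincr : forall u v, a <= u -> u < v -> v <= b -> sigma u < sigma v.
Hypothesis Hinv : forall y, sigma a <= y <= sigma b ->
  a <= inv y <= b /\ sigma (inv y) = y.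

Lemma reparam_le u v : a <= u -> u <= v -> v <= b -> sigma u <= sigma v.
Proof. intros ? [L | ->] ?; [left; now apply Hincr | lra]. Qed.

Lemma reparam_inv_le u y : sigma a <= y <= sigma b -> a <= u <= b ->
  (y <= sigma u <-> inv y <= u).
Proof.
  intros Hy Hu. destruct (Hinv y Hy) as [Hi E]. split; intros H.
  - destruct (Rle_lt_dec (inv y) u) as [L|L]; [exact L|].
    apply Hincr in L; lra.
  - rewrite <- E. apply reparam_le; lra.
Qed.

Lemma reparam_cancel u : a <= u <= b -> inv (sigma u) = u.
Proof.
  intros Hu.
  assert (Hs : sigma a <= sigma u <= sigma b) by (split; apply reparam_le; lra).
  destruct (Hinv _ Hs) as [Hi E].
  destruct (Rtotal_order (inv (sigma u)) u) as [L|[L|L]]; [|exact L|];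
    apply Hincr in L; lra.
Qed.

Lemma inscribed_le_arc d : inscribed_length c a b d -> d <= sigma b - sigma a.
Proof.
  intros (n & p & Ha & Hb & Hp & ->).
  rewrite <- Ha, <- Hb, <- (sum_telescope (fun i => sigma (p i))).
  apply sum_Rle. intros i Hi.
  assert (a <= p i) by (rewrite <- Ha; apply (chain_monotone p n); auto; lia).
  assert (p (S i) <= b) by (rewrite <- Hb; apply (chain_monotone p n); auto; lia).
  pose proof (Hp i Hi).
  rewrite !Hc by lra. eapply Rle_trans; [apply chord_le_arc, HPhi|].
  rewrite Rabs_pos_eq; [lra|]. pose proof (reparam_le (p i) (p (S i))). lra.
Qed.

(** Vertices equally spaced with respect to the arclength parameter make all
    chords short, hence almost as long as their arcs. *)
Lemma arc_le_inscribed eps : a <= b -> 0 < eps ->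
  exists d, inscribed_length c a b d /\ (1 - eps) * (sigma b - sigma a) <= d.
Proof.
  intros Hab Heps.
  destruct (arc_le_short_chord Phi z0 HPhi (sigma a) (sigma b) eps Heps)
    as (delta & Hdelta & Hch).
  assert (HL : 0 <= sigma b - sigma a) by (pose proof (reparam_le a b); lra).
  set (L := sigma b - sigma a) in *.
  destruct (nfloor_ex (L / delta)) as [n [_ Hn]].
  { apply Rdiv_le_0_compat; lra. }
  assert (HN : 0 < INR (S n)) by (apply lt_0_INR; lia).
  set (y := fun i => sigma a + INR i * (L / INR (S n))).
  assert (Hstep : forall i, y (S i) - y i = L / INR (S n)).
  { intros i. unfold y. rewrite (S_INR i). ring. }
  assert (Hq : 0 <= L / INR (S n)) by (apply Rdiv_le_0_compat; lra).
  assert (Hy0 : y 0%nat = sigma a) by (unfold y; simpl; ring).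
  assert (Hyn : y (S n) = sigma b) by (unfold y, L; field; lra).
  assert (Hyr : forall i, (i <= S n)%nat -> sigma a <= y i <= sigma b).
  { intros i Hi. rewrite <- Hy0 at 1. rewrite <- Hyn.
    assert (Hs : forall k, (k <= n)%nat -> y k <= y (S k))
      by (intros k _; pose proof (Hstep k); lra).
    split; apply (chain_monotone y n); auto; lia. }
  exists (sum_f_R0 (fun i => dist3 (c (inv (y i))) (c (inv (y (S i))))) n). split.
  - exists n, (fun i => inv (y i)). repeat split.
    + rewrite Hy0. apply reparam_cancel. lra.
    + rewrite Hyn. apply reparam_cancel. lra.
    + intros i Hi. destruct (Hinv (y i)) as [? E]; [apply Hyr; lia|].
      destruct (Hinv (y (S i))) as [? E']; [apply Hyr; lia|].
      apply reparam_inv_le; [apply Hyr; lia | lra |].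
      rewrite E'. pose proof (Hstep i). lra.
  - assert (EL : L = sum_f_R0 (fun i => y (S i) - y i) n)
      by (rewrite sum_telescope; unfold L; lra).
    rewrite EL, scal_sum.
    apply sum_Rle. intros i Hi.
    destruct (Hinv (y i)) as [? E]; [apply Hyr; lia|].
    destruct (Hinv (y (S i))) as [? E']; [apply Hyr; lia|].
    rewrite !Hc by lra. rewrite E, E', Rmult_comm.
    pose proof (Hstep i). apply Hch; try (apply Hyr; lia); [lra|].
    rewrite Hstep. apply Rmult_lt_reg_r with (INR (S n)); [exact HN|].
    unfold Rdiv. rewrite Rmult_assoc, Rinv_l, Rmult_1_r by lra.
    rewrite S_INR. apply Rmult_lt_compat_r with (r := delta) in Hn; [|exact Hdelta].
    unfold Rdiv in Hn. rewrite Rmult_assoc, Rinv_l, Rmult_1_r in Hn by lra. lra.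
Qed.

Lemma arc_length_reparam : a <= b -> arc_length c a b = Finite (sigma b - sigma a).
Proof.
  intros Hab. apply is_lub_Rbar_unique. split.
  - intros d Hd. now apply inscribed_le_arc.
  - intros M HM.
    assert (HL : 0 <= sigma b - sigma a) by (pose proof (reparam_le a b); lra).
    destruct M as [m| |]; [|exact I|].
    + simpl. apply le_epsilon. intros eps Heps.
      set (L := sigma b - sigma a) in *.
      destruct (arc_le_inscribed (eps / (L + 1)) Hab) as (d & Hd & Hle).
      { apply Rdiv_lt_0_compat; lra. }
      fold L in Hle. apply HM in Hd. simpl in Hd.
      assert (eps / (L + 1) * L <= eps).
      { apply Rmult_le_reg_r with (L + 1); [lra|].
        replace (eps / (L + 1) * L * (L + 1)) with (eps * L) by (field; lra). nra. }
      lra.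
    + destruct (arc_le_inscribed 1 Hab Rlt_0_1) as (d & Hd & _).
      apply HM in Hd. destruct Hd.
Qed.

End ArcLength.

(** The length up to u is sigma u - sigma a, so the parameter selected at length s is
    the preimage of sigma a + s. *)
Lemma by_arclength_reparam Phi z0 c sigma inv a b s :
  (forall r, continuous Phi r) -> a <= b ->
  (forall u, a <= u <= b -> c u = curve_of_angle Phi z0 (sigma u)) ->
  (forall u v, a <= u -> u < v -> v <= b -> sigma u < sigma v) ->
  (forall y, sigma a <= y <= sigma b -> a <= inv y <= b /\ sigma (inv y) = y) ->
  0 <= s <= sigma b - sigma a ->
  by_arclength c a b s = curve_of_angle Phi z0 (sigma a + s).
Proof.
  intros HPhi Hab Hc Hincr Hinv Hs. unfold by_arclength.
  assert (Hy : sigma a <= sigma a + s <= sigma b) by lra.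
  destruct (Hinv _ Hy) as [Hi E].
  assert (Hlen : forall u, a <= u <= b -> arc_length c a u = Finite (sigma u - sigma a)).
  { intros u Hu. apply (arc_length_reparam Phi z0 HPhi c sigma inv a u); try lra.
    - intros v Hv. apply Hc. lra.
    - intros v w ? ? ?. apply Hincr; lra.
    - intros y Hyu.
      assert (Hub : sigma u <= sigma b) by (apply (reparam_le sigma a b Hincr); lra).
      destruct (Hinv y) as [Hiy Ey]; [lra|].
      split; [|exact Ey]. split; [lra|].
      apply (reparam_inv_le sigma inv a b Hincr Hinv); lra. }
  rewrite (is_glb_Rbar_unique _ (Finite (inv (sigma a + s)))).
  - simpl. rewrite Hc by exact Hi. now rewrite E.
  - split.
    + intros u [Hu Hsu]. rewrite Hlen in Hsu by exact Hu. simpl in *.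
      apply (reparam_inv_le sigma inv a b Hincr Hinv); lra.
    + intros M HM. apply HM. split; [exact Hi|]. rewrite Hlen, E by exact Hi. simpl. lra.
Qed.

Lemma arc_length_sym c a b : arc_length (fun u => sym (c u)) a b = arc_length c a b.
Proof.
  apply Lub_Rbar_eqset. intros d.
  split; intros (n & p & Ha & Hb & Hp & ->); exists n, p; repeat split; auto;
    apply sum_eq; intros i _; [|symmetry]; apply dist3_sym_sym.
Qed.

Lemma by_arclength_sym c a b s :
  by_arclength (fun u => sym (c u)) a b s = sym (by_arclength c a b s).
Proof.
  unfold by_arclength. do 3 f_equal. apply Glb_Rbar_eqset. intros u.
  now rewrite arc_length_sym.
Qed.

(** * The radius of curvature *)

Lemma inv_kappa_eq tau u :
  inv_kappa tau u =
  (1 - (tau - Rabs u) ^ 2 + (tau - Rabs u) * Rabs u * (1 - u ^ 2)) /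
  sqrt ((1 - u ^ 2 * (tau - Rabs u) ^ 2) ^ 3 * (1 - (tau - Rabs u) ^ 2)).
Proof.
  unfold inv_kappa, kappa.
  destruct (Req_EM_T _ 0) as [E|E]; simpl Rbar_inv; unfold real.
  - rewrite E. unfold Rdiv. ring.
  - apply Rinv_div.
Qed.

Lemma inv_kappa_opp tau u : inv_kappa tau (- u) = inv_kappa tau u.
Proof.
  rewrite !inv_kappa_eq, Rabs_Ropp.
  now replace ((- u) ^ 2) with (u ^ 2) by ring.
Qed.

Lemma x_gamma_opp tau u : x_gamma tau (- u) = - x_gamma tau u.
Proof.
  unfold x_gamma. rewrite Rabs_Ropp.
  replace ((- u) ^ 2) with (u ^ 2) by ring. unfold Rdiv. ring.
Qed.

Section Radius.

Variable tau : R.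
Hypothesis Htau : 0 <= tau <= 1.

Lemma strut_root_pos u : Rabs u <= 1 -> (Rabs u < 1 \/ 0 < tau) ->
  0 < 1 - u ^ 2 * (tau - Rabs u) ^ 2.
Proof.
  intros Hu H. rewrite <- (pow2_abs u). pose proof (Rabs_pos u).
  set (v := Rabs u) in *. clearbody v. set (a := tau - v).
  assert (Ha : -1 <= a <= 1) by (unfold a; lra).
  assert (-1 < v * a < 1).
  { destruct (Rle_lt_dec 1 v); [unfold a; nra|].
    split; nra. }
  nra.
Qed.

Lemma conjugate_root_pos u : Rabs u <= 1 -> (Rabs u < 1 \/ 0 < tau) ->
  (tau < 1 \/ u <> 0) -> 0 < 1 - (tau - Rabs u) ^ 2.
Proof.
  intros Hu H H'.
  assert (tau - Rabs u < 1).
  { destruct H' as [H'|H']; [pose proof (Rabs_pos u); lra|].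
    apply Rabs_pos_lt in H'. lra. }
  assert (-1 < tau - Rabs u) by lra. nra.
Qed.

Lemma inv_kappa_pos u : Rabs u <= tau -> (tau < 1 \/ u <> 0) -> 0 < inv_kappa tau u.
Proof.
  intros Hu H. rewrite inv_kappa_eq.
  assert (Hb : Rabs u < 1 \/ 0 < tau) by lra.
  pose proof (strut_root_pos u) as HB. pose proof (conjugate_root_pos u) as HA.
  assert (HA' : 0 < 1 - (tau - Rabs u) ^ 2) by (apply HA; lra).
  assert (HB' : 0 < 1 - u ^ 2 * (tau - Rabs u) ^ 2) by (apply HB; lra).
  apply Rdiv_lt_0_compat.
  - pose proof (Rabs_pos u).
    assert (0 <= (tau - Rabs u) * Rabs u) by (apply Rmult_le_pos; lra).
    assert (0 <= 1 - u ^ 2) by (rewrite <- (pow2_abs u); nra).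
    assert (0 <= (tau - Rabs u) * Rabs u * (1 - u ^ 2)) by now apply Rmult_le_pos.
    lra.
  - apply sqrt_lt_R0, Rmult_lt_0_compat; [apply pow_lt|]; assumption.
Qed.

Lemma inv_kappa_singular : inv_kappa 1 0 = 0.
Proof. rewrite inv_kappa_eq, Rabs_R0. unfold Rdiv. ring. Qed.

Lemma inv_kappa_nonneg u : Rabs u <= tau -> 0 <= inv_kappa tau u.
Proof.
  intros Hu. destruct (Req_dec u 0) as [E|E]; [|left; now apply inv_kappa_pos; auto].
  destruct (Rlt_le_dec tau 1) as [L|L]; [left; now apply inv_kappa_pos; auto|].
  subst u. replace tau with 1 by lra. rewrite inv_kappa_singular. lra.
Qed.

(** At the ends of the curved part the strut goes to the tip of the other arc, whose sine
    tau - |u| is 0, and the dependence on tau disappears. *)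
Lemma inv_kappa_end u : Rabs u = tau -> inv_kappa tau u = 1.
Proof.
  intros Hu. rewrite inv_kappa_eq, Hu.
  replace ((1 - u ^ 2 * (tau - tau) ^ 2) ^ 3 * (1 - (tau - tau) ^ 2)) with 1 by ring.
  rewrite sqrt_1. field.
Qed.

(** Continuity at the tip for tau = 1: as u tends to 0 the numerator of 1 / kappa is of
    the order of |u| and the denominator of the order of its square root. *)
Lemma inv_kappa_singular_bound u : Rabs u <= 1 / 2 ->
  Rabs (inv_kappa 1 u) <= 6 * sqrt (Rabs u).
Proof.
  intros Hu. rewrite inv_kappa_eq, <- (pow2_abs u).
  pose proof (Rabs_pos u) as H0. set (v := Rabs u) in *. clearbody v. clear u.
  destruct (Req_dec v 0) as [->|Hv0].
  { replace (_ / _) with 0 by (unfold Rdiv; ring). rewrite Rabs_R0.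
    pose proof (sqrt_pos 0). lra. }
  assert (Hv : 0 < sqrt v) by (apply sqrt_lt_R0; lra).
  assert (Hvv : sqrt v * sqrt v = v) by (apply sqrt_sqrt; lra).
  (* The radicand is at least v / 4, since its cubed factor is at least 27 / 64. *)
  assert (Hs : sqrt v / 2 <= sqrt ((1 - v ^ 2 * (1 - v) ^ 2) ^ 3 * (1 - (1 - v) ^ 2))).
  { replace (sqrt v / 2) with (sqrt (v * (1 / 4))).
    2: { rewrite sqrt_mult by lra. replace (1 / 4) with ((1 / 2) * (1 / 2)) by field.
         rewrite sqrt_square by lra. field. }
    apply sqrt_le_1_alt. rewrite Rmult_comm.
    apply Rmult_le_compat; try lra.
    - replace (1 / 4) with (1 / 4 * 1 ^ 3) by ring.
      assert (Hb : 3 / 4 <= 1 - v ^ 2 * (1 - v) ^ 2).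
      { assert (0 <= v * (1 - v) <= 1 / 2) by nra.
        replace (v ^ 2 * (1 - v) ^ 2) with ((v * (1 - v)) ^ 2) by ring. nra. }
      apply Rle_trans with ((3 / 4) ^ 3); [lra|]. apply pow_incr. lra.
    - nra. }
  rewrite Rabs_pos_eq.
  2: { apply Rdiv_le_0_compat; [|lra].
       assert (0 <= (1 - v) * v * (1 - v ^ 2)) by (apply Rmult_le_pos; nra). nra. }
  apply Rmult_le_reg_r with (sqrt ((1 - v ^ 2 * (1 - v) ^ 2) ^ 3 * (1 - (1 - v) ^ 2)));
    [lra|].
  unfold Rdiv. rewrite Rmult_assoc, Rinv_l, Rmult_1_r by lra.
  apply Rle_trans with (6 * sqrt v * (sqrt v / 2)); [|apply Rmult_le_compat_l; lra].
  replace (6 * sqrt v * (sqrt v / 2)) with (3 * (sqrt v * sqrt v)) by field.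
  rewrite Hvv. nra.
Qed.

Lemma continuous_inv_kappa u : Rabs u <= 1 -> (Rabs u < 1 \/ 0 < tau) ->
  continuous (inv_kappa tau) u.
Proof.
  intros Hu H.
  destruct (classic (tau < 1 \/ u <> 0)) as [Hr|Hs].
  - eapply continuous_ext; [intros v; symmetry; apply inv_kappa_eq|].
    cont. apply Rgt_not_eq, sqrt_lt_R0, Rmult_lt_0_compat.
    + apply pow_lt. now apply strut_root_pos.
    + now apply conjugate_root_pos.
  - assert (u = 0) by (destruct (Req_dec u 0); tauto).
    assert (tau = 1) by (destruct (Rlt_le_dec tau 1); [tauto | lra]).
    subst u tau. apply continuity_pt_filterlim. intros eps Heps.
    exists (Rmin (1 / 2) ((eps / 6) ^ 2)). split.
    { apply Rmin_glb_lt; [lra|]. apply pow_lt. lra. }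
    intros v [_ Hv]. unfold dist in *; simpl in *; unfold R_dist in *.
    rewrite Rminus_0_r in Hv. rewrite inv_kappa_singular, Rminus_0_r.
    assert (Hv1 : Rabs v < 1 / 2) by (eapply Rlt_le_trans; [exact Hv | apply Rmin_l]).
    assert (Hv2 : Rabs v < (eps / 6) ^ 2).
    { eapply Rlt_le_trans; [exact Hv|]. simpl. apply Rmin_r. }
    eapply Rle_lt_trans; [apply inv_kappa_singular_bound; lra|].
    assert (sqrt (Rabs v) < eps / 6).
    { rewrite <- (sqrt_pow2 (eps / 6)) by lra. apply sqrt_lt_1_alt.
      split; [apply Rabs_pos | exact Hv2]. }
    lra.
Qed.

Lemma is_derive_x_gamma_pos u : 0 < u < 1 ->
  is_derive (x_gamma tau) u (inv_kappa tau u).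
Proof.
  intros Hu.
  assert (Ea : Rabs u = u) by (apply Rabs_pos_eq; lra).
  assert (HA : 0 < 1 - (tau - u) ^ 2).
  { rewrite <- Ea. apply conjugate_root_pos; rewrite ?Ea; lra. }
  assert (HB : 0 < 1 - u ^ 2 * (tau - u) ^ 2).
  { rewrite <- Ea at 2. apply strut_root_pos; rewrite ?Ea; lra. }
  apply (is_derive_ext_loc
    (fun v => v * sqrt (1 - (tau - v) ^ 2) / sqrt (1 - v ^ 2 * (tau - v) ^ 2))).
  { exists (mkposreal u (proj1 Hu)). intros v Hv.
    apply Rabs_def2 in Hv. unfold minus, plus, opp in Hv; simpl in Hv.
    unfold x_gamma. now rewrite (Rabs_pos_eq v) by lra. }
  pose proof (sqrt_lt_R0 _ HA) as Hp. pose proof (sqrt_lt_R0 _ HB) as Hq.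
  rewrite inv_kappa_eq, Ea.
  rewrite sqrt_mult by (try apply pow_le; lra).
  replace (sqrt ((1 - u ^ 2 * (tau - u) ^ 2) ^ 3))
    with (sqrt (1 - u ^ 2 * (tau - u) ^ 2) ^ 3).
  2: { symmetry. apply sqrt_lem_1; [apply pow_le; lra | apply pow_le; lra |].
       rewrite <- Rpow_mult_distr, sqrt_sqrt by lra. reflexivity. }
  auto_derive.
  - replace (1 - (tau - u) ^ 2) with (1 + - ((tau + - u) * ((tau + - u) * 1))) in HA, Hp by ring.
    replace (1 - u ^ 2 * (tau - u) ^ 2)
      with (1 + - (u * (u * 1) * ((tau + - u) * ((tau + - u) * 1)))) in HB, Hq by ring.
    repeat split; lra.
  - assert (Ep : sqrt (1 - (tau - u) ^ 2) ^ 2 = 1 - (tau - u) ^ 2)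
      by (apply pow2_sqrt; lra).
    assert (Eq : sqrt (1 - u ^ 2 * (tau - u) ^ 2) ^ 2 = 1 - u ^ 2 * (tau - u) ^ 2)
      by (apply pow2_sqrt; lra).
    replace ((1 + - ((tau + - u) * ((tau + - u) * 1)))) with (1 - (tau - u) ^ 2) by ring.
    replace ((1 + - (u * (u * 1) * ((tau + - u) * ((tau + - u) * 1)))))
      with (1 - u ^ 2 * (tau - u) ^ 2) by ring.
    set (p := sqrt (1 - (tau - u) ^ 2)) in *.
    set (q := sqrt (1 - u ^ 2 * (tau - u) ^ 2)) in *.
    transitivity ((q ^ 2 * (p ^ 2 + u * (tau - u))
      + u * p ^ 2 * (u * (tau - u) ^ 2 - u ^ 2 * (tau - u))) / (q ^ 3 * p)).
    + field. lra.
    + rewrite Ep, Eq. f_equal. ring.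
Qed.

Lemma continuous_x_gamma u : Rabs u <= 1 -> (Rabs u < 1 \/ 0 < tau) ->
  continuous (x_gamma tau) u.
Proof.
  intros Hu H. unfold x_gamma. cont.
  apply Rgt_not_eq, sqrt_lt_R0. now apply strut_root_pos.
Qed.

Lemma is_derive_x_gamma u : Rabs u < 1 -> is_derive (x_gamma tau) u (inv_kappa tau u).
Proof.
  intros Hu. apply Rabs_def2 in Hu.
  destruct (Rtotal_order u 0) as [L|[->|L]].
  - apply (is_derive_ext (fun v => - x_gamma tau (- v))).
    { intros v. rewrite x_gamma_opp. apply Ropp_involutive. }
    eapply der_eq.
    + apply der_opp. apply (der_comp (fun v => - v) u (- (1))).
      * apply der_neg.
      * apply is_derive_x_gamma_pos. lra.
    + rewrite inv_kappa_opp. ring.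
  - (* The function is u times a function that is merely continuous at 0. *)
    set (f := fun v => sqrt (1 - (tau - Rabs v) ^ 2)
                       / sqrt (1 - v ^ 2 * (tau - Rabs v) ^ 2)).
    assert (Hf : continuous f 0).
    { unfold f. cont. apply Rgt_not_eq, sqrt_lt_R0.
      apply strut_root_pos; rewrite Rabs_R0; lra. }
    assert (E : inv_kappa tau 0 = f 0).
    { rewrite inv_kappa_eq. unfold f. rewrite Rabs_R0.
      replace (1 - 0 ^ 2 * (tau - 0) ^ 2) with 1 by ring.
      replace (1 ^ 3 * (1 - (tau - 0) ^ 2)) with (1 - tau ^ 2) by ring.
      rewrite sqrt_1, !Rminus_0_r.
      replace (1 - tau ^ 2 + tau * 0 * (1 - 0 ^ 2)) with (1 - tau ^ 2) by ring.
      destruct (Req_dec (1 - tau ^ 2) 0) as [Z|Z].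
      - rewrite Z, sqrt_0. unfold Rdiv. ring.
      - assert (0 < 1 - tau ^ 2) by nra.
        pose proof (sqrt_lt_R0 _ H).
        rewrite <- (pow2_sqrt (1 - tau ^ 2)) at 1 by lra. field. lra. }
    rewrite E. apply is_derive_Reals. intros eps Heps.
    apply continuity_pt_filterlim in Hf. destruct (Hf eps Heps) as (d & Hd & H).
    exists (mkposreal d Hd). intros h Hh Hhd. simpl in Hhd.
    specialize (H h). unfold dist in H; simpl in H; unfold R_dist in H.
    rewrite Rminus_0_r in H.
    replace ((x_gamma tau (0 + h) - x_gamma tau 0) / h) with (f h).
    + apply H. split; [|exact Hhd]. split; [exact I|]. now apply not_eq_sym.
    + unfold x_gamma, f. rewrite Rplus_0_l. unfold Rdiv. rewrite !Rmult_0_l, Rminus_0_r.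
      set (r := / sqrt _). clearbody r. field. exact Hh.
  - apply is_derive_x_gamma_pos. lra.
Qed.

End Radius.

Lemma kappa_of_inv tau u : inv_kappa tau u <> 0 -> kappa tau u = Finite (/ inv_kappa tau u).
Proof.
  unfold inv_kappa. destruct (kappa tau u); simpl; [|tauto|tauto].
  now rewrite Rinv_inv.
Qed.

Lemma kappa_singular : kappa 1 0 = p_infty.
Proof.
  unfold kappa. rewrite Rabs_R0.
  destruct (Req_EM_T _ 0) as [E|E]; [reflexivity|]. exfalso; apply E; ring.
Qed.

(** * Clamping *)

Definition clamp (m w : R) : R := Rmax (- m) (Rmin m w).

Section Clamp.
Variable m : R.
Hypothesis Hm : 0 <= m.

Ltac clamp := unfold clamp, Rmax, Rmin; repeat destruct Rle_dec; try lra.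

Lemma clamp_bounds w : - m <= clamp m w <= m.
Proof. clamp. Qed.

Lemma clamp_id w : - m <= w <= m -> clamp m w = w.
Proof. clamp. Qed.

Lemma clamp_ge w : m <= w -> clamp m w = m.
Proof. clamp. Qed.

Lemma clamp_opp w : clamp m (- w) = - clamp m w.
Proof. clamp. Qed.

Lemma clamp_incr v w : v <= w -> clamp m v <= clamp m w.
Proof. clamp. Qed.

Lemma clamp_incr_excess v w : v <= w -> v - clamp m v <= w - clamp m w.
Proof. clamp. Qed.

Lemma clamp_nonneg w : 0 <= w -> 0 <= clamp m w.
Proof. clamp. Qed.

Lemma clamp_eq0 w : 0 < m -> clamp m w = 0 -> w = 0.
Proof. clamp. Qed.

Lemma continuous_clamp w : continuous (clamp m) w.
Proof.
  apply monotone_surjective_continuous; [exact clamp_incr|].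
  intros a b y H. exists y. apply clamp_id.
  pose proof (clamp_bounds a). pose proof (clamp_bounds b). lra.
Qed.
End Clamp.

Section OddPrimitives.
Variable f : R -> R.
Hypothesis Hf : forall x, continuous f x.

Lemma RInt_zero a : RInt f a a = 0.
Proof. apply (RInt_point (V := R_CompleteNormedModule)). Qed.

(** The factor e is 1 for even and -1 for odd f. *)
Lemma primitive_symmetry e x : e = 1 \/ e = -1 ->
  (forall y, f (- y) = e * f y) -> RInt f 0 (- x) = - (e * RInt f 0 x).
Proof.
  intros He Hs.
  assert (D : forall y : R, is_derive (fun y => RInt f 0 (- y) + e * RInt f 0 y) y 0).
  { intros y. eapply der_eq.
    - apply der_plus.
      + apply (der_comp (fun y => - y) y (- (1)) (fun y => RInt f 0 y));
          [apply der_neg | now apply is_derive_primitive].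
      + apply der_mult; [apply der_const | now apply is_derive_primitive].
    - simpl. rewrite Hs. ring. }
  assert (E : RInt f 0 (- 0) + e * RInt f 0 0 = RInt f 0 (- x) + e * RInt f 0 x).
  { destruct (Rle_lt_dec 0 x) as [L|L]; [|symmetry];
      apply (eq_of_derive_zero (fun y => RInt f 0 (- y) + e * RInt f 0 y)); try lra;
      intros; try apply D; eapply derive_continuous, D. }
  rewrite Ropp_0, RInt_zero in E. lra.
Qed.
End OddPrimitives.

(** * The clasp arc parametrized by its turning angle *)

Section ClaspArc.

Variable tau : R.
Hypothesis Htau : 0 <= tau <= 1.

Definition max_angle : R := asin tau.
Notation alpha := max_angle.

Lemma max_angle_bounds : 0 <= alpha <= PI / 2.
Proof.
  unfold alpha. pose proof (asin_bound tau).
  assert (asin 0 <= asin tau) by (apply asin_le; lra). rewrite asin_0 in *. lra.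
Qed.

Lemma sin_max_angle : sin alpha = tau.
Proof. apply sin_asin. lra. Qed.

Lemma cos_max_angle : cos alpha = sqrt (1 - tau ^ 2).
Proof.
  unfold alpha. rewrite cos_asin by lra. f_equal. unfold Rsqr. ring.
Qed.

Lemma asin_le_max_angle u : - tau <= u <= tau -> - alpha <= asin u <= alpha.
Proof.
  intros Hu. unfold alpha. rewrite <- asin_opp. split; apply asin_le; lra.
Qed.

Lemma sin_le_tau w : - alpha <= w <= alpha -> - tau <= sin w <= tau.
Proof.
  intros Hw. pose proof max_angle_bounds.
  rewrite <- sin_max_angle, <- sin_antisym. split; apply sin_incr_1; lra.
Qed.

Lemma sin_abs_le_tau w : - alpha <= w <= alpha -> Rabs (sin w) <= tau.
Proof. intros Hw. apply Rabs_le. now apply sin_le_tau. Qed.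

(** Radius of curvature as a function of the turning angle, continued by the
    value 1 that it takes at both ends of the curved part. *)
Definition radius (w : R) : R := inv_kappa tau (sin (clamp alpha w)).

Lemma clamp_max_angle w : - alpha <= clamp alpha w <= alpha.
Proof. apply clamp_bounds, max_angle_bounds. Qed.

Lemma continuous_radius w : continuous radius w.
Proof.
  unfold radius.
  apply (cont_comp (fun w => sin (clamp alpha w)) w (inv_kappa tau)).
  - apply continuous_sin_comp, continuous_clamp, max_angle_bounds.
  - pose proof (sin_abs_le_tau _ (clamp_max_angle w)).
    apply continuous_inv_kappa; lra.
Qed.

Lemma radius_nonneg w : 0 <= radius w.
Proof. apply inv_kappa_nonneg; [exact Htau|]. apply sin_abs_le_tau, clamp_max_angle. Qed.

Lemma radius_pos w : w <> 0 -> 0 < radius w.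
Proof.
  intros Hw. apply inv_kappa_pos; [exact Htau | apply sin_abs_le_tau, clamp_max_angle |].
  destruct (Rlt_le_dec tau 1) as [L|L]; [now left|right]. intros E.
  assert (Ea : alpha = PI / 2).
  { unfold alpha. replace tau with 1 by lra. apply asin_1. }
  pose proof PI_RGT_0. apply Hw.
  apply (clamp_eq0 alpha); [lra|].
  assert (- (PI / 2) <= clamp alpha w <= PI / 2) by (rewrite <- Ea; apply clamp_max_angle).
  rewrite <- (asin_sin (clamp alpha w)) by lra. rewrite E. apply asin_0.
Qed.

Lemma radius_inside w : - alpha <= w <= alpha -> radius w = inv_kappa tau (sin w).
Proof. intros Hw. unfold radius. rewrite clamp_id by exact Hw. reflexivity. Qed.

Lemma radius_opp w : radius (- w) = radius w.
Proof.
  unfold radius. rewrite clamp_opp, sin_antisym, inv_kappa_opp by apply max_angle_bounds.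
  reflexivity.
Qed.

Lemma radius_outside w : alpha <= w -> radius w = 1.
Proof.
  intros Hw. unfold radius. rewrite clamp_ge, sin_max_angle by
    (try apply max_angle_bounds; exact Hw).
  apply inv_kappa_end. apply Rabs_pos_eq. lra.
Qed.

Definition arc_at (w : R) : R := RInt radius 0 w.

Lemma is_derive_arc_at w : is_derive arc_at w (radius w).
Proof. apply is_derive_primitive, continuous_radius. Qed.

(** The radius vanishes at most at w = 0, which no interval on one side of 0 contains
    in its interior. *)
Lemma arc_at_incr v w : v < w -> arc_at v < arc_at w.
Proof.
  assert (H : forall v w, v < w -> (0 <= v \/ w <= 0) -> arc_at v < arc_at w).
  { clear v w. intros v w Hvw H0.
    destruct (mean_value arc_at radius v w Hvw) as (c & Hc & E).
    - intros. apply is_derive_arc_at.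
    - intros x _. eapply derive_continuous, is_derive_arc_at.
    - assert (0 < radius c) by (apply radius_pos; lra). nra. }
  intros Hvw. destruct (Rle_lt_dec 0 v); [apply H; lra|].
  destruct (Rle_lt_dec w 0); [apply H; lra|].
  apply Rlt_trans with (arc_at 0); apply H; lra.
Qed.

Lemma arc_at_le v w : v <= w -> arc_at v <= arc_at w.
Proof. intros [L| ->]; [left; now apply arc_at_incr | lra]. Qed.

Lemma arc_at_inj v w : arc_at v = arc_at w -> v = w.
Proof.
  intros E. destruct (Rtotal_order v w) as [L|[L|L]]; [|exact L|];
    apply arc_at_incr in L; lra.
Qed.

Lemma arc_at_0 : arc_at 0 = 0.
Proof. apply RInt_zero. Qed.

Lemma arc_at_opp w : arc_at (- w) = - arc_at w.
Proof.
  unfold arc_at. rewrite (primitive_symmetry radius continuous_radius 1); [ring | now left |].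
  intros y. rewrite radius_opp. ring.
Qed.

Lemma arc_at_outside w : alpha <= w -> arc_at w = arc_at alpha + (w - alpha).
Proof.
  intros Hw.
  assert (E : arc_at alpha - alpha = arc_at w - w).
  { apply (eq_of_derive_zero (fun w => arc_at w - w)); [exact Hw | |].
    - intros x Hx. eapply der_eq.
      + apply der_minus; [apply is_derive_arc_at | apply der_id].
      + rewrite radius_outside by lra. ring.
    - intros x _. cont. eapply derive_continuous, is_derive_arc_at. }
  lra.
Qed.

Lemma arc_at_surjective s : { w | arc_at w = s }.
Proof.
  pose proof max_angle_bounds as Ha. pose proof (Rabs_pos s) as H0.
  assert (H : Rabs s <= arc_at (alpha + Rabs s)).
  { rewrite arc_at_outside by lra.
    assert (arc_at 0 <= arc_at alpha) by (apply arc_at_le; lra).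
    rewrite arc_at_0 in *. lra. }
  destruct (IVT_gen arc_at (- (alpha + Rabs s)) (alpha + Rabs s) s) as [w [_ E]].
  - intros x. apply continuity_pt_continuous. eapply derive_continuous, is_derive_arc_at.
  - rewrite arc_at_opp, Rmin_left, Rmax_right by lra.
    split; [|eapply Rle_trans; [apply Rle_abs | exact H]].
    pose proof (Rle_abs (- s)). rewrite Rabs_Ropp in *. lra.
  - now exists w.
Qed.

Definition angle_at (s : R) : R := proj1_sig (arc_at_surjective s).

Lemma arc_at_angle_at s : arc_at (angle_at s) = s.
Proof. apply (proj2_sig (arc_at_surjective s)). Qed.

Lemma angle_at_arc_at w : angle_at (arc_at w) = w.
Proof. apply arc_at_inj, arc_at_angle_at. Qed.

Lemma angle_at_le s r : s <= r <-> angle_at s <= angle_at r.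
Proof.
  split; intros H.
  - destruct (Rle_lt_dec (angle_at s) (angle_at r)) as [L|L]; [exact L|].
    apply arc_at_incr in L. rewrite !arc_at_angle_at in L. lra.
  - apply arc_at_le in H. now rewrite !arc_at_angle_at in H.
Qed.

Lemma continuous_angle_at s : continuous angle_at s.
Proof.
  apply monotone_surjective_continuous.
  - intros x y H. now apply (proj1 (angle_at_le x y)).
  - intros a b y _. exists (arc_at y). apply angle_at_arc_at.
Qed.

Lemma angle_at_opp s : angle_at (- s) = - angle_at s.
Proof. apply arc_at_inj. now rewrite arc_at_opp, !arc_at_angle_at. Qed.

(** Angle of the tangent as a function of arclength; beyond the curved part the
    parameter [angle_at] keeps growing with unit speed, but the tangent is constant. *)
Definition turning (s : R) : R := clamp alpha (angle_at s).

Lemma turning_eq s : turning s = clamp alpha (angle_at s).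
Proof. reflexivity. Qed.

Lemma arc_at_eq w : arc_at w = RInt radius 0 w.
Proof. reflexivity. Qed.

Lemma turning_arc_at w : turning (arc_at w) = clamp alpha w.
Proof. unfold turning. now rewrite angle_at_arc_at. Qed.

Lemma continuous_turning s : continuous turning s.
Proof.
  apply (cont_comp angle_at s (clamp alpha)); [apply continuous_angle_at|].
  apply continuous_clamp, max_angle_bounds.
Qed.

Lemma turning_opp s : turning (- s) = - turning s.
Proof. unfold turning. rewrite angle_at_opp. apply clamp_opp, max_angle_bounds. Qed.

Lemma turning_bounds s : - alpha <= turning s <= alpha.
Proof. apply clamp_max_angle. Qed.

Lemma cos_turning_nonneg s : 0 <= cos (turning s).
Proof.
  pose proof (turning_bounds s). pose proof max_angle_bounds. apply cos_ge_0; lra.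
Qed.

(** Built from its angle as a function of arclength, which is continuous even where the
    curvature is infinite, and so C^1 with unit speed for every tau. *)
Definition clasp_arc : R -> R3 := curve_of_angle turning (z_gamma tau 0).

Definition xs (s : R) : R := xc (clasp_arc s).
Definition zs (s : R) : R := zc (clasp_arc s).

Lemma clasp_arc_eq s : clasp_arc s = (xs s, 0, zs s).
Proof. reflexivity. Qed.

Lemma is_derive_xs s : is_derive xs s (cos (turning s)).
Proof. apply curve_of_angle_derive_x, continuous_turning. Qed.

Lemma is_derive_zs s : is_derive zs s (sin (turning s)).
Proof. apply curve_of_angle_derive_z, continuous_turning. Qed.

Lemma xs_opp s : xs (- s) = - xs s.
Proof.
  assert (E : RInt (fun r => cos (turning r)) 0 (- s)
              = - (1 * RInt (fun r => cos (turning r)) 0 s)).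
  { apply primitive_symmetry; [|now left|].
    - intros. apply continuous_cos_comp, continuous_turning.
    - intros y. rewrite turning_opp, cos_neg. ring. }
  unfold xs, clasp_arc, curve_of_angle, xc; simpl. rewrite E. ring.
Qed.

Lemma zs_opp s : zs (- s) = zs s.
Proof.
  assert (E : RInt (fun r => sin (turning r)) 0 (- s)
              = - (-1 * RInt (fun r => sin (turning r)) 0 s)).
  { apply primitive_symmetry; [|now right|].
    - intros. apply continuous_sin_comp, continuous_turning.
    - intros y. rewrite turning_opp, sin_antisym. ring. }
  unfold zs, clasp_arc, curve_of_angle, zc; simpl. rewrite E. ring.
Qed.

Lemma xs_0 : xs 0 = 0.
Proof. apply RInt_zero. Qed.

Lemma zs_0 : zs 0 = z_gamma tau 0.
Proof. unfold zs, clasp_arc, curve_of_angle, zc; simpl. rewrite RInt_zero. ring. Qed.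

Lemma is_derive_x_angle w :
  is_derive (fun w => xs (arc_at w)) w (radius w * cos (clamp alpha w)).
Proof.
  rewrite <- turning_arc_at.
  apply (der_comp arc_at w (radius w) xs); [apply is_derive_arc_at | apply is_derive_xs].
Qed.

Lemma is_derive_z_angle w :
  is_derive (fun w => zs (arc_at w)) w (radius w * sin (clamp alpha w)).
Proof.
  rewrite <- turning_arc_at.
  apply (der_comp arc_at w (radius w) zs); [apply is_derive_arc_at | apply is_derive_zs].
Qed.

End ClaspArc.

(** * Agreement with the parametrization by the sine of the angle *)

Lemma eq_of_same_derive (f g d : R -> R) m w :
  (forall x, - m < x < m -> is_derive f x (d x) /\ is_derive g x (d x)) ->
  (forall x, - m <= x <= m -> continuous f x /\ continuous g x) ->
  f 0 = g 0 -> - m <= w <= m -> f w = g w.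
Proof.
  intros Hd Hc H0 Hw.
  assert (E : f 0 - g 0 = f w - g w).
  { destruct (Rle_lt_dec 0 w) as [L|L]; [|symmetry];
      apply (eq_of_derive_zero (fun x => f x - g x)); try lra; intros x Hx.
    1, 3: destruct (Hd x) as [H1 H2]; [lra|];
      eapply der_eq; [exact (der_minus f g x _ _ H1 H2) | ring].
    all: destruct (Hc x) as [H1 H2]; [lra|]; now apply cont_minus. }
  lra.
Qed.

Lemma towards_proper u : -1 <= u <= 1 -> ProperFilter' (towards u).
Proof.
  intros Hu. split.
  - intros [d Hd].
    set (v := u * (1 - Rmin (1 / 2) (d / 2))).
    pose proof (cond_pos d).
    assert (Hm : 0 < Rmin (1 / 2) (d / 2)) by (apply Rmin_glb_lt; lra).
    pose proof (Rmin_l (1 / 2) (d / 2)). pose proof (Rmin_r (1 / 2) (d / 2)).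
    set (m := Rmin _ _) in *. clearbody m.
    apply (Hd v).
    + unfold ball; simpl. unfold AbsRing_ball, minus, plus, opp, abs; simpl.
      unfold v. replace (u * (1 - m) + - u) with (- (u * m)) by ring.
      rewrite Rabs_Ropp, Rabs_mult, (Rabs_pos_eq m) by lra.
      assert (Rabs u <= 1) by (apply Rabs_le; lra). nra.
    + unfold v. nra.
  - apply within_filter, locally_filter.
Qed.

Section Integrals.

Variable tau : R.
Hypothesis Htau : 0 <= tau <= 1.
Notation alpha := (max_angle tau).

(** Substituting u = sin w removes the singularities at the endpoints from the
    integrals that define the curve. *)
Lemma is_RInt_gen_angle (h g : R -> R) u :
  (forall x, continuous h x) ->
  (forall v, g v = h v * inv_kappa tau v / sqrt (1 - v ^ 2)) ->
  - tau <= u <= tau ->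
  is_RInt_gen g (at_point 0) (towards u)
    (RInt (fun w => h (sin w) * radius tau w) 0 (asin u)).
Proof.
  intros Hh Hg Hu.
  set (I := fun w => RInt (fun w => h (sin w) * radius tau w) 0 w).
  assert (HI : forall w, is_derive I w (h (sin w) * radius tau w)).
  { intros w. apply (is_derive_primitive (fun w => h (sin w) * radius tau w)).
    intros r. cont; [|now apply continuous_radius].
    apply (cont_comp sin r h); [apply continuous_sin | apply Hh]. }
  assert (Hcont : forall v, -1 < v < 1 -> continuous g v).
  { intros v Hv. eapply continuous_ext; [intros; symmetry; apply Hg|].
    assert (0 < 1 - v ^ 2) by nra.
    cont; [apply Hh | | apply Rgt_not_eq, sqrt_lt_R0; lra].
    apply continuous_inv_kappa; [lra | | left];
      [left|]; apply Rabs_def1; lra. }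
  assert (Hex : forall b, -1 < b < 1 -> is_RInt g 0 b (RInt g 0 b)).
  { intros b Hb. apply (RInt_correct (V := R_CompleteNormedModule)).
    apply (ex_RInt_continuous (V := R_CompleteNormedModule)).
    intros z Hz. apply Hcont.
    unfold Rmin, Rmax in Hz. destruct (Rle_dec 0 b); lra. }
  assert (Hder : forall b, -1 < b < 1 -> is_derive (fun b => RInt g 0 b) b (g b)).
  { intros b Hb. apply (is_derive_RInt g (fun b => RInt g 0 b) 0 b); [|now apply Hcont].
    apply (locally_interval _ b (-1) 1); simpl; try lra.
    intros y ? ?. apply Hex. simpl in *. lra. }
  assert (HG : forall b, - tau <= b <= tau -> -1 < b < 1 -> RInt g 0 b = I (asin b)).
  { intros b Hb Hb1.
    apply (eq_of_same_derive (fun b => RInt g 0 b) (fun b => I (asin b)) g (Rabs b) b).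
    - intros x Hx.
      assert (Hxt : - tau < x < tau /\ -1 < x < 1)
        by (unfold Rabs in Hx; destruct (Rcase_abs b); lra).
      split; [apply Hder; lra|].
      eapply der_eq.
      { apply (der_comp asin x (/ sqrt (1 - x ^ 2)) I); [apply is_derive_asin; lra | apply HI]. }
      rewrite radius_inside, !sin_asin, Hg by
        (try lra; apply asin_le_max_angle; lra).
      unfold Rdiv. ring.
    - intros x Hx.
      assert (Hxt : -1 < x < 1)
        by (unfold Rabs in Hx; destruct (Rcase_abs b); lra).
      split; [eapply derive_continuous, Hder, Hxt|].
      apply (cont_comp asin x I); [apply continuous_asin | eapply derive_continuous, HI].
    - rewrite asin_0. unfold I. now rewrite !RInt_zero.
    - pose proof (Rle_abs b). pose proof (Rle_abs (- b)). rewrite Rabs_Ropp in *. lra. }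
  fold (I (asin u)).
  assert (Hlim : filterlim (fun b => RInt g 0 b) (towards u) (locally (I (asin u)))).
  { destruct (Rlt_le_dec (Rabs u) 1) as [L|L].
    - apply Rabs_def2 in L.
      rewrite <- HG by lra.
      eapply filterlim_filter_le_1; [apply filter_le_within|].
      eapply derive_continuous, Hder. lra.
    - assert (tau = 1) by (unfold Rabs in L; destruct (Rcase_abs u); lra).
      apply (filterlim_within_ext _ (fun b => I (asin b))).
      + intros b Hb. symmetry. apply HG; lra.
      + eapply filterlim_filter_le_1; [apply filter_le_within|].
        apply (cont_comp asin u I); [apply continuous_asin | eapply derive_continuous, HI]. }
  intros Q HQ. specialize (Hlim Q HQ).
  apply (Filter_prod _ _ _ (fun x => x = 0) (fun b => -1 < b < 1 /\ Q (RInt g 0 b))).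
  - reflexivity.
  - destruct Hlim as [d Hd]. exists d. intros y Hy Hy1. split; [exact Hy1 | now apply Hd].
  - intros x b -> [Hb HQb]. exists (RInt g 0 b). split; [now apply Hex | exact HQb].
Qed.

Lemma z_int_eq u : - tau <= u <= tau ->
  z_int tau u = RInt (fun w => sin w * radius tau w) 0 (asin u).
Proof.
  intros Hu. unfold z_int.
  assert (Hprop : ProperFilter' (towards u)) by (apply towards_proper; lra).
  apply (is_RInt_gen_unique (V := R_CompleteNormedModule)).
  - apply (is_RInt_gen_angle (fun v => v)); [apply continuous_id | | exact Hu].
    intros v. unfold Rdiv. ring.
Qed.

Lemma zs_eq w : - alpha <= w <= alpha ->
  zs tau Htau (arc_at tau w) =
  z_gamma tau 0 + RInt (fun w => sin w * radius tau w) 0 w.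
Proof.
  intros Hw.
  set (I := fun w => z_gamma tau 0 + RInt (fun w => sin w * radius tau w) 0 w).
  assert (HI : forall w, is_derive I w (sin w * radius tau w)).
  { intros x. unfold I. eapply der_eq; [apply der_plus; [apply der_const|]|apply Rplus_0_l].
    apply (is_derive_primitive (fun w => sin w * radius tau w)).
    intros r. cont. now apply continuous_radius. }
  apply (eq_of_same_derive (fun w => zs tau Htau (arc_at tau w)) I
    (fun w => radius tau w * sin (clamp alpha w)) alpha).
  - intros x Hx. split; [apply is_derive_z_angle|].
    eapply der_eq; [apply HI|]. rewrite clamp_id by lra. ring.
  - intros x _. split; eapply derive_continuous; [apply is_derive_z_angle | apply HI].
  - rewrite arc_at_0, zs_0. unfold I. rewrite RInt_zero. ring.
  - exact Hw.
Qed.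

Lemma z_gamma_angle w : - alpha <= w <= alpha ->
  z_gamma tau (sin w) = zs tau Htau (arc_at tau w).
Proof.
  intros Hw. rewrite zs_eq by exact Hw.
  pose proof (max_angle_bounds tau Htau).
  assert (E0 : z_int tau 0 = 0) by (rewrite z_int_eq, asin_0, RInt_zero by lra; reflexivity).
  assert (Ew : z_int tau (sin w) = RInt (fun w => sin w * radius tau w) 0 w).
  { rewrite z_int_eq, asin_sin by (try apply sin_le_tau; lra). reflexivity. }
  unfold z_gamma. rewrite Ew, E0. ring.
Qed.

Lemma x_gamma_angle w : - alpha <= w <= alpha ->
  x_gamma tau (sin w) = xs tau Htau (arc_at tau w).
Proof.
  intros Hw. pose proof (max_angle_bounds tau Htau).
  apply (eq_of_same_derive (fun w => x_gamma tau (sin w)) (fun w => xs tau Htau (arc_at tau w))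
    (fun w => radius tau w * cos (clamp alpha w)) alpha).
  - intros x Hx. split; [|apply is_derive_x_angle].
    rewrite clamp_id by lra.
    assert (Hs : -1 < sin x < 1).
    { assert (H1 : sin (- (PI / 2)) < sin x) by (apply sin_increasing_1; lra).
      assert (H2 : sin x < sin (PI / 2)) by (apply sin_increasing_1; lra).
      rewrite sin_antisym, sin_PI2 in H1. rewrite sin_PI2 in H2. lra. }
    eapply der_eq.
    + apply (der_comp sin x (cos x) (x_gamma tau)); [apply is_derive_sin|].
      apply is_derive_x_gamma; [exact Htau | apply Rabs_def1; lra].
    + rewrite radius_inside by lra. ring.
  - intros x Hx. split; [|eapply derive_continuous, is_derive_x_angle].
    apply (cont_comp sin x (x_gamma tau)); [apply continuous_sin|].
    pose proof (sin_abs_le_tau tau Htau x Hx).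
    apply continuous_x_gamma; lra.
  - rewrite sin_0, arc_at_0, xs_0. unfold x_gamma, Rdiv. ring.
  - exact Hw.
Qed.

Lemma gamma_angle u : - tau <= u <= tau ->
  gamma tau u = clasp_arc tau Htau (arc_at tau (asin u)).
Proof.
  intros Hu. rewrite clasp_arc_eq. unfold gamma.
  rewrite <- x_gamma_angle, <- z_gamma_angle, sin_asin by
    (try apply asin_le_max_angle; lra). reflexivity.
Qed.

(** The additive constant in z is fixed by the requirement that the strut joining
    the tip of one arc to the end of the curved part of the other has length 1. *)
Lemma z_tip_end : z_gamma tau 0 + z_gamma tau tau = - sqrt (1 - tau ^ 2).
Proof. unfold z_gamma. lra. Qed.

End Integrals.

(** * Struts *)

Lemma sq_root_frac (a b c : R) : 0 <= a -> 0 < c -> (b * sqrt a / sqrt c) ^ 2 = b ^ 2 * a / c.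
Proof.
  intros Ha Hc. pose proof (sqrt_lt_R0 _ Hc).
  rewrite <- (pow2_sqrt c) at 2 by lra. rewrite <- (pow2_sqrt a) at 2 by exact Ha.
  field. lra.
Qed.

Section Struts.

Variable tau : R.
Hypothesis Htau : 0 <= tau <= 1.
Notation alpha := (max_angle tau).
Notation X w := (xs tau Htau (arc_at tau w)).
Notation Z w := (zs tau Htau (arc_at tau w)).

(** Difference of height between the ends with sines u and tau - u of a strut. *)
Definition strut_height (u : R) : R :=
  sqrt (1 - u ^ 2) * sqrt (1 - (tau - u) ^ 2) / sqrt (1 - u ^ 2 * (tau - u) ^ 2).

Lemma strut_denominator_pos u : 0 <= u <= tau -> 0 < 1 - u ^ 2 * (tau - u) ^ 2.
Proof.
  intros Hu.
  assert (0 <= u * (tau - u) <= 1 / 2).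
  { split; [apply Rmult_le_pos; lra|].
    assert (0 <= (u - (tau - u)) ^ 2) by apply pow2_ge_0. nra. }
  replace (u ^ 2 * (tau - u) ^ 2) with ((u * (tau - u)) ^ 2) by ring. nra.
Qed.

Lemma strut_height_conj u : strut_height (tau - u) = strut_height u.
Proof.
  unfold strut_height. replace (tau - (tau - u)) with u by ring.
  rewrite (Rmult_comm ((tau - u) ^ 2)), (Rmult_comm (sqrt (1 - (tau - u) ^ 2))).
  reflexivity.
Qed.

Lemma strut_height_nonneg u : 0 <= strut_height u.
Proof.
  unfold strut_height, Rdiv. repeat apply Rmult_le_pos; try apply sqrt_pos.
  destruct (Req_dec (sqrt (1 - u ^ 2 * (tau - u) ^ 2)) 0) as [E|E].
  - rewrite E, Rinv_0. lra.
  - left. apply Rinv_0_lt_compat. pose proof (sqrt_pos (1 - u ^ 2 * (tau - u) ^ 2)). lra.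
Qed.

(** Orthogonality of the tangent (sqrt (1 - u^2), 0, u) to the strut, whose components
    in this plane are x and minus its height. *)
Lemma strut_normal u : 0 <= u <= tau ->
  x_gamma tau u * sqrt (1 - u ^ 2) = u * strut_height u.
Proof.
  intros Hu. unfold x_gamma, strut_height. rewrite Rabs_pos_eq by lra. unfold Rdiv. ring.
Qed.

Lemma x_gamma_sq u : 0 <= u <= tau ->
  x_gamma tau u ^ 2 = u ^ 2 * (1 - (tau - u) ^ 2) / (1 - u ^ 2 * (tau - u) ^ 2).
Proof.
  intros Hu. unfold x_gamma. rewrite Rabs_pos_eq by lra.
  apply sq_root_frac; [nra | now apply strut_denominator_pos].
Qed.

Lemma strut_height_sq u : 0 <= u <= tau ->
  strut_height u ^ 2 = (1 - u ^ 2) * (1 - (tau - u) ^ 2) / (1 - u ^ 2 * (tau - u) ^ 2).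
Proof.
  intros Hu. unfold strut_height.
  rewrite sq_root_frac, pow2_sqrt; [reflexivity | nra | nra |].
  now apply strut_denominator_pos.
Qed.

(** The strut has length 1; its two horizontal components are the coordinates x of its
    ends. *)
Lemma strut_unit u : 0 <= u <= tau ->
  x_gamma tau u ^ 2 + x_gamma tau (tau - u) ^ 2 + strut_height u ^ 2 = 1.
Proof.
  intros Hu. rewrite x_gamma_sq, x_gamma_sq, strut_height_sq by lra.
  replace (tau - (tau - u)) with u by ring.
  rewrite (Rmult_comm ((tau - u) ^ 2) (u ^ 2)).
  pose proof (strut_denominator_pos u Hu). field. lra.
Qed.

Lemma z_gamma_arc u : - tau <= u <= tau -> z_gamma tau u = Z (asin u).
Proof.
  intros Hu.
  rewrite <- z_gamma_angle, sin_asin by (try apply asin_le_max_angle; lra). reflexivity.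
Qed.

Lemma x_gamma_arc u : - tau <= u <= tau -> x_gamma tau u = X (asin u).
Proof.
  intros Hu.
  rewrite <- x_gamma_angle, sin_asin by (try apply asin_le_max_angle; lra). reflexivity.
Qed.

Lemma cos_asin_pow u : -1 <= u <= 1 -> cos (asin u) = sqrt (1 - u ^ 2).
Proof. intros Hu. rewrite cos_asin by exact Hu. f_equal. unfold Rsqr. ring. Qed.

Lemma is_derive_z_sine u : - tau < u < tau ->
  is_derive (fun u => Z (asin u)) u (u / sqrt (1 - u ^ 2) * inv_kappa tau u).
Proof.
  intros Hu. eapply der_eq.
  - eapply (der_comp asin u (/ sqrt (1 - u ^ 2)) (fun w => Z w));
      [apply is_derive_asin; lra | apply is_derive_z_angle].
  - assert (- alpha <= asin u <= alpha) by (apply asin_le_max_angle; lra).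
    rewrite radius_inside, clamp_id, !sin_asin by lra. unfold Rdiv. ring.
Qed.

Lemma continuous_z_sine u : continuous (fun u => Z (asin u)) u.
Proof.
  apply (cont_comp asin u (fun w => Z w)); [apply continuous_asin|].
  eapply derive_continuous, is_derive_z_angle.
Qed.

(** Since a strut has length 1, its height is a function of the two horizontal
    coordinates.  Differentiating this function and using normality at both ends
    gives the slopes of the arcs there, and so the derivative of the left-hand side. *)
Lemma strut_z u : 0 <= u <= tau -> Z (asin u) + Z (asin (tau - u)) = - strut_height u.
Proof.
  intros Hu.
  (* The height expressed through the coordinates x, whose derivatives are known. *)
  set (root := fun u => sqrt (1 - x_gamma tau u ^ 2 - x_gamma tau (tau - u) ^ 2)).
  assert (Hroot : forall u, 0 <= u <= tau -> root u = strut_height u).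
  { intros v Hv. unfold root. pose proof (strut_unit v Hv).
    replace (1 - _ - _) with (strut_height v ^ 2) by lra.
    apply sqrt_pow2, strut_height_nonneg. }
  set (D := fun u => Z (asin u) + Z (asin (tau - u)) + root u).
  assert (E : D 0 = D u).
  { apply eq_of_derive_zero; [lra | |].
    - intros v Hv.
      assert (Hp : 0 < 1 - v ^ 2) by nra. apply sqrt_lt_R0 in Hp.
      assert (Hq : 0 < 1 - (tau - v) ^ 2) by nra. apply sqrt_lt_R0 in Hq.
      pose proof (strut_denominator_pos v ltac:(lra)) as Hr. apply sqrt_lt_R0 in Hr.
      assert (Hh : 0 < strut_height v).
      { unfold strut_height. apply Rdiv_lt_0_compat; [nra | exact Hr]. }
      assert (Hx : forall y, Rabs y < 1 -> is_derive (x_gamma tau) y (inv_kappa tau y))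
        by (intros; now apply is_derive_x_gamma).
      assert (Hconj : is_derive (fun v => tau - v) v (0 - 1))
        by (apply der_minus; [apply der_const | apply der_id]).
      eapply der_eq.
      + apply der_plus; [apply der_plus|].
        * apply is_derive_z_sine. lra.
        * eapply (der_comp _ _ _ (fun u => Z (asin u)) _ Hconj), is_derive_z_sine. lra.
        * eapply (der_comp (fun u => 1 - x_gamma tau u ^ 2 - x_gamma tau (tau - u) ^ 2)
            v _ sqrt (/ (2 * root v))).
          -- apply der_minus; [apply der_minus; [apply der_const|]|].
             ++ eapply (der_comp (x_gamma tau) v _ (fun x => x ^ 2) (2 * x_gamma tau v));
                  [apply Hx, Rabs_def1; lra|].
                auto_derive; [exact I | ring].
             ++ eapply (der_comp (fun v => x_gamma tau (tau - v)) v _ (fun x => x ^ 2)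
                  (2 * x_gamma tau (tau - v))).
                ** eapply (der_comp _ _ _ (x_gamma tau) _ Hconj), Hx, Rabs_def1; lra.
                ** auto_derive; [exact I | ring].
          -- pose proof (strut_unit v ltac:(lra)).
             apply is_derive_Reals. apply derivable_pt_lim_sqrt. nra.
      + rewrite Hroot by lra.
        assert (E1 : x_gamma tau v = v * strut_height v / sqrt (1 - v ^ 2))
          by (rewrite <- strut_normal by lra; field; lra).
        assert (E2 : x_gamma tau (tau - v)
                     = (tau - v) * strut_height v / sqrt (1 - (tau - v) ^ 2))
          by (rewrite <- strut_height_conj, <- strut_normal by lra; field; lra).
        rewrite E1, E2. field. lra.
    - intros v Hv. unfold D, root.
      assert (Hc : forall y, 0 <= y <= tau -> continuous (x_gamma tau) y).
      { intros y Hy. apply continuous_x_gamma; try rewrite Rabs_pos_eq; lra. }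
      assert (Hconj : continuous (fun v => tau - v) v) by cont.
      assert (Hc' : continuous (fun v => x_gamma tau (tau - v)) v)
        by (apply (cont_comp _ v (x_gamma tau) Hconj), Hc; lra).
      specialize (Hc v ltac:(lra)).
      cont; [apply continuous_z_sine|].
      apply (cont_comp _ v (fun u => Z (asin u)) Hconj), continuous_z_sine. }
  assert (D 0 = 0).
  { unfold D. rewrite Rminus_0_r, Hroot by lra.
    rewrite <- !z_gamma_arc, z_tip_end by lra. unfold strut_height.
    replace (1 - 0 ^ 2 * (tau - 0) ^ 2) with 1 by ring.
    replace (1 - 0 ^ 2) with 1 by ring. rewrite Rminus_0_r, sqrt_1. field. }
  rewrite <- Hroot by exact Hu. unfold D in *. lra.
Qed.

(** * The distance between the two arcs *)

Definition sep_sq (s r : R) : R :=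
  xs tau Htau s ^ 2 + xs tau Htau r ^ 2 + (zs tau Htau s + zs tau Htau r) ^ 2.

Lemma dist3_clasp_sq s r :
  dist3 (clasp_arc tau Htau s) (sym (clasp_arc tau Htau r)) ^ 2 = sep_sq s r.
Proof.
  rewrite dist3_sq, !clasp_arc_eq. unfold sym, sep_sq, xc, yc, zc; simpl. ring.
Qed.

Lemma sep_sq_comm s r : sep_sq s r = sep_sq r s.
Proof. unfold sep_sq. ring. Qed.

Lemma sep_sq_opp s r : sep_sq (- s) r = sep_sq s r.
Proof. unfold sep_sq. rewrite xs_opp, zs_opp. ring. Qed.

Lemma sep_sq_strut u : 0 <= u <= tau ->
  sep_sq (arc_at tau (asin u)) (arc_at tau (asin (tau - u))) = 1.
Proof.
  intros Hu. unfold sep_sq. rewrite strut_z, <- !x_gamma_arc by lra.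
  rewrite <- (strut_unit u Hu). ring.
Qed.

Lemma z_angle_le v w : 0 <= v -> v <= w -> Z v <= Z w.
Proof.
  intros Hv Hvw. pose proof (max_angle_bounds tau Htau) as Ha.
  apply (le_of_derive_nonneg (fun w => Z w) (fun w => radius tau w * sin (clamp alpha w)));
    [exact Hvw | | |]; intros x Hx.
  - apply is_derive_z_angle.
  - eapply derive_continuous, is_derive_z_angle.
  - apply Rmult_le_pos; [now apply radius_nonneg|].
    pose proof (clamp_nonneg alpha (proj1 Ha) x ltac:(lra)).
    pose proof (clamp_max_angle tau Htau x). apply sin_ge_0; lra.
Qed.

Lemma x_angle_le v w : v <= w -> X v <= X w.
Proof.
  intros Hvw.
  apply (le_of_derive_nonneg (fun w => X w) (fun w => radius tau w * cos (clamp alpha w)));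
    [exact Hvw | | |]; intros x Hx.
  - apply is_derive_x_angle.
  - eapply derive_continuous, is_derive_x_angle.
  - apply Rmult_le_pos; [now apply radius_nonneg|].
    rewrite <- (turning_arc_at tau Htau). apply cos_turning_nonneg.
Qed.

(** Half the derivative of the squared distance with respect to the arclength of the
    first point. *)
Definition pull (w w' : R) : R :=
  X w * cos (clamp alpha w) + (Z w + Z w') * sin (clamp alpha w).

Lemma is_derive_sep_sq w w' :
  is_derive (fun w => sep_sq (arc_at tau w) (arc_at tau w')) w (2 * radius tau w * pull w w').
Proof.
  unfold sep_sq, pull.
  pose proof (is_derive_x_angle tau Htau w) as Hx.
  pose proof (is_derive_z_angle tau Htau w) as Hz.
  assert (Hsq : forall x : R, is_derive (fun x => x ^ 2) x (2 * x))
    by (intros x; auto_derive; [exact I | ring]).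
  eapply der_eq.
  - apply der_plus; [apply der_plus|].
    + exact (der_comp (fun w => X w) w _ (fun x => x ^ 2) _ Hx (Hsq _)).
    + apply der_const.
    + exact (der_comp (fun w => Z w + Z w') w _ (fun x => x ^ 2) _
        (der_plus _ _ _ _ _ Hz (der_const _ _)) (Hsq _)).
  - simpl. ring.
Qed.

(** By normality the horizontal term is the one that would cancel the vertical term if
    the second point were the strut partner, of sine tau - sin w. *)
Lemma pull_inside w w' : 0 <= w <= alpha ->
  pull w w' = sin w * (Z w' - Z (asin (tau - sin w))).
Proof.
  intros Hw. pose proof (max_angle_bounds tau Htau) as Ha.
  pose proof (sin_le_tau tau Htau w ltac:(lra)).
  assert (0 <= sin w) by (apply sin_ge_0; lra).
  pose proof (strut_z (sin w) ltac:(lra)) as Ez.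
  pose proof (strut_normal (sin w) ltac:(lra)) as En.
  rewrite <- cos_asin_pow, asin_sin in En by lra. rewrite asin_sin in Ez by lra.
  unfold pull. rewrite clamp_id by lra.
  rewrite (x_gamma_angle tau Htau) in En by lra. rewrite En.
  replace (strut_height (sin w)) with (- (Z w + Z (asin (tau - sin w)))) by lra. ring.
Qed.

(** True at the end of the curved part, whose strut partner is the tip, the lowest
    point; further out the tangent is constant and both coordinates grow. *)
Lemma pull_outside w w' : alpha <= w -> 0 <= w' -> 0 <= pull w w'.
Proof.
  intros Hw Hw'. pose proof (max_angle_bounds tau Htau) as Ha.
  assert (H0 : 0 <= pull alpha w').
  { rewrite pull_inside, sin_max_angle, Rminus_diag, asin_0 by lra.
    apply Rmult_le_pos; [lra|]. pose proof (z_angle_le 0 w'). lra. }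
  apply Rle_trans with (1 := H0). unfold pull.
  rewrite !clamp_ge by lra.
  assert (X alpha <= X w) by now apply x_angle_le.
  assert (Z alpha <= Z w) by (apply z_angle_le; lra).
  assert (0 <= cos alpha) by (apply cos_ge_0; lra).
  assert (0 <= sin alpha) by (apply sin_ge_0; lra).
  apply Rplus_le_compat; apply Rmult_le_compat_r; lra.
Qed.

Lemma sep_sq_le w0 w1 w' : w0 <= w1 ->
  (forall w, w0 < w < w1 -> 0 <= pull w w') ->
  sep_sq (arc_at tau w0) (arc_at tau w') <= sep_sq (arc_at tau w1) (arc_at tau w').
Proof.
  intros Hw Hp.
  apply (le_of_derive_nonneg (fun w => sep_sq (arc_at tau w) (arc_at tau w'))
    (fun w => 2 * radius tau w * pull w w') w0 w1 Hw).
  - intros. apply is_derive_sep_sq.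
  - intros. eapply derive_continuous, is_derive_sep_sq.
  - intros w Hx. pose proof (radius_nonneg tau Htau w). apply Rmult_le_pos; [lra | auto].
Qed.

Lemma sep_sq_ge w0 w1 w' : w0 <= w1 ->
  (forall w, w0 < w < w1 -> pull w w' <= 0) ->
  sep_sq (arc_at tau w1) (arc_at tau w') <= sep_sq (arc_at tau w0) (arc_at tau w').
Proof.
  intros Hw Hp. apply Ropp_le_cancel.
  apply (le_of_derive_nonneg (fun w => - sep_sq (arc_at tau w) (arc_at tau w'))
    (fun w => - (2 * radius tau w * pull w w')) w0 w1 Hw).
  - intros. apply der_opp, is_derive_sep_sq.
  - intros. apply cont_opp. eapply derive_continuous, is_derive_sep_sq.
  - intros w Hx. pose proof (radius_nonneg tau Htau w). specialize (Hp w Hx).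
    assert (0 <= 2 * radius tau w * - pull w w') by (apply Rmult_le_pos; lra). lra.
Qed.

(** As one point moves along its arc, the other being fixed in the curved part, the
    distance decreases until it reaches the strut and increases afterwards: [pull]
    compares the height of the fixed point with that of the strut partner. *)
Lemma sep_sq_curved w w' : 0 <= w -> 0 <= w' <= alpha ->
  1 <= sep_sq (arc_at tau w) (arc_at tau w').
Proof.
  intros Hw Hw'. pose proof (max_angle_bounds tau Htau) as Ha.
  pose proof (sin_le_tau tau Htau w' ltac:(lra)).
  assert (0 <= sin w') by (apply sin_ge_0; lra).
  set (ws := asin (tau - sin w')).
  assert (Hws : 0 <= ws <= alpha).
  { unfold ws, alpha. rewrite <- asin_0. split; apply asin_le; lra. }
  assert (Es : sin ws = tau - sin w') by (apply sin_asin; lra).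
  assert (E1 : sep_sq (arc_at tau ws) (arc_at tau w') = 1).
  { rewrite <- (sep_sq_strut (tau - sin w')) by lra. fold ws.
    replace (tau - (tau - sin w')) with (sin w') by ring.
    now rewrite asin_sin by lra. }
  rewrite <- E1. destruct (Rle_lt_dec w ws) as [L|L].
  - apply sep_sq_ge; [exact L|]. intros x Hx. rewrite pull_inside by lra.
    assert (sin x <= sin ws) by (apply sin_incr_1; lra).
    assert (0 <= sin x) by (apply sin_ge_0; lra).
    assert (Z w' <= Z (asin (tau - sin x))).
    { apply z_angle_le; [lra|]. rewrite <- (asin_sin w') at 1 by lra. apply asin_le; lra. }
    nra.
  - apply Rle_trans with (sep_sq (arc_at tau (Rmin w alpha)) (arc_at tau w')).
    + apply sep_sq_le; [apply Rmin_glb; lra|].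
      intros x Hx. pose proof (Rmin_l w alpha). pose proof (Rmin_r w alpha).
      rewrite pull_inside by lra.
      assert (sin ws <= sin x) by (apply sin_incr_1; lra).
      pose proof (sin_le_tau tau Htau x ltac:(lra)).
      assert (Z (asin (tau - sin x)) <= Z w').
      { apply z_angle_le; [rewrite <- asin_0; apply asin_le; lra|].
        rewrite <- (asin_sin w') by lra. apply asin_le; lra. }
      apply Rmult_le_pos; lra.
    + apply sep_sq_le; [apply Rmin_l|]. intros x Hx. apply pull_outside; [|lra].
      unfold Rmin in Hx. destruct (Rle_dec w alpha); lra.
Qed.

Lemma sep_sq_ge_1 s r : 1 <= sep_sq s r.
Proof.
  assert (H : forall w w', 0 <= w -> 0 <= w' -> 1 <= sep_sq (arc_at tau w) (arc_at tau w')).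
  { intros w w' Hw Hw'. pose proof (max_angle_bounds tau Htau).
    destruct (Rle_lt_dec w' alpha); [apply sep_sq_curved; lra|].
    (* A point of a straight end is compared with the end of the curved part. *)
    rewrite sep_sq_comm.
    apply Rle_trans with (sep_sq (arc_at tau alpha) (arc_at tau w)).
    - rewrite sep_sq_comm. apply sep_sq_curved; lra.
    - apply sep_sq_le; [lra|]. intros x Hx. apply pull_outside; lra. }
  assert (Habs : forall s r, sep_sq (Rabs s) r = sep_sq s r).
  { intros s0 r0. unfold Rabs. destruct (Rcase_abs s0); [apply sep_sq_opp | reflexivity]. }
  assert (Hang : forall s, 0 <= s -> 0 <= angle_at tau Htau s).
  { intros s0 Hs. apply (angle_at_le tau Htau) in Hs.
    rewrite <- (arc_at_0 tau) in Hs at 1. now rewrite angle_at_arc_at in Hs. }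
  rewrite <- Habs, sep_sq_comm, <- Habs.
  rewrite <- (arc_at_angle_at tau Htau (Rabs s)), <- (arc_at_angle_at tau Htau (Rabs r)).
  apply H; apply Hang, Rabs_pos.
Qed.

End Struts.

(** * One-sided derivative of a minimum distance *)

(** The gauge at a point is chosen smaller than half the value there, so that the mesh
    of a subordinate cover is itself a lower bound. *)
Lemma positive_lower_bound_2d (f : R -> R -> R) a b a' b' :
  (forall x y, a <= x <= b -> a' <= y <= b' -> continuity_2d_pt f x y) ->
  (forall x y, a <= x <= b -> a' <= y <= b' -> 0 < f x y) ->
  exists delta, 0 < delta /\
    forall x y, a <= x <= b -> a' <= y <= b' -> delta <= f x y.
Proof.
  intros Hc Hp.
  assert (H : forall u v, exists d : posreal, a <= u <= b -> a' <= v <= b' ->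
    forall x y, Rabs (x - u) < d -> Rabs (y - v) < d -> d <= f x y).
  { intros u v.
    destruct (classic (a <= u <= b /\ a' <= v <= b')) as [[Hu Hv]|Hn].
    - pose proof (Hp u v Hu Hv) as Hf.
      destruct (Hc u v Hu Hv (mkposreal (f u v / 2) ltac:(lra))) as [d Hd].
      assert (Hm : 0 < Rmin d (f u v / 2)) by (apply Rmin_glb_lt; [apply cond_pos | lra]).
      exists (mkposreal _ Hm). intros _ _ x y Hx Hy. simpl in *.
      pose proof (Rmin_l d (f u v / 2)). pose proof (Rmin_r d (f u v / 2)).
      specialize (Hd x y ltac:(lra) ltac:(lra)). apply Rabs_def2 in Hd. lra.
    - exists (mkposreal 1 Rlt_0_1). intros ? ?. exfalso; apply Hn; now split. }
  set (delta := fun u v => proj1_sig (constructive_indefinite_description _ (H u v))).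
  destruct (compactness_value_2d a b a' b' delta) as [d Hd].
  exists d. split; [apply cond_pos|]. intros x y Hx Hy.
  apply Rnot_lt_le. intros Hlt. apply (Hd x y Hx Hy).
  intros (u & v & Hu & Hv & Hxu & Hyv & Hle). unfold delta in *.
  destruct (constructive_indefinite_description _ (H u v)) as [d' Hd']. simpl in *.
  specialize (Hd' Hu Hv x y Hxu Hyv). lra.
Qed.

Lemma is_glb_real (E : R -> Prop) x b : E x -> (forall y, E y -> b <= y) ->
  is_glb_Rbar E (Finite (real (Glb_Rbar E))).
Proof.
  intros Hx Hb. pose proof (Glb_Rbar_correct E) as H.
  destruct (Glb_Rbar E) as [l| |] eqn:El; [exact H | |].
  - destruct H as [H _]. destruct (H x Hx).
  - destruct H as [_ H]. destruct (H (Finite b)). exact Hb.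
Qed.

Lemma real_glb_ge (E : R -> Prop) x b : E x -> (forall y, E y -> b <= y) ->
  b <= real (Glb_Rbar E).
Proof.
  intros Hx Hb. destruct (is_glb_real E x b Hx Hb) as [_ H]. exact (H (Finite b) Hb).
Qed.

Lemma real_glb_le (E : R -> Prop) x b : E x -> (forall y, E y -> b <= y) ->
  real (Glb_Rbar E) <= x.
Proof.
  intros Hx Hb. destruct (is_glb_real E x b Hx Hb) as [H _]. exact (H x Hx).
Qed.

Lemma real_glb_approx (E : R -> Prop) x b eps : E x -> (forall y, E y -> b <= y) ->
  0 < eps -> exists y, E y /\ y < real (Glb_Rbar E) + eps.
Proof.
  intros Hx Hb Heps. apply NNPP. intros Hn.
  assert (real (Glb_Rbar E) + eps <= real (Glb_Rbar E)); [|lra].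
  apply (real_glb_ge E x); [exact Hx|]. intros y Hy.
  apply Rnot_lt_le. intros Hlt. apply Hn. now exists y.
Qed.

Lemma sqrt_le_tangent x : -1 <= x -> sqrt (1 + x) <= 1 + x / 2.
Proof.
  intros Hx. pose proof (sqrt_pos (1 + x)). pose proof (sqrt_sqrt (1 + x) ltac:(lra)).
  assert (0 <= (sqrt (1 + x) - 1) ^ 2) by apply pow2_ge_0. lra.
Qed.

Lemma sqrt_ge_parabola x : Rabs x <= 1 / 4 -> 1 + x - x ^ 2 <= sqrt (1 + 2 * x).
Proof.
  intros Hx. apply Rabs_le_between in Hx.
  apply Rsqr_incr_0_var; [|apply sqrt_pos]. rewrite Rsqr_sqrt by lra. unfold Rsqr.
  replace ((1 + x - x ^ 2) * (1 + x - x ^ 2))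
    with (1 + 2 * x - x ^ 2 * (1 + 2 * x - x ^ 2)) by ring.
  assert (0 <= x ^ 2 <= 1 / 4) by nra.
  assert (0 <= x ^ 2 * (1 + 2 * x - x ^ 2)) by (apply Rmult_le_pos; lra). lra.
Qed.

Lemma dist3_perturb_sq (p q x y : R3) t :
  dist3 (plus p (scal t x) : R3) (plus q (scal t y) : R3) ^ 2 =
  dot (minus p q) (minus p q) + 2 * t * dot (minus p q) (minus x y)
  + t ^ 2 * dot (minus x y) (minus x y).
Proof.
  rewrite dist3_sq. destruct p as [[? ?] ?], q as [[? ?] ?], x as [[? ?] ?], y as [[? ?] ?].
  unfold dot, xc, yc, zc. cbn. ring.
Qed.

Definition continuous3 (c : R -> R3) : Prop := forall s,
  continuous (fun r => xc (c r)) s /\ continuous (fun r => yc (c r)) s /\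
  continuous (fun r => zc (c r)) s.

Lemma continuity_2d_dot_minus (c1 c2 c3 c4 : R -> R3) s r :
  continuous3 c1 -> continuous3 c2 -> continuous3 c3 -> continuous3 c4 ->
  continuity_2d_pt (fun s r => dot (minus (c1 s) (c2 r)) (minus (c3 s) (c4 r))) s r.
Proof.
  intros H1 H2 H3 H4.
  assert (Hs : forall f : R -> R, continuous f s -> continuity_2d_pt (fun s _ => f s) s r).
  { intros f Hf. apply (continuity_1d_2d_pt_comp f (fun s _ => s));
      [now apply continuity_pt_continuous | apply continuity_2d_pt_id1]. }
  assert (Hr : forall f : R -> R, continuous f r -> continuity_2d_pt (fun _ r => f r) s r).
  { intros f Hf. apply (continuity_1d_2d_pt_comp f (fun _ r => r));
      [now apply continuity_pt_continuous | apply continuity_2d_pt_id2]. }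
  destruct (H1 s) as (A1 & A2 & A3). destruct (H2 r) as (B1 & B2 & B3).
  destruct (H3 s) as (C1 & C2 & C3). destruct (H4 r) as (D1 & D2 & D3).
  apply (continuity_2d_pt_ext (fun s r =>
    (xc (c1 s) - xc (c2 r)) * (xc (c3 s) - xc (c4 r))
    + (yc (c1 s) - yc (c2 r)) * (yc (c3 s) - yc (c4 r))
    + (zc (c1 s) - zc (c2 r)) * (zc (c3 s) - zc (c4 r)))); [reflexivity|].
  repeat first [ apply continuity_2d_pt_minus | apply continuity_2d_pt_plus
    | apply continuity_2d_pt_mult ];
  first [ now apply (Hs (fun s => xc (c1 s))) | now apply (Hs (fun s => yc (c1 s)))
    | now apply (Hs (fun s => zc (c1 s))) | now apply (Hr (fun r => xc (c2 r)))
    | now apply (Hr (fun r => yc (c2 r))) | now apply (Hr (fun r => zc (c2 r)))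
    | now apply (Hs (fun s => xc (c3 s))) | now apply (Hs (fun s => yc (c3 s)))
    | now apply (Hs (fun s => zc (c3 s))) | now apply (Hr (fun r => xc (c4 r)))
    | now apply (Hr (fun r => yc (c4 r))) | now apply (Hr (fun r => zc (c4 r))) ].
Qed.

Lemma dot_self_nonneg p : 0 <= dot p p.
Proof.
  unfold dot. pose proof (Rle_0_sqr (xc p)). pose proof (Rle_0_sqr (yc p)).
  pose proof (Rle_0_sqr (zc p)). unfold Rsqr in *. lra.
Qed.

Section MinimumDistance.

Variables (c1 c2 xi1 xi2 : R -> R3) (l1 l2 : R).
Hypotheses (Hc1 : continuous3 c1) (Hc2 : continuous3 c2).
Hypotheses (Hxi1 : continuous3 xi1) (Hxi2 : continuous3 xi2).

Let rect s r := 0 <= s <= l1 /\ 0 <= r <= l2.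
Let sep s r : R := dot (minus (c1 s) (c2 r)) (minus (c1 s) (c2 r)).
Let rate s r : R := dot (minus (c1 s) (c2 r)) (minus (xi1 s) (xi2 r)).
Let speed s r : R := dot (minus (xi1 s) (xi2 r)) (minus (xi1 s) (xi2 r)).
Let moved t s r : R :=
  dist3 (plus (c1 s) (scal t (xi1 s)) : R3) (plus (c2 r) (scal t (xi2 r)) : R3).

Definition perturbed_distance (t : R) : R :=
  real (Glb_Rbar (fun d => exists s r, 0 <= s <= l1 /\ 0 <= r <= l2 /\
    d = dist3 (plus (c1 s) (scal t (xi1 s)) : R3) (plus (c2 r) (scal t (xi2 r)) : R3))).

Lemma rate_lower_bound : exists M, 0 <= M /\ forall s r, rect s r -> - M <= rate s r.
Proof.
  (* A positive lower bound for 1 / (1 + rate^2) bounds the rate. *)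
  destruct (positive_lower_bound_2d (fun s r => / (1 + rate s r * rate s r)) 0 l1 0 l2)
    as (d & Hd & H).
  - intros s r _ _.
    apply continuity_2d_pt_inv.
    + apply continuity_2d_pt_plus; [apply continuity_2d_pt_const|].
      apply continuity_2d_pt_mult; now apply continuity_2d_dot_minus.
    + pose proof (Rle_0_sqr (rate s r)). unfold Rsqr in *. lra.
  - intros s r _ _. apply Rinv_0_lt_compat.
    pose proof (Rle_0_sqr (rate s r)). unfold Rsqr in *. lra.
  - exists (/ d + 1). pose proof (Rinv_0_lt_compat d Hd). split; [lra|].
    intros s r [Hs Hr]. specialize (H s r Hs Hr).
    apply Rinv_le_contravar in H; [|exact Hd]. rewrite Rinv_inv in H. nra.
Qed.

(** Danskin's theorem: only the pairs at minimum distance contribute to the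
    first-order change of the minimum. *)
Lemma perturbed_distance_right_derive :
  (forall s r, rect s r -> 1 <= sep s r) -> (exists s r, rect s r /\ sep s r = 1) ->
  exists m, is_right_derive perturbed_distance 0 m /\
    forall s r, rect s r -> sep s r = 1 -> m <= rate s r.
Proof.
  intros Hsep (s0 & r0 & Hsr0 & Hstrut0).
  destruct rate_lower_bound as (M & HM & Hrate).
  set (E := fun q => exists s r, rect s r /\ sep s r = 1 /\ q = rate s r).
  assert (HE0 : E (rate s0 r0)) by (exists s0, r0; auto).
  assert (HEb : forall q, E q -> - M <= q) by (intros q (s & r & H & _ & ->); auto).
  set (m := real (Glb_Rbar E)).
  assert (Hm : forall s r, rect s r -> sep s r = 1 -> m <= rate s r).
  { intros s r H H1. apply (real_glb_le E _ (- M)); [|exact HEb]. exists s, r; auto. }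
  exists m. split; [|exact Hm].
  assert (Hsq : forall t s r,
    moved t s r ^ 2 = sep s r + 2 * t * rate s r + t ^ 2 * speed s r)
    by (intros; apply dist3_perturb_sq).
  assert (Hmoved : forall t s r, moved t s r = sqrt (moved t s r ^ 2)).
  { intros. symmetry. apply sqrt_pow2, dist3_pos. }
  assert (Hspeed : forall s r, 0 <= speed s r) by (intros; apply dot_self_nonneg).
  assert (Hpos : forall t q, (exists s r, 0 <= s <= l1 /\ 0 <= r <= l2 /\ q = moved t s r)
    -> 0 <= q) by (intros t q (s & r & _ & _ & ->); apply dist3_pos).
  assert (Hle : forall t s r, rect s r -> perturbed_distance t <= moved t s r).
  { intros t s r [Hs Hr]. apply (real_glb_le _ _ 0); [now exists s, r | exact (Hpos t)]. }
  assert (Hge : forall t b, (forall s r, rect s r -> b <= moved t s r) ->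
    b <= perturbed_distance t).
  { intros t b Hb. destruct Hsr0 as [Hs0 Hr0].
    apply (real_glb_ge _ (moved t s0 r0)); [now exists s0, r0|].
    intros q (s & r & Hs & Hr & ->). now apply Hb. }
  assert (H0 : perturbed_distance 0 = 1).
  { assert (E0 : forall s r, moved 0 s r = sqrt (sep s r)).
    { intros s r. rewrite Hmoved, Hsq. f_equal. ring. }
    apply Rle_antisym.
    - rewrite <- sqrt_1, <- Hstrut0, <- E0. now apply Hle.
    - apply Hge. intros s r H. rewrite E0, <- sqrt_1. now apply sqrt_le_1_alt, Hsep. }
  intros Q [eps HQ]. pose proof (cond_pos eps) as Heps.
  destruct (real_glb_approx E _ (- M) (eps / 2) HE0 HEb) as (q & (s1 & r1 & H1 & H1' & ->) & Hq);
    [lra|]. fold m in Hq.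
  set (mu := m - eps / 2).
  (* This function is positive because a pair with rate at most mu is not at minimum
     distance; where the second term vanishes it is the excess of [sep] over 1. *)
  destruct (positive_lower_bound_2d
    (fun s r => (sep s r - 1) + (Rabs (rate s r - mu) + (rate s r - mu))) 0 l1 0 l2)
    as (d & Hd & Hfar).
  { intros s r _ _.
    assert (Hr : continuity_2d_pt (fun s r => rate s r - mu) s r).
    { apply continuity_2d_pt_minus; [now apply continuity_2d_dot_minus|].
      apply continuity_2d_pt_const. }
    apply continuity_2d_pt_plus.
    - apply continuity_2d_pt_minus; [now apply continuity_2d_dot_minus|].
      apply continuity_2d_pt_const.
    - apply continuity_2d_pt_plus; [|exact Hr].
      apply (continuity_1d_2d_pt_comp Rabs); [apply Rcontinuity_abs | exact Hr]. }
  { intros s r Hs Hr. pose proof (Hsep s r (conj Hs Hr)) as H1s.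
    pose proof (Rle_abs (- (rate s r - mu))) as Ha. rewrite Rabs_Ropp in Ha.
    pose proof (Rle_abs (rate s r - mu)) as Ha'.
    destruct (Req_dec (sep s r) 1) as [Es|Es]; [|lra].
    pose proof (Hm s r (conj Hs Hr) Es). unfold mu in *. lra. }
  set (n := speed s1 r1). pose proof (Hspeed s1 r1) as Hn. fold n in Hn.
  pose proof (Rabs_pos mu) as Hmu.
  assert (Hmu2 : 0 <= mu ^ 2) by apply pow2_ge_0.
  set (t0 := Rmin (Rmin (eps / (n + 1)) (d / (2 * M + 2 * Rabs mu + 1)))
                  (Rmin (/ (4 * Rabs mu + 4)) (eps / (2 * mu ^ 2 + 1)))).
  assert (Ht0 : 0 < t0).
  { unfold t0. repeat apply Rmin_glb_lt; try (apply Rdiv_lt_0_compat; lra).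
    apply Rinv_0_lt_compat. lra. }
  exists (mkposreal _ Ht0). intros t Hball Ht. apply HQ.
  assert (Htt : t < t0).
  { unfold ball in Hball; simpl in Hball.
    unfold AbsRing_ball, minus, plus, opp, abs in Hball; simpl in Hball.
    rewrite Ropp_0, Rplus_0_r, Rabs_pos_eq in Hball; lra. }
  assert (Hfrac : forall a b, 0 < b -> t < a / b -> t * b < a).
  { intros a b Hb H. apply (Rmult_lt_compat_r b) in H; [|exact Hb].
    unfold Rdiv in H. rewrite Rmult_assoc, Rinv_l, Rmult_1_r in H; lra. }
  unfold t0 in Htt.
  assert (T1 : t * (n + 1) < eps).
  { apply Hfrac; [lra|]. eapply Rlt_le_trans; [exact Htt|].
    eapply Rle_trans; apply Rmin_l. }
  assert (T2 : t * (2 * M + 2 * Rabs mu + 1) < d).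
  { apply Hfrac; [lra|]. eapply Rlt_le_trans; [exact Htt|].
    eapply Rle_trans; [apply Rmin_l | apply Rmin_r]. }
  assert (T3 : t * (4 * Rabs mu + 4) < 1).
  { apply Hfrac; [lra|]. eapply Rlt_le_trans; [exact Htt|].
    unfold Rdiv. rewrite Rmult_1_l. eapply Rle_trans; [apply Rmin_r | apply Rmin_l]. }
  assert (T4 : t * (2 * mu ^ 2 + 1) < eps).
  { apply Hfrac; [lra|]. eapply Rlt_le_trans; [exact Htt|].
    eapply Rle_trans; apply Rmin_r. }
  clear t0 Ht0 Hball Htt Hfrac.
  rewrite Rplus_0_l, H0.
  assert (Hup : perturbed_distance t <= 1 + t * (rate s1 r1 + t * n / 2)).
  { eapply Rle_trans; [apply (Hle t s1 r1 H1)|]. rewrite Hmoved.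
    pose proof (pow2_ge_0 (moved t s1 r1)) as Hp.
    rewrite Hsq, H1' in Hp |- *. fold n in Hp |- *.
    replace (1 + 2 * t * rate s1 r1 + t ^ 2 * n)
      with (1 + (2 * t * rate s1 r1 + t ^ 2 * n)) in Hp |- * by ring.
    eapply Rle_trans; [apply sqrt_le_tangent; lra|]. right. field. }
  assert (Hlow : 1 + t * (mu - t * mu ^ 2) <= perturbed_distance t).
  { apply Hge. intros s r Hsr. rewrite Hmoved, Hsq.
    eapply Rle_trans; [|apply sqrt_le_1_alt; instantiate (1 := 1 + 2 * (t * mu))].
    - eapply Rle_trans; [|apply sqrt_ge_parabola].
      + right. ring.
      + rewrite Rabs_mult, (Rabs_pos_eq t) by lra. lra.
    - pose proof (Hspeed s r). pose proof (pow2_ge_0 t).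
      assert (0 <= t ^ 2 * speed s r) by now apply Rmult_le_pos.
      pose proof (Hsep s r Hsr). pose proof (Hrate s r Hsr).
      destruct (Rle_lt_dec (rate s r) mu) as [L|L].
      + destruct Hsr as [Hs Hr]. specialize (Hfar s r Hs Hr). simpl in Hfar.
        rewrite Rabs_left1 in Hfar by lra.
        assert (t * - M <= t * rate s r) by (apply Rmult_le_compat_l; lra).
        assert (t * mu <= t * Rabs mu) by (apply Rmult_le_compat_l; [lra | apply Rle_abs]).
        lra.
      + assert (t * mu <= t * rate s r) by (apply Rmult_le_compat_l; lra). lra. }
  assert (Hdiv : forall a b, a <= b * t -> a / t <= b).
  { intros a b H. apply Rmult_le_reg_r with t; [exact Ht|].
    unfold Rdiv. rewrite Rmult_assoc, Rinv_l; lra. }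
  assert (Hdiv' : forall a b, b * t <= a -> b <= a / t).
  { intros a b H. apply Rmult_le_reg_r with t; [exact Ht|].
    unfold Rdiv. rewrite Rmult_assoc, Rinv_l; lra. }
  assert (U : (perturbed_distance t - 1) / t <= rate s1 r1 + t * n / 2) by (apply Hdiv; lra).
  assert (V : mu - t * mu ^ 2 <= (perturbed_distance t - 1) / t) by (apply Hdiv'; lra).
  unfold ball; simpl. unfold AbsRing_ball, minus, plus, opp, abs; simpl.
  unfold mu in *. apply Rabs_def1; lra.
Qed.

End MinimumDistance.

(** * The two components parametrized by arclength *)

Section Components.

Variable tau : R.
Hypothesis Htau : 0 <= tau <= 1.
Notation alpha := (max_angle tau).
Notation P := (clasp_arc tau Htau).
Notation xs := (xs tau Htau).
Notation zs := (zs tau Htau).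
Notation arc_at := (arc_at tau).
Notation angle_at := (angle_at tau Htau).
Notation turning := (turning tau Htau).

(** Half of the length of the curved part. *)
Definition curved_half : R := arc_at alpha.

Lemma curved_half_nonneg : 0 <= curved_half.
Proof.
  unfold curved_half. rewrite <- (arc_at_0 tau). apply arc_at_le; [exact Htau|].
  now apply max_angle_bounds.
Qed.

Lemma turning_beyond s : curved_half <= s -> turning s = alpha.
Proof.
  intros Hs. apply clamp_ge; [now apply max_angle_bounds|].
  apply (angle_at_le tau Htau) in Hs. unfold curved_half in Hs.
  now rewrite angle_at_arc_at in Hs.
Qed.

Lemma sqrt_cos_sq : sqrt (1 - tau ^ 2) * sqrt (1 - tau ^ 2) = 1 - tau ^ 2.
Proof. apply sqrt_sqrt. nra. Qed.

Lemma affine_beyond (f d : R -> R) c r : 0 <= r ->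
  (forall s, is_derive f s (d s)) -> (forall s, curved_half <= s -> d s = c) ->
  f (curved_half + r) = f curved_half + r * c.
Proof.
  intros Hr Hf Hd.
  assert (D : forall t : R, is_derive (fun t => f (curved_half + t) - c * t) t
    ((0 + 1) * d (curved_half + t) - c * 1)).
  { intros t. apply der_minus; [|apply der_scal, der_id].
    apply (der_comp (fun t => curved_half + t) t (0 + 1) f); [|apply Hf].
    apply der_plus; [apply der_const | apply der_id]. }
  assert (E : f (curved_half + 0) - c * 0 = f (curved_half + r) - c * r).
  { apply (eq_of_derive_zero (fun t => f (curved_half + t) - c * t));
      [exact Hr | |]; intros t Ht.
    - eapply der_eq; [apply D|]. rewrite Hd by lra. ring.
    - eapply derive_continuous, D. }
  rewrite Rplus_0_r in E. lra.
Qed.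

Lemma xs_beyond r : 0 <= r -> xs (curved_half + r) = xs curved_half + r * sqrt (1 - tau ^ 2).
Proof.
  intros Hr. apply (affine_beyond xs (fun s => cos (turning s))); [exact Hr | |].
  - intros s. apply is_derive_xs.
  - intros s Hs. now rewrite turning_beyond, cos_max_angle.
Qed.

Lemma zs_beyond r : 0 <= r -> zs (curved_half + r) = zs curved_half + r * tau.
Proof.
  intros Hr. apply (affine_beyond zs (fun s => sin (turning s))); [exact Hr | |].
  - intros s. apply is_derive_zs.
  - intros s Hs. now rewrite turning_beyond, sin_max_angle.
Qed.

(** Signed arclength from the tip as a function of the parameter of [gamma_ext]. *)
Definition arc_param (u : R) : R := arc_at (asin (clamp tau u)) + (u - clamp tau u).

Definition arc_param_inv (y : R) : R :=
  sin (angle_at (clamp curved_half y)) + (y - clamp curved_half y).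

Lemma arc_param_inside u : - tau <= u <= tau -> arc_param u = arc_at (asin u).
Proof. intros Hu. unfold arc_param. rewrite clamp_id by exact Hu. ring. Qed.

Lemma arc_param_above u : tau <= u -> arc_param u = curved_half + (u - tau).
Proof. intros Hu. unfold arc_param. rewrite clamp_ge by lra. reflexivity. Qed.

Lemma arc_param_opp u : arc_param (- u) = - arc_param u.
Proof.
  unfold arc_param. rewrite clamp_opp, asin_opp, arc_at_opp by lra. ring.
Qed.

Lemma arc_param_incr u v : u < v -> arc_param u < arc_param v.
Proof.
  intros Huv. unfold arc_param.
  pose proof (clamp_bounds tau (proj1 Htau) u). pose proof (clamp_bounds tau (proj1 Htau) v).
  pose proof (clamp_incr_excess tau (proj1 Htau) u v ltac:(lra)).
  destruct (clamp_incr tau u v ltac:(lra)) as [L|L].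
  - assert (arc_at (asin (clamp tau u)) < arc_at (asin (clamp tau v)))
      by (apply arc_at_incr; [exact Htau | apply asin_increasing; lra]).
    lra.
  - rewrite L. lra.
Qed.

Lemma angle_at_curved y : - curved_half <= y <= curved_half -> - alpha <= angle_at y <= alpha.
Proof.
  intros [H1 H2]. apply (angle_at_le tau Htau) in H1, H2.
  rewrite angle_at_opp in H1. unfold curved_half in *. rewrite angle_at_arc_at in *. lra.
Qed.

Lemma arc_param_cancel y : arc_param (arc_param_inv y) = y.
Proof.
  pose proof curved_half_nonneg as H0. pose proof (max_angle_bounds tau Htau).
  assert (Hin : forall y, - curved_half <= y <= curved_half ->
    arc_param (arc_param_inv y) = y).
  { intros z Hz. unfold arc_param_inv. rewrite clamp_id by exact Hz.
    pose proof (angle_at_curved z Hz).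
    rewrite Rminus_diag, Rplus_0_r, arc_param_inside by (apply sin_le_tau; lra).
    rewrite asin_sin by lra. apply arc_at_angle_at. }
  assert (Hout : forall y, curved_half <= y -> arc_param (arc_param_inv y) = y).
  { intros z Hz. unfold arc_param_inv. rewrite clamp_ge by lra.
    unfold curved_half at 1. rewrite angle_at_arc_at, sin_max_angle by exact Htau.
    rewrite arc_param_above by lra. ring. }
  destruct (Rle_lt_dec y curved_half); [|apply Hout; lra].
  destruct (Rle_lt_dec (- curved_half) y); [apply Hin; lra|].
  assert (Eo : arc_param_inv y = - arc_param_inv (- y)).
  { unfold arc_param_inv. rewrite clamp_opp, angle_at_opp, sin_antisym by lra. ring. }
  rewrite Eo, arc_param_opp, Hout by lra. ring.
Qed.

Lemma arc_param_inv_between a b y : arc_param a <= y <= arc_param b ->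
  a <= arc_param_inv y <= b /\ arc_param (arc_param_inv y) = y.
Proof.
  intros Hy. pose proof (arc_param_cancel y) as E. split; [|exact E].
  split; apply Rnot_lt_le; intros L; apply arc_param_incr in L; lra.
Qed.

Lemma gamma_arc_param u : - tau <= u <= tau -> gamma tau u = P (arc_param u).
Proof.
  intros Hu. rewrite arc_param_inside by exact Hu. now apply gamma_angle.
Qed.

Lemma gamma_ext_arc_param u : gamma_ext tau u = P (arc_param u).
Proof.
  unfold gamma_ext. destruct (Rle_dec u (- tau)) as [L|L]; [|destruct (Rle_dec tau u) as [L'|L']].
  - set (v := - u). assert (Eu : u = - v) by (unfold v; ring). assert (tau <= v) by (unfold v; lra).
    clearbody v. subst u. clear L.
    rewrite gamma_arc_param, !clasp_arc_eq by lra.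
    rewrite !arc_param_opp, !xs_opp, !zs_opp by exact Htau.
    rewrite (arc_param_above v), xs_beyond, zs_beyond, arc_param_inside by lra.
    change (asin tau) with alpha. fold curved_half.
    apply vector_eq; unfold xc, yc, zc, n_vec; cbn; ring.
  - rewrite gamma_arc_param, !clasp_arc_eq by lra.
    rewrite (arc_param_above u), xs_beyond, zs_beyond, arc_param_inside by lra.
    change (asin tau) with alpha. fold curved_half.
    apply vector_eq; unfold xc, yc, zc, n_vec; cbn; ring.
  - apply gamma_arc_param. lra.
Qed.

End Components.

Section Link.

Variable tau : R.
Hypothesis Htau : 0 <= tau <= 1.
Notation alpha := (max_angle tau).
Notation P := (clasp_arc tau Htau).
Notation xs := (xs tau Htau).
Notation zs := (zs tau Htau).
Notation arc_at := (arc_at tau).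
Notation angle_at := (angle_at tau Htau).
Notation turning := (turning tau Htau).

(** The value of C for which the straight ends have length 0. *)
Definition support_height : R :=
  xs (curved_half tau) * sqrt (1 - tau ^ 2) + zs (curved_half tau) * tau.

Lemma gamma_end : gamma tau tau = P (curved_half tau).
Proof.
  rewrite (gamma_arc_param tau Htau), arc_param_inside by lra. reflexivity.
Qed.

Lemma gap_right C : gap tau C 1 = C - support_height.
Proof.
  unfold gap. rewrite Rmult_1_l, gamma_end, clasp_arc_eq.
  unfold support_height, n_vec, dot, xc, yc, zc; simpl. ring.
Qed.

Lemma gap_left C : gap tau C (-1) = C - support_height.
Proof.
  unfold gap. rewrite (gamma_arc_param tau Htau) by lra.
  replace (-1 * tau) with (- tau) by ring.
  rewrite arc_param_opp, arc_param_inside, clasp_arc_eq, xs_opp, zs_opp by lra.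
  unfold support_height, n_vec, dot, xc, yc, zc, curved_half; simpl.
  unfold max_angle. ring.
Qed.

Variable C : R.
Hypothesis HC : support_height <= C.

Definition half_length : R := curved_half tau + (C - support_height).

Lemma half_length_ge : curved_half tau <= half_length.
Proof. unfold half_length. lra. Qed.

Lemma half_length_nonneg : 0 <= half_length.
Proof. pose proof half_length_ge. pose proof (curved_half_nonneg tau Htau). lra. Qed.

Lemma arc_param_hi : arc_param tau (hi tau C) = half_length.
Proof.
  unfold hi. rewrite gap_right, arc_param_above by lra. unfold half_length. ring.
Qed.

Lemma arc_param_lo : arc_param tau (lo tau C) = - half_length.
Proof.
  replace (lo tau C) with (- hi tau C).
  - rewrite arc_param_opp by exact Htau. now rewrite arc_param_hi.
  - unfold lo, hi. rewrite gap_right, gap_left. ring.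
Qed.

Lemma lo_le_hi : lo tau C <= hi tau C.
Proof. unfold lo, hi. rewrite gap_left, gap_right. lra. Qed.

Lemma arc_length_ext : arc_length (gamma_ext tau) (lo tau C) (hi tau C) =
  Finite (2 * half_length).
Proof.
  rewrite (arc_length_reparam (turning) (z_gamma tau 0) (continuous_turning tau Htau)
    (gamma_ext tau) (arc_param tau) (arc_param_inv tau Htau)).
  - rewrite arc_param_hi, arc_param_lo. f_equal. ring.
  - intros u _. apply gamma_ext_arc_param.
  - intros u v _ Huv _. now apply arc_param_incr.
  - intros y Hy. now apply arc_param_inv_between.
  - exact lo_le_hi.
Qed.

Lemma len1_eq : len1 tau C = 2 * half_length.
Proof. unfold len1. now rewrite arc_length_ext. Qed.

Lemma len2_eq : len2 tau C = 2 * half_length.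
Proof. unfold len2. now rewrite arc_length_sym, arc_length_ext. Qed.

Lemma arc1_eq s : 0 <= s <= 2 * half_length -> arc1 tau C s = P (s - half_length).
Proof.
  intros Hs. unfold arc1.
  rewrite (by_arclength_reparam (turning) (z_gamma tau 0) (gamma_ext tau)
    (arc_param tau) (arc_param_inv tau Htau)).
  - rewrite arc_param_lo. unfold clasp_arc. f_equal. ring.
  - apply continuous_turning.
  - exact lo_le_hi.
  - intros u _. apply gamma_ext_arc_param.
  - intros u v _ Huv _. now apply arc_param_incr.
  - intros y Hy. now apply arc_param_inv_between.
  - rewrite arc_param_hi, arc_param_lo. lra.
Qed.

Lemma arc2_eq s : 0 <= s <= 2 * half_length -> arc2 tau C s = sym (P (s - half_length)).
Proof.
  intros Hs. unfold arc2. rewrite by_arclength_sym. f_equal. now apply arc1_eq.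
Qed.

(** * Endpoints and obstacles *)

Lemma end_on_plane : xs half_length * sqrt (1 - tau ^ 2) + zs half_length * tau = C.
Proof.
  unfold half_length. rewrite xs_beyond, zs_beyond by lra.
  pose proof (sqrt_cos_sq tau Htau). unfold support_height in *. nra.
Qed.

Lemma zs_min s : zs 0 <= zs s.
Proof.
  assert (H : forall r, 0 <= r -> zs 0 <= zs r).
  { intros r Hr. apply (le_of_derive_nonneg zs (fun r => sin (turning r))); [exact Hr | | |].
    - intros. apply is_derive_zs.
    - intros. eapply derive_continuous, is_derive_zs.
    - intros x Hx. pose proof (max_angle_bounds tau Htau) as Ha.
      pose proof (turning_bounds tau Htau x).
      assert (angle_at 0 <= angle_at x) by (apply (proj1 (angle_at_le tau Htau 0 x)); lra).
      rewrite <- (arc_at_0 tau) in H0 at 1. rewrite angle_at_arc_at in H0.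
      pose proof (clamp_nonneg alpha (proj1 Ha) (angle_at x) H0).
      apply sin_ge_0; [exact H1 | lra]. }
  destruct (Rle_lt_dec 0 s); [now apply H|].
  rewrite <- (zs_opp tau Htau s). apply H. lra.
Qed.

Hypothesis HC' : 1 + Rabs (z_gamma tau 0) <= C.

(** The quantity on the right is the value of every obstacle function on its arc, by
    [wall_first] and [wall_second]; it is least at the tip. *)
Lemma obstacle_slack s : 1 <= C + tau * zs s.
Proof.
  pose proof (zs_min s) as H. rewrite zs_0 in H.
  pose proof (Rle_abs (- z_gamma tau 0)) as Ha. rewrite Rabs_Ropp in Ha.
  assert (- Rabs (z_gamma tau 0) <= zs s) by lra.
  pose proof (Rabs_pos (z_gamma tau 0)).
  assert (tau * - Rabs (z_gamma tau 0) <= tau * zs s) by (apply Rmult_le_compat_l; lra).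
  assert (tau * Rabs (z_gamma tau 0) <= 1 * Rabs (z_gamma tau 0))
    by (apply Rmult_le_compat_r; lra).
  lra.
Qed.

Lemma wall_first e s : wall C (nt_vec tau e) (P s) = C + tau * zs s.
Proof. rewrite clasp_arc_eq. unfold wall, nt_vec, dot, xc, yc, zc; simpl. ring. Qed.

Lemma wall_second e s : wall C (n_vec tau e) (sym (P s)) = C + tau * zs s.
Proof. rewrite clasp_arc_eq. unfold wall, n_vec, sym, dot, xc, yc, zc; simpl. ring. Qed.

Lemma clasp_admissible :
  admissible (clasp_link tau C (len1 tau C) (arc1 tau C) (len2 tau C) (arc2 tau C)).
Proof.
  pose proof half_length_nonneg. pose proof end_on_plane as E.
  unfold admissible, satisfies_constraints, on_plane; simpl.
  rewrite len1_eq, len2_eq, !arc1_eq, !arc2_eq by lra.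
  replace (0 - half_length) with (- half_length) by ring.
  replace (2 * half_length - half_length) with half_length by ring.
  rewrite !clasp_arc_eq, !xs_opp, !zs_opp.
  repeat split; try (etransitivity; [|exact E];
    unfold n_vec, nt_vec, sym, dot, xc, yc, zc; simpl; ring).
  - intros g s Hg Hs. rewrite arc1_eq by exact Hs.
    pose proof (obstacle_slack (s - half_length)).
    destruct Hg as [<-|[<-|[]]]; rewrite wall_first; lra.
  - intros g s Hg Hs. rewrite arc2_eq by exact Hs.
    pose proof (obstacle_slack (s - half_length)).
    destruct Hg as [<-|[<-|[]]]; rewrite wall_second; lra.
Qed.

Lemma no_contact xi1 xi2 :
  dObst (clasp_link tau C (len1 tau C) (arc1 tau C) (len2 tau C) (arc2 tau C)) xi1 xi2
  = p_infty.
Proof.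
  apply is_glb_Rbar_unique. split.
  - intros d [(s & g & Hs & Hg & Hz & _)|(s & g & Hs & Hg & Hz & _)]; exfalso; simpl in *.
    + rewrite len1_eq in Hs. rewrite arc1_eq in Hz by exact Hs.
      pose proof (obstacle_slack (s - half_length)).
      destruct Hg as [<-|[<-|[]]]; rewrite wall_first in Hz; lra.
    + rewrite len2_eq in Hs. rewrite arc2_eq in Hz by exact Hs.
      pose proof (obstacle_slack (s - half_length)).
      destruct Hg as [<-|[<-|[]]]; rewrite wall_second in Hz; lra.
  - intros b _. destruct b; exact I.
Qed.

End Link.

(** * First variation of length *)

Section Variation.

Variable tau : R.
Hypothesis Htau : 0 <= tau <= 1.
Notation alpha := (max_angle tau).
Notation P := (clasp_arc tau Htau).
Notation xs := (xs tau Htau).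
Notation zs := (zs tau Htau).
Notation arc_at := (arc_at tau).
Notation turning := (turning tau Htau).

Section OneArc.

Variables (h : R) (a a' b b' : R -> R).
Hypothesis Hh : curved_half tau <= h.
Hypotheses (Ha : forall s, is_derive a s (a' s)) (Ha' : forall s, continuous a' s).
Hypotheses (Hb : forall s, is_derive b s (b' s)) (Hb' : forall s, continuous b' s).

(** Minus the normal component, at angle w, of the field with components a, b; the
    normal is (- sin w, cos w). *)
Definition bend (w : R) : R := sin w * a (h + arc_at w) - cos w * b (h + arc_at w).

Lemma continuous_bend w : continuous bend w.
Proof.
  assert (Hw : continuous (fun w => h + arc_at w) w).
  { cont. eapply derive_continuous, is_derive_arc_at. exact Htau. }
  unfold bend. cont.
  - apply (cont_comp _ w a Hw). eapply derive_continuous, Ha.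
  - apply (cont_comp _ w b Hw). eapply derive_continuous, Hb.
Qed.

Lemma continuous_bend_pair w : continuous (fun w => bend w + bend (- w)) w.
Proof.
  apply cont_plus; [apply continuous_bend|].
  apply (cont_comp (fun w => - w) w bend); [cont | apply continuous_bend].
Qed.

(** The tangent is constant on the straight ends and turns with unit speed as a
    function of w in between, so after an integration by parts only boundary terms
    and the normal component along the curved part remain. *)
Lemma length_variation :
  RInt (fun s => cos (turning (s - h)) * a' s + sin (turning (s - h)) * b' s) 0 (2 * h) =
  (sqrt (1 - tau ^ 2) * a (2 * h) + tau * b (2 * h))
  - (sqrt (1 - tau ^ 2) * a 0 - tau * b 0)
  + RInt (fun w => bend w + bend (- w)) 0 alpha.
Proof.
  set (f := fun s => cos (turning (s - h)) * a' s + sin (turning (s - h)) * b' s).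
  pose proof (curved_half_nonneg tau Htau) as H0. pose proof (max_angle_bounds tau Htau) as Hal.
  pose proof (sin_max_angle tau Htau) as Es. pose proof (cos_max_angle tau Htau) as Ec.
  set (J := fun s => RInt f 0 s).
  assert (HJ : forall s, is_derive J s (f s)).
  { intros s. apply is_derive_primitive. intros r. unfold f.
    assert (continuous (fun s => turning (s - h)) r).
    { apply (cont_comp (fun s => s - h) r turning); [cont | apply continuous_turning]. }
    cont; auto. }
  assert (E1 : J (h + curved_half tau) - (cos alpha * a (h + curved_half tau)
                 + sin alpha * b (h + curved_half tau))
               = J (2 * h) - (cos alpha * a (2 * h) + sin alpha * b (2 * h))).
  { assert (D : forall s : R, is_derive (fun s => J s - (cos alpha * a s + sin alpha * b s)) s
        (f s - ((0 * a s + cos alpha * a' s) + (0 * b s + sin alpha * b' s)))).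
    { intros s. apply der_minus; [apply HJ|].
      exact (der_plus _ _ s _ _
        (der_mult (fun _ => cos alpha) a s 0 (a' s) (der_const _ s) (Ha s))
        (der_mult (fun _ => sin alpha) b s 0 (b' s) (der_const _ s) (Hb s))). }
    apply (eq_of_derive_zero (fun s => J s - (cos alpha * a s + sin alpha * b s)));
      [lra | |]; intros s Hs.
    - eapply der_eq; [apply D|]. unfold f. rewrite turning_beyond by lra. ring.
    - eapply derive_continuous, D. }
  assert (E2 : J 0 - (cos alpha * a 0 - sin alpha * b 0)
               = J (h - curved_half tau) - (cos alpha * a (h - curved_half tau)
                 - sin alpha * b (h - curved_half tau))).
  { assert (D : forall s : R, is_derive (fun s => J s - (cos alpha * a s - sin alpha * b s)) s
        (f s - ((0 * a s + cos alpha * a' s) - (0 * b s + sin alpha * b' s)))).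
    { intros s. apply der_minus; [apply HJ|].
      exact (der_minus _ _ s _ _
        (der_mult (fun _ => cos alpha) a s 0 (a' s) (der_const _ s) (Ha s))
        (der_mult (fun _ => sin alpha) b s 0 (b' s) (der_const _ s) (Hb s))). }
    apply (eq_of_derive_zero (fun s => J s - (cos alpha * a s - sin alpha * b s)));
      [lra | |]; intros s Hs.
    - eapply der_eq; [apply D|]. unfold f.
      replace (s - h) with (- (h - s)) by ring.
      rewrite turning_opp, turning_beyond, cos_neg, sin_antisym by lra. ring.
    - eapply derive_continuous, D. }
  set (B := fun w => RInt bend 0 w).
  assert (HB : forall w, is_derive B w (bend w))
    by (intros; apply is_derive_primitive, continuous_bend).
  set (M := fun w => J (h + arc_at w)
    - (cos w * a (h + arc_at w) + sin w * b (h + arc_at w)) - B w).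
  assert (E3 : M (- alpha) = M alpha).
  { assert (D : forall w : R, is_derive M w
      ((0 + radius tau w) * f (h + arc_at w)
       - ((- sin w * a (h + arc_at w) + cos w * ((0 + radius tau w) * a' (h + arc_at w)))
          + (cos w * b (h + arc_at w) + sin w * ((0 + radius tau w) * b' (h + arc_at w))))
       - bend w)).
    { intros w.
      assert (Hw : is_derive (fun w => h + arc_at w) w (0 + radius tau w))
        by (apply der_plus; [apply der_const | now apply is_derive_arc_at]).
      apply der_minus; [apply der_minus|apply HB].
      - exact (der_comp _ w _ J _ Hw (HJ _)).
      - exact (der_plus _ _ w _ _
          (der_mult cos _ w _ _ (is_derive_cos w) (der_comp _ w _ a _ Hw (Ha _)))
          (der_mult sin _ w _ _ (is_derive_sin w) (der_comp _ w _ b _ Hw (Hb _)))). }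
    apply (eq_of_derive_zero M); [lra | |]; intros w Hw.
    - eapply der_eq; [apply D|]. unfold f, bend.
      replace (h + arc_at w - h) with (arc_at w) by ring.
      rewrite turning_arc_at, clamp_id by lra. ring.
    - eapply derive_continuous, D. }
  assert (E4 : B alpha - B (- alpha) = RInt (fun w => bend w + bend (- w)) 0 alpha).
  { set (Q := fun w => RInt (fun w => bend w + bend (- w)) 0 w).
    assert (D : forall w : R, is_derive (fun w => B w - B (- w) - Q w) w
      (bend w - (- (1) * bend (- w)) - (bend w + bend (- w)))).
    { intros w. apply der_minus; [apply der_minus|].
      - apply HB.
      - exact (der_comp (fun w => - w) w (- (1)) B _ (der_neg w) (HB _)).
      - apply (is_derive_primitive (fun w => bend w + bend (- w))), continuous_bend_pair. }
    assert (E : B 0 - B (- 0) - Q 0 = B alpha - B (- alpha) - Q alpha).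
    { apply (eq_of_derive_zero (fun w => B w - B (- w) - Q w)); [lra | |]; intros w Hw.
      - eapply der_eq; [apply D | ring].
      - eapply derive_continuous, D. }
    unfold B, Q in *. rewrite Ropp_0, !RInt_zero in E. lra. }
  unfold M in E3. rewrite arc_at_opp, cos_neg, sin_antisym in E3 by exact Htau.
  fold (curved_half tau) in E3.
  replace (h + - curved_half tau) with (h - curved_half tau) in E3 by ring.
  assert (J0 : J 0 = 0) by apply RInt_zero.
  fold (J (2 * h)). rewrite <- E4, <- Ec.
  replace tau with (sin alpha) at 2 4 by exact Es. lra.
Qed.

End OneArc.
End Variation.

(** * Balance *)

Lemma smooth_field_derive (xi : R -> R3) s : smooth_field xi ->
  (is_derive (fun r => xc (xi r)) s (Derive (fun r => xc (xi r)) s) /\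
   continuous (Derive (fun r => xc (xi r))) s) /\
  (is_derive (fun r => yc (xi r)) s (Derive (fun r => yc (xi r)) s) /\
   continuous (Derive (fun r => yc (xi r))) s) /\
  (is_derive (fun r => zc (xi r)) s (Derive (fun r => zc (xi r)) s) /\
   continuous (Derive (fun r => zc (xi r))) s).
Proof.
  intros H. destruct (H 1%nat s) as (X1 & Y1 & Z1). destruct (H 2%nat s) as (X2 & Y2 & Z2).
  simpl in *.
  repeat split; try (apply Derive_correct; assumption);
    apply (ex_derive_continuous (V := R_NormedModule)); assumption.
Qed.

Lemma smooth_field_continuous (xi : R -> R3) : smooth_field xi -> continuous3 xi.
Proof.
  intros H s. destruct (smooth_field_derive xi s H) as ((X & _) & (Y & _) & (Z & _)).
  repeat split; eapply derive_continuous; eassumption.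
Qed.

(** The sines at the two ends of a strut add up to tau, so one of them is at most 1/2.
    The bound is a combination of derivatives of arcsines, hence integrable even for
    tau = 1, when both ends of the interval are singular. *)
Lemma strut_density_bound tau u : 0 <= tau <= 1 -> 0 < u < tau ->
  / strut_height tau u <= 2 * (/ sqrt (1 - u ^ 2) + / sqrt (1 - (tau - u) ^ 2)).
Proof.
  intros Htau Hu.
  assert (HA : 0 < sqrt (1 - u ^ 2)) by (apply sqrt_lt_R0; nra).
  assert (HB : 0 < sqrt (1 - (tau - u) ^ 2)) by (apply sqrt_lt_R0; nra).
  pose proof (strut_denominator_pos tau Htau u ltac:(lra)) as HD.
  pose proof (sqrt_lt_R0 _ HD) as HD'.
  assert (HD1 : sqrt (1 - u ^ 2 * (tau - u) ^ 2) <= 1).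
  { apply Rle_trans with (sqrt 1); [|rewrite sqrt_1; lra]. apply sqrt_le_1_alt.
    assert (0 <= u ^ 2 * (tau - u) ^ 2) by (apply Rmult_le_pos; apply pow2_ge_0). lra. }
  assert (Hhalf : forall x, 0 <= x <= 1 / 2 -> 1 / 2 <= sqrt (1 - x ^ 2)).
  { intros x Hx. rewrite <- (sqrt_pow2 (1 / 2)) by lra. apply sqrt_le_1_alt. nra. }
  assert (Hsum : 1 / 2 <= sqrt (1 - u ^ 2) + sqrt (1 - (tau - u) ^ 2)).
  { destruct (Rle_lt_dec u (1 / 2)).
    - pose proof (Hhalf u ltac:(lra)). lra.
    - pose proof (Hhalf (tau - u) ltac:(lra)). lra. }
  unfold strut_height.
  set (A := sqrt (1 - u ^ 2)) in *. set (B := sqrt (1 - (tau - u) ^ 2)) in *.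
  set (D := sqrt (1 - u ^ 2 * (tau - u) ^ 2)) in *.
  replace (/ (A * B / D)) with (D * / (A * B)) by (field; lra).
  replace (2 * (/ A + / B)) with ((2 * (A + B)) * / (A * B)) by (field; lra).
  apply Rmult_le_compat_r; [|lra].
  left. apply Rinv_0_lt_compat. now apply Rmult_lt_0_compat.
Qed.

Section Balance.

Variable tau : R.
Hypothesis Htau : 0 <= tau <= 1.
Notation alpha := (max_angle tau).
Notation P := (clasp_arc tau Htau).
Notation xs := (xs tau Htau).
Notation zs := (zs tau Htau).
Notation arc_at := (arc_at tau).
Notation turning := (turning tau Htau).

Variable C : R.
Hypothesis HC : support_height tau Htau <= C.
Notation h := (half_length tau Htau C).
Notation L := (clasp_link tau C (len1 tau C) (arc1 tau C) (len2 tau C) (arc2 tau C)).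

Lemma velocity_arc1 s : 0 < s < 2 * h ->
  velocity (arc1 tau C) s = (cos (turning (s - h)), 0, sin (turning (s - h))).
Proof.
  intros Hs.
  assert (Hloc : forall f : R3 -> R, locally s (fun r => f (P (r - h)) = f (arc1 tau C r))).
  { intros f. apply (locally_interval _ s 0 (2 * h)); simpl; try lra.
    intros r ? ?. rewrite (arc1_eq tau Htau C HC) by (simpl in *; lra). reflexivity. }
  assert (Hsh : is_derive (fun r => r - h) s (1 - 0))
    by (apply der_minus; [apply der_id | apply der_const]).
  unfold velocity. f_equal; [f_equal|]; apply is_derive_unique.
  - apply (is_derive_ext_loc _ _ _ _ (Hloc xc)). eapply der_eq.
    + exact (der_comp _ s _ xs _ Hsh (is_derive_xs tau Htau _)).
    + ring.
  - apply (is_derive_ext_loc _ _ _ _ (Hloc yc)). apply (der_const 0).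
  - apply (is_derive_ext_loc _ _ _ _ (Hloc zc)). eapply der_eq.
    + exact (der_comp _ s _ zs _ Hsh (is_derive_zs tau Htau _)).
    + ring.
Qed.

Lemma velocity_sym c s : velocity (fun r => sym (c r)) s = sym (velocity c s).
Proof.
  unfold velocity, sym. apply vector_eq; unfold xc, yc, zc; simpl; try reflexivity.
  apply Derive_opp.
Qed.

Lemma velocity_arc2 s : 0 < s < 2 * h ->
  velocity (arc2 tau C) s = (0, cos (turning (s - h)), - sin (turning (s - h))).
Proof.
  intros Hs.
  assert (E : velocity (arc2 tau C) s = velocity (fun r => sym (arc1 tau C r)) s).
  { unfold arc2, velocity. f_equal; [f_equal|];
      apply Derive_ext; intros r; now rewrite by_arclength_sym. }
  now rewrite E, velocity_sym, velocity_arc1 by exact Hs.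
Qed.

Definition bend_pair (a b : R -> R) (w : R) : R :=
  bend tau h a b w + bend tau h a b (- w).

Lemma dLen_first xi1 : smooth_field xi1 -> compatible (fst L) xi1 ->
  dLen (fst L) xi1 =
  RInt (bend_pair (fun s => xc (xi1 s)) (fun s => zc (xi1 s))) 0 alpha.
Proof.
  intros Hxi [H0 H1]. simpl in H0, H1. unfold dLen; simpl.
  rewrite (len1_eq tau Htau C HC) in H1 |- *.
  pose proof (half_length_nonneg tau Htau C HC).
  rewrite (RInt_ext _ (fun s => cos (turning (s - h)) * Derive (fun s => xc (xi1 s)) s
    + sin (turning (s - h)) * Derive (fun s => zc (xi1 s)) s)).
  - rewrite (length_variation tau Htau h (fun s => xc (xi1 s)) _ (fun s => zc (xi1 s)) _);
      try (intros s; apply (smooth_field_derive xi1 s Hxi)); [|now apply half_length_ge].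
    unfold dot, n_vec, xc, yc, zc in *; simpl in *. unfold bend_pair. lra.
  - intros s Hs. rewrite Rmin_left, Rmax_right in Hs by lra.
    rewrite velocity_arc1 by exact Hs. unfold dot, velocity, xc, yc, zc; simpl. ring.
Qed.

Lemma dLen_second xi2 : smooth_field xi2 -> compatible (snd L) xi2 ->
  dLen (snd L) xi2 =
  RInt (bend_pair (fun s => yc (xi2 s)) (fun s => - zc (xi2 s))) 0 alpha.
Proof.
  intros Hxi [H0 H1]. simpl in H0, H1. unfold dLen; simpl.
  rewrite (len2_eq tau Htau C HC) in H1 |- *.
  pose proof (half_length_nonneg tau Htau C HC).
  rewrite (RInt_ext _ (fun s => cos (turning (s - h)) * Derive (fun s => yc (xi2 s)) s
    + sin (turning (s - h)) * - Derive (fun s => zc (xi2 s)) s)).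
  - rewrite (length_variation tau Htau h (fun s => yc (xi2 s)) _
      (fun s => - zc (xi2 s)) (fun s => - Derive (fun s => zc (xi2 s)) s)).
    + unfold dot, nt_vec, xc, yc, zc in *; simpl in *. unfold bend_pair. lra.
    + now apply half_length_ge.
    + intros s; apply (smooth_field_derive xi2 s Hxi).
    + intros s; apply (smooth_field_derive xi2 s Hxi).
    + intros s. apply der_opp, (smooth_field_derive xi2 s Hxi).
    + intros s. apply cont_opp, (smooth_field_derive xi2 s Hxi).
  - intros s Hs. rewrite Rmin_left, Rmax_right in Hs by lra.
    rewrite velocity_arc2 by exact Hs. unfold dot, velocity, xc, yc, zc; simpl. ring.
Qed.

(** The two arcs continued to the whole line, so that they are continuous everywhere. *)
Definition first_arc (s : R) : R3 := P (s - h).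
Definition second_arc (s : R) : R3 := sym (P (s - h)).

Definition strut_rate (xi1 xi2 : R -> R3) (s r : R) : R :=
  dot (minus (first_arc s) (second_arc r)) (minus (xi1 s) (xi2 r)).

(** At each of the four points two of these struts end, and their components normal to
    the plane of the arc are opposite; the sum of the two is therefore along the normal
    of the arc, with the same factor on both arcs up to the cosine of the angle. *)
Lemma four_struts xi1 xi2 u : 0 < u < tau ->
  let s := arc_at (asin u) in
  let r := arc_at (asin (tau - u)) in
  strut_rate xi1 xi2 (h + s) (h + r) + strut_rate xi1 xi2 (h + s) (h + - r)
  + strut_rate xi1 xi2 (h + - s) (h + r) + strut_rate xi1 xi2 (h + - s) (h + - r) =
  2 * strut_height tau u *
  (/ sqrt (1 - u ^ 2) *
     bend_pair (fun s => xc (xi1 s)) (fun s => zc (xi1 s)) (asin u)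
   + / sqrt (1 - (tau - u) ^ 2) *
     bend_pair (fun s => yc (xi2 s)) (fun s => - zc (xi2 s)) (asin (tau - u))).
Proof.
  intros Hu s r. unfold strut_rate, first_arc, second_arc.
  assert (Eh : forall t, h + t - h = t) by (intros; ring). rewrite !Eh.
  assert (HA : 0 < sqrt (1 - u ^ 2)) by (apply sqrt_lt_R0; nra).
  assert (HB : 0 < sqrt (1 - (tau - u) ^ 2)) by (apply sqrt_lt_R0; nra).
  pose proof (strut_z tau Htau u ltac:(lra)) as Ez. fold s r in Ez.
  pose proof (strut_normal tau u ltac:(lra)) as E1.
  pose proof (strut_normal tau (tau - u) ltac:(lra)) as E2.
  rewrite strut_height_conj in E2.
  rewrite (x_gamma_arc tau Htau) in E1, E2 by lra. fold s r in E1, E2.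
  unfold bend_pair, bend. rewrite !sin_antisym, !cos_neg, !arc_at_opp by exact Htau.
  rewrite !sin_asin, !cos_asin_pow by lra. fold s r.
  rewrite !clasp_arc_eq, !xs_opp, !zs_opp.
  set (H := strut_height tau u) in *.
  set (A := sqrt (1 - u ^ 2)) in *. set (B := sqrt (1 - (tau - u) ^ 2)) in *.
  assert (X1 : xs s = u * H / A) by (rewrite <- E1; field; lra).
  assert (X2 : xs r = (tau - u) * H / B) by (rewrite <- E2; field; lra).
  assert (Z2 : zs r = - H - zs s) by lra.
  rewrite X1, X2, Z2.
  destruct (xi1 (h + s)) as [[? ?] ?], (xi1 (h + - s)) as [[? ?] ?],
    (xi2 (h + r)) as [[? ?] ?], (xi2 (h + - r)) as [[? ?] ?].
  unfold dot, sym, xc, yc, zc; cbn. field. lra.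
Qed.

(** With u as parameter on the first arc and tau - u on the second, the variation of
    length is the integral of the rates of the struts against a positive density.  It is
    compared with the integral of m times the bound for that density, which is
    8 * m * max_angle.  No integral in u occurs: both sides are primitives composed with
    arcsines, compared through their derivatives. *)
Lemma balance xi1 xi2 m : smooth_field xi1 -> smooth_field xi2 -> m <= 0 ->
  (forall s r, 0 <= s <= 2 * h -> 0 <= r <= 2 * h ->
     dist3 (first_arc s) (second_arc r) ^ 2 = 1 -> m <= strut_rate xi1 xi2 s r) ->
  16 * m <= RInt (bend_pair (fun s => xc (xi1 s)) (fun s => zc (xi1 s))) 0 alpha
            + RInt (bend_pair (fun s => yc (xi2 s)) (fun s => - zc (xi2 s))) 0 alpha.
Proof.
  intros Hxi1 Hxi2 Hm Hrate.
  set (q1 := bend_pair (fun s => xc (xi1 s)) (fun s => zc (xi1 s))).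
  set (q2 := bend_pair (fun s => yc (xi2 s)) (fun s => - zc (xi2 s))).
  assert (Hq1 : forall w, continuous q1 w).
  { intros w. apply (continuous_bend_pair tau Htau h _ (Derive (fun s => xc (xi1 s)))
      _ (Derive (fun s => zc (xi1 s)))); intros s; apply (smooth_field_derive xi1 s Hxi1). }
  assert (Hq2 : forall w, continuous q2 w).
  { intros w. apply (continuous_bend_pair tau Htau h _ (Derive (fun s => yc (xi2 s)))
      _ (fun s => - Derive (fun s => zc (xi2 s)) s)); intros s.
    - apply (smooth_field_derive xi2 s Hxi2).
    - apply der_opp, (smooth_field_derive xi2 s Hxi2). }
  set (I1 := fun w => RInt q1 0 w). set (I2 := fun w => RInt q2 0 w).
  assert (HI1 : forall w, is_derive I1 w (q1 w)) by (intros; now apply is_derive_primitive).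
  assert (HI2 : forall w, is_derive I2 w (q2 w)) by (intros; now apply is_derive_primitive).
  (* Its increment over the whole interval is the right-hand side minus 8 * m * alpha. *)
  set (Lam := fun u => I1 (asin u) - I2 (asin (tau - u))
                       - 4 * m * (asin u - asin (tau - u))).
  assert (Hconj : forall u : R, is_derive (fun u => tau - u) u (0 - 1))
    by (intros; apply der_minus; [apply der_const | apply der_id]).
  assert (Hmono : Lam 0 <= Lam tau).
  { apply (le_of_derive_nonneg Lam (fun u =>
      / sqrt (1 - u ^ 2) * q1 (asin u)
      - ((0 - 1) * / sqrt (1 - (tau - u) ^ 2)) * q2 (asin (tau - u))
      - (0 * (asin u - asin (tau - u))
         + 4 * m * (/ sqrt (1 - u ^ 2) - (0 - 1) * / sqrt (1 - (tau - u) ^ 2)))));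
      [lra | | |].
    - intros u Hu.
      pose proof (is_derive_asin u ltac:(lra)) as D1.
      pose proof (der_comp _ u _ asin _ (Hconj u) (is_derive_asin (tau - u) ltac:(lra))) as D2.
      exact (der_minus _ _ u _ _
        (der_minus _ _ u _ _ (der_comp _ u _ I1 _ D1 (HI1 _)) (der_comp _ u _ I2 _ D2 (HI2 _)))
        (der_mult _ _ u _ _ (der_const (4 * m) u) (der_minus _ _ u _ _ D1 D2))).
    - intros u Hu.
      assert (D1 : continuous asin u) by apply continuous_asin.
      assert (D2 : continuous (fun u => asin (tau - u)) u).
      { apply (cont_comp (fun u => tau - u) u asin); [cont | apply continuous_asin]. }
      unfold Lam. cont.
      + apply (cont_comp _ u I1 D1). eapply derive_continuous, HI1.
      + apply (cont_comp _ u I2 D2). eapply derive_continuous, HI2.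
    - intros u Hu.
      pose proof (four_struts xi1 xi2 u Hu) as E. cbv zeta in E. fold q1 q2 in E.
      set (s := arc_at (asin u)) in *. set (r := arc_at (asin (tau - u))) in *.
      assert (Hcurved : forall v, 0 <= v <= tau ->
        0 <= h + arc_at (asin v) <= 2 * h /\ 0 <= h + - arc_at (asin v) <= 2 * h).
      { intros v Hv. pose proof (half_length_ge tau Htau C HC) as Hg.
        pose proof (asin_le_max_angle tau Htau v ltac:(lra)).
        assert (arc_at (asin v) <= curved_half tau) by (apply arc_at_le; [exact Htau | lra]).
        assert (0 <= arc_at (asin v)).
        { rewrite <- (arc_at_0 tau). apply arc_at_le; [exact Htau|].
          rewrite <- asin_0. apply asin_le; lra. }
        lra. }
      destruct (Hcurved u ltac:(lra)) as [Hs Hs']. destruct (Hcurved (tau - u) ltac:(lra)) as [Hr Hr'].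
      fold s in Hs, Hs'. fold r in Hr, Hr'.
      assert (Hone : forall e f, (e = s \/ e = - s) -> (f = r \/ f = - r) ->
        dist3 (first_arc (h + e)) (second_arc (h + f)) ^ 2 = 1).
      { intros e f He Hf. unfold first_arc, second_arc.
        replace (h + e - h) with e by ring. replace (h + f - h) with f by ring.
        rewrite dist3_clasp_sq, <- (sep_sq_strut tau Htau u) by lra. fold s r.
        destruct He as [->| ->]; rewrite ?sep_sq_opp;
          destruct Hf as [->| ->]; rewrite ?(sep_sq_comm tau Htau _ (- r)), ?sep_sq_opp;
          rewrite ?(sep_sq_comm tau Htau r s); reflexivity. }
      pose proof (Hrate _ _ Hs Hr (Hone s r (or_introl eq_refl) (or_introl eq_refl))).
      pose proof (Hrate _ _ Hs Hr' (Hone s (- r) (or_introl eq_refl) (or_intror eq_refl))).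
      pose proof (Hrate _ _ Hs' Hr (Hone (- s) r (or_intror eq_refl) (or_introl eq_refl))).
      pose proof (Hrate _ _ Hs' Hr' (Hone (- s) (- r) (or_intror eq_refl) (or_intror eq_refl))).
      pose proof (strut_density_bound tau u Htau Hu) as Hdens.
      assert (HH : 0 < strut_height tau u).
      { assert (0 < strut_height tau u ^ 2).
        { rewrite strut_height_sq by lra. apply Rdiv_lt_0_compat.
          - apply Rmult_lt_0_compat; nra.
          - apply strut_denominator_pos; lra. }
        pose proof (strut_height_nonneg tau u). nra. }
      set (H0' := strut_height tau u) in *.
      set (q := / sqrt (1 - u ^ 2) * q1 (asin u)
                + / sqrt (1 - (tau - u) ^ 2) * q2 (asin (tau - u))) in *.
      assert (Hq : 2 * m * / H0' <= q).
      { apply Rmult_le_reg_l with (2 * H0'); [lra|].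
        replace (2 * H0' * (2 * m * / H0')) with (4 * m) by (field; lra). lra. }
      assert (2 * m * (2 * (/ sqrt (1 - u ^ 2) + / sqrt (1 - (tau - u) ^ 2)))
              <= 2 * m * / H0').
      { apply Rmult_le_compat_neg_l; [lra | exact Hdens]. }
      unfold q in *. lra. }
  unfold Lam in Hmono.
  rewrite Rminus_0_r, Rminus_diag, asin_0 in Hmono. change (asin tau) with alpha in Hmono.
  unfold I1, I2 in Hmono. rewrite !RInt_zero in Hmono.
  pose proof (max_angle_bounds tau Htau). pose proof PI_4.
  assert (m * 16 <= m * (8 * alpha)) by (apply Rmult_le_compat_neg_l; lra).
  unfold I1, I2. lra.
Qed.

Hypothesis HC' : 1 + Rabs (z_gamma tau 0) <= C.

Lemma continuous_first_arc : continuous3 first_arc.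
Proof.
  intros s.
  assert (Hs : continuous (fun s => s - h) s) by cont.
  unfold first_arc. repeat split.
  - apply (cont_comp _ s xs Hs). eapply derive_continuous, is_derive_xs.
  - apply continuous_const.
  - apply (cont_comp _ s zs Hs). eapply derive_continuous, is_derive_zs.
Qed.

Lemma continuous_second_arc : continuous3 second_arc.
Proof.
  intros s. destruct (continuous_first_arc s) as (X & Y & Z). repeat split.
  - exact Y.
  - exact X.
  - exact (cont_opp _ s Z).
Qed.

Lemma LThi_perturb xi1 xi2 t :
  LThi (perturb (fst L) xi1 t, perturb (snd L) xi2 t) =
  perturbed_distance first_arc second_arc xi1 xi2 (2 * h) (2 * h) t.
Proof.
  unfold LThi, perturbed_distance. f_equal. apply Glb_Rbar_eqset. intros d. simpl.
  rewrite (len1_eq tau Htau C HC), (len2_eq tau Htau C HC).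
  split; intros (s & r & Hs & Hr & ->); exists s, r; repeat split; try lra;
    rewrite (arc1_eq tau Htau C HC), (arc2_eq tau Htau C HC) by lra; reflexivity.
Qed.

Lemma clasp_strongly_critical : strongly_critical L.
Proof.
  exists (1 / 16). split; [lra|].
  intros xi1 xi2 Hxi1 Hxi2 Hk1 Hk2 HdLen.
  rewrite dLen_first, dLen_second in HdLen by assumption.
  assert (Hsep : forall s r, dot (minus (first_arc s) (second_arc r))
                                 (minus (first_arc s) (second_arc r))
                             = sep_sq tau Htau (s - h) (r - h)).
  { intros s r. rewrite <- dist3_clasp_sq. unfold dist3, enorm.
    rewrite pow2_sqrt by apply dot_self_nonneg. reflexivity. }
  pose proof (half_length_nonneg tau Htau C HC) as Hh0.
  pose proof (half_length_ge tau Htau C HC) as Hh1.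
  pose proof (curved_half_nonneg tau Htau) as Hch.
  destruct (perturbed_distance_right_derive first_arc second_arc xi1 xi2 (2 * h) (2 * h)
    continuous_first_arc continuous_second_arc
    (smooth_field_continuous xi1 Hxi1) (smooth_field_continuous xi2 Hxi2)) as (m & Hd & Hm).
  - intros s r _. rewrite Hsep. apply sep_sq_ge_1.
  - exists h, (h + curved_half tau). split; [lra|]. rewrite Hsep.
    rewrite <- (sep_sq_strut tau Htau 0) by lra. rewrite asin_0, arc_at_0, Rminus_0_r.
    replace (h - h) with 0 by ring.
    replace (h + curved_half tau - h) with (curved_half tau) by ring. reflexivity.
  - exists m. split.
    + eapply filterlim_ext; [|exact Hd]. intros t. simpl. now rewrite !LThi_perturb.
    + rewrite (no_contact tau Htau C HC HC'). simpl.
      assert (Hb : 16 * Rmin m 0 <= -1).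
      { rewrite <- HdLen. apply balance; try assumption; [apply Rmin_r|].
        intros s r Hs Hr H1. apply Rle_trans with m; [apply Rmin_l|].
        apply Hm; [lra|]. rewrite Hsep, <- dist3_clasp_sq. exact H1. }
      unfold Rmin in Hb. destruct (Rle_dec m 0); lra.
Qed.

End Balance.

(** * Isotopy to the model clasp *)

Lemma filterlim_locally_pair {T : Type} {V W : UniformSpace} (F : (T -> Prop) -> Prop)
    (f : T -> V) (g : T -> W) a b : Filter F ->
  filterlim f F (locally a) -> filterlim g F (locally b) ->
  filterlim (fun t => (f t, g t)) F (locally (a, b)).
Proof.
  intros HF Hf Hg Q [eps HQ].
  assert (Hf' : F (fun y => ball a eps (f y))) by (apply Hf; now exists eps).
  assert (Hg' : F (fun y => ball b eps (g y))) by (apply Hg; now exists eps).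
  change (F (fun y => Q (f y, g y))).
  generalize (filter_and _ _ Hf' Hg'). apply filter_imp. intros y [H1 H2].
  apply HQ. split; assumption.
Qed.

Lemma continuous_pair {U V W : UniformSpace} (f : U -> V) (g : U -> W) x :
  continuous f x -> continuous g x -> continuous (fun y => (f y, g y)) x.
Proof. apply filterlim_locally_pair, locally_filter. Qed.

Lemma continuous_on_forall {U V : UniformSpace} (D : U -> Prop) (f : U -> V) :
  (forall q, continuous f q) -> continuous_on D f.
Proof.
  intros Hf q _. eapply filterlim_filter_le_1; [|apply Hf].
  apply filter_le_within.
Qed.

Lemma is_derive_pair {V W : NormedModule R_AbsRing} (f : R -> V) (g : R -> W) (x : R) a b :
  is_derive f x a -> is_derive g x b ->
  is_derive (fun y => (f y, g y) : prod_NormedModule R_AbsRing V W) x (a, b).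
Proof.
  intros Hf Hg.
  apply (filterdiff_comp'_2 (W := prod_NormedModule R_AbsRing V W) f g
    (fun u v => (u, v)) x _ _ (fun u v => (u, v)) Hf Hg).
  apply (filterdiff_ext (fun t => t)); [now intros [u v]|].
  apply (filterdiff_ext_lin _ (fun t => t)); [|now intros [u v]].
  apply filterdiff_id.
Qed.

(** The second arc is moved by the mirror image of the motion of the first one. *)
Lemma planar_isotopy (x z x' z' : R * R -> R) :
  (forall q, continuous x q /\ continuous z q /\ continuous x' q /\ continuous z' q) ->
  (forall t s : R, is_derive (fun r => x (t, r)) s (x' (t, s)) /\
               is_derive (fun r => z (t, r)) s (z' (t, s))) ->
  (forall q, unit_square q -> x' q = 0 -> z' q = 0 -> False) ->
  (forall t s s', 0 <= t <= 1 -> 0 <= s <= 1 -> 0 <= s' <= 1 ->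
     x (t, s) = x (t, s') -> z (t, s) = z (t, s') -> s = s') ->
  C1_isotopy (fun q => (x q, 0, z q)) /\ C1_isotopy (fun q => sym (x q, 0, z q)).
Proof.
  intros Hc Hd Hn Hi.
  split; split.
  - exists (fun q => (x' q, 0, z' q)). split; [|split; [|split]].
    + apply continuous_on_forall. intros q. destruct (Hc q) as (? & ? & ? & ?).
      apply continuous_pair;
        [apply continuous_pair; [assumption | apply continuous_const] | assumption].
    + apply continuous_on_forall. intros q. destruct (Hc q) as (? & ? & ? & ?).
      apply continuous_pair;
        [apply continuous_pair; [assumption | apply continuous_const] | assumption].
    + intros t s _ _. destruct (Hd t s). apply is_derive_pair; [apply is_derive_pair|]; auto.
      apply (der_const 0).
    + intros q Hq E. injection E as E1 E2. exact (Hn q Hq E1 E2).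
  - intros t s s' Ht Hs Hs' E. injection E as E1 E2. now apply (Hi t).
  - exists (fun q => sym (x' q, 0, z' q)). split; [|split; [|split]].
    + apply continuous_on_forall. intros q. destruct (Hc q) as (? & ? & ? & ?).
      apply continuous_pair;
        [apply continuous_pair; [apply continuous_const | assumption] | now apply (cont_opp z)].
    + apply continuous_on_forall. intros q. destruct (Hc q) as (? & ? & ? & ?).
      apply continuous_pair;
        [apply continuous_pair; [apply continuous_const | assumption] | now apply (cont_opp z')].
    + intros t s _ _. destruct (Hd t s). apply is_derive_pair; [apply is_derive_pair|]; auto.
      * apply (der_const 0).
      * now apply (der_opp (fun r => z (t, r))).
    + intros q Hq E. unfold sym, xc, yc, zc in E; simpl in E. injection E as E1 E2.
      apply (Hn q Hq E1). lra.
  - intros t s s' Ht Hs Hs' E. unfold sym, xc, yc, zc in E; simpl in E.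
    injection E as E1 E2. apply (Hi t); auto. lra.
Qed.

Section Clasped.

Variable tau : R.
Hypothesis Htau : 0 <= tau <= 1.
Notation alpha := (max_angle tau).
Notation P := (clasp_arc tau Htau).
Notation xs := (xs tau Htau).
Notation zs := (zs tau Htau).
Notation arc_at := (arc_at tau).
Notation angle_at := (angle_at tau Htau).
Notation turning := (turning tau Htau).

Lemma xs_le s r : s <= r -> xs s <= xs r.
Proof.
  intros Hsr. apply (le_of_derive_nonneg xs (fun r => cos (turning r))); [exact Hsr | | |].
  - intros. apply is_derive_xs.
  - intros. eapply derive_continuous, is_derive_xs.
  - intros. apply cos_turning_nonneg.
Qed.

(** The tangent can be vertical only from the ends of the curved part on, when tau = 1. *)
Lemma xs_pos s : 0 < s -> 0 < xs s.
Proof.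
  intros Hs. pose proof (max_angle_bounds tau Htau) as Ha.
  assert (H : forall r, 0 < r -> (r <= curved_half tau \/ alpha < PI / 2) -> 0 < xs r).
  { intros r Hr Hcase.
    destruct (mean_value xs (fun r => cos (turning r)) 0 r Hr) as (c & Hc & E).
    - intros. apply is_derive_xs.
    - intros. eapply derive_continuous, is_derive_xs.
    - rewrite xs_0, !Rminus_0_r in E. rewrite E. apply Rmult_lt_0_compat; [|exact Hr].
      pose proof (turning_bounds tau Htau c) as Hb.
      assert (turning c < PI / 2).
      { destruct Hcase as [Hcase|Hcase]; [|lra].
        assert (Hac : - alpha <= angle_at c <= alpha)
          by (apply angle_at_curved; pose proof (curved_half_nonneg tau Htau); lra).
        rewrite turning_eq, clamp_id by exact Hac.
        destruct (Rle_lt_dec alpha (angle_at c)) as [L|L]; [|lra].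
        apply (arc_at_le tau Htau) in L. rewrite arc_at_angle_at in L.
        unfold curved_half in Hcase. lra. }
      apply cos_gt_0; [|assumption].
      assert (angle_at 0 <= angle_at c) by (apply (proj1 (angle_at_le tau Htau 0 c)); lra).
      rewrite <- (arc_at_0 tau) in H0 at 1. rewrite angle_at_arc_at in H0.
      pose proof (clamp_nonneg alpha (proj1 Ha) _ H0) as Hpos. rewrite <- turning_eq in Hpos.
      pose proof PI_RGT_0. lra. }
  destruct (Rlt_le_dec alpha (PI / 2)) as [L|L]; [apply H; auto|].
  assert (Hch : 0 < curved_half tau).
  { unfold curved_half. rewrite <- (arc_at_0 tau). apply arc_at_incr; [exact Htau|].
    pose proof PI_RGT_0. lra. }
  apply Rlt_le_trans with (xs (Rmin s (curved_half tau))).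
  - apply H; [apply Rmin_glb_lt; lra | left; apply Rmin_r].
  - apply xs_le, Rmin_l.
Qed.

Lemma xs_neg s : s < 0 -> xs s < 0.
Proof.
  intros Hs. pose proof (xs_pos (- s) ltac:(lra)) as H. rewrite xs_opp in H. lra.
Qed.

(** On either side of the tip, horizontal and vertical displacement have constant signs
    and do not vanish together. *)
Lemma clasp_arc_inj s r : xs s = xs r -> zs s = zs r -> s = r.
Proof.
  assert (H : forall s r, 0 <= s -> s < r -> xs s + zs s < xs r + zs r).
  { clear s r. intros s r Hs Hsr. pose proof (max_angle_bounds tau Htau) as Ha.
    destruct (mean_value (fun r => xs r + zs r)
      (fun r => cos (turning r) + sin (turning r)) s r Hsr) as (c & Hc & E).
    - intros. apply der_plus; [apply is_derive_xs | apply is_derive_zs].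
    - intros. cont; eapply derive_continuous; [apply is_derive_xs | apply is_derive_zs].
    - assert (angle_at 0 <= angle_at c) by (apply (proj1 (angle_at_le tau Htau 0 c)); lra).
      rewrite <- (arc_at_0 tau) in H at 1. rewrite angle_at_arc_at in H.
      pose proof (clamp_nonneg alpha (proj1 Ha) _ H) as Hpos. rewrite <- turning_eq in Hpos.
      pose proof (turning_bounds tau Htau c) as Hb.
      assert (H1 : 0 <= cos (turning c)) by apply cos_turning_nonneg.
      assert (H2 : 0 <= sin (turning c)) by (apply sin_ge_0; lra).
      pose proof (sin2_cos2 (turning c)) as T. unfold Rsqr in T.
      assert (0 < cos (turning c) + sin (turning c)) by nra. nra. }
  assert (Hpp : forall s r, 0 <= s -> 0 <= r -> xs s = xs r -> zs s = zs r -> s = r).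
  { clear s r. intros s r Hs Hr Ex Ez.
    destruct (Rtotal_order s r) as [L|[L|L]]; [|exact L|]; apply H in L; lra. }
  intros Ex Ez.
  destruct (Rle_lt_dec 0 s) as [Hs|Hs], (Rle_lt_dec 0 r) as [Hr|Hr].
  - now apply Hpp.
  - pose proof (xs_neg r Hr). pose proof (xs_le 0 s Hs). rewrite xs_0 in *. lra.
  - pose proof (xs_neg s Hs). pose proof (xs_le 0 r Hr). rewrite xs_0 in *. lra.
  - assert (- s = - r); [|lra]. apply Hpp; rewrite ?xs_opp, ?zs_opp; lra.
Qed.

(** The tips are at distance at least 1 from each other, and the strut relation at
    u = 0 tells which of the two is higher. *)
Lemma zs_tip : zs 0 <= - (1 / 2).
Proof.
  pose proof (sep_sq_ge_1 tau Htau 0 0) as H. unfold sep_sq in H. rewrite xs_0 in H.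
  pose proof (strut_z tau Htau 0 ltac:(lra)) as E.
  rewrite asin_0, arc_at_0, Rminus_0_r in E.
  pose proof (strut_height_nonneg tau 0).
  pose proof (zs_min tau Htau (arc_at (asin tau))). nra.
Qed.

Variable C : R.
Hypothesis HC : support_height tau Htau + 1 <= C.
Hypothesis HC' : 1 + Rabs (z_gamma tau 0) <= C.
Notation h := (half_length tau Htau C).

Lemma model_width : exists a, 0 < a /\ a * sqrt (1 - tau ^ 2) + tau * (tau * a ^ 2 - 1) = C.
Proof.
  pose proof (Rabs_pos (z_gamma tau 0)) as Hz.
  assert (Hs : 1 - tau ^ 2 <= sqrt (1 - tau ^ 2)).
  { pose proof (sqrt_pos (1 - tau ^ 2)). pose proof (sqrt_cos_sq tau Htau).
    assert (sqrt (1 - tau ^ 2) <= 1).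
    { apply Rle_trans with (sqrt 1); [|rewrite sqrt_1; lra]. apply sqrt_le_1_alt. nra. }
    nra. }
  set (c := sqrt (1 - tau ^ 2)) in *.
  destruct (IVT_gen (fun a => a * c + tau * (tau * a ^ 2 - 1)) 0 (C + 2) C) as (a & Ha & E).
  - intros a. apply continuity_pt_continuous. cont.
  - rewrite Rmin_left, Rmax_right.
    + split; [nra|].
      assert (C + 2 <= (C + 2) * (c + tau ^ 2 * (C + 2))).
      { assert (1 <= c + tau ^ 2 * (C + 2)) by nra. nra. }
      nra.
    + assert (0 <= c) by apply sqrt_pos. nra.
    + assert (0 <= c) by apply sqrt_pos. nra.
  - rewrite Rmin_left in Ha by lra. exists a. split; [|exact E].
    destruct Ha as [[Ha|Ha] _]; [exact Ha|]. subst a. nra.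
Qed.

(** Linear interpolation keeps the ends in their planes and the arcs in the wedges, as
    these are affine and convex.  Each arc continues to cross the plane of the other at
    its tip only, and the tips stay on their sides. *)
Lemma clasp_clasped :
  clasped tau C (len1 tau C) (arc1 tau C) (len2 tau C) (arc2 tau C).
Proof.
  assert (HCs : support_height tau Htau <= C) by lra.
  pose proof (curved_half_nonneg tau Htau) as Hch.
  assert (Hh : 0 < h) by (unfold half_length; lra).
  pose proof (Rabs_pos (z_gamma tau 0)) as Hz0.
  destruct model_width as (a & Ha & Ea).
  set (y := fun s => 2 * s - 1).
  set (x := fun q : R * R => (1 - fst q) * xs (h * y (snd q)) + fst q * (a * y (snd q))).
  set (z := fun q : R * R => (1 - fst q) * zs (h * y (snd q))
                             + fst q * (tau * (a * y (snd q)) ^ 2 - 1)).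
  set (x' := fun q : R * R => (1 - fst q) * (2 * h * cos (turning (h * y (snd q))))
                              + fst q * (2 * a)).
  set (z' := fun q : R * R => (1 - fst q) * (2 * h * sin (turning (h * y (snd q))))
                              + fst q * (4 * tau * a ^ 2 * y (snd q))).
  assert (Hxpos : forall t s, 0 <= t <= 1 -> 1 / 2 < s -> 0 < x (t, s)).
  { intros t s Ht Hs. unfold x; simpl.
    assert (Hy : 0 < y s) by (unfold y; lra).
    pose proof (xs_pos (h * y s) ltac:(nra)). assert (0 < a * y s) by nra.
    destruct (Req_dec t 0) as [->|Ht0]; [lra|].
    assert (0 <= (1 - t) * xs (h * y s)) by (apply Rmult_le_pos; lra).
    assert (0 < t * (a * y s)) by (apply Rmult_lt_0_compat; lra). lra. }
  assert (Hxneg : forall t s, x (t, 1 - s) = - x (t, s)).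
  { intros t s. unfold x; simpl.
    replace (y (1 - s)) with (- y s) by (unfold y; ring).
    rewrite <- !Ropp_mult_distr_r, xs_opp. ring. }
  assert (Hx0 : forall t s, 0 <= t <= 1 -> x (t, s) = 0 -> s = 1 / 2).
  { intros t s Ht E. destruct (Rtotal_order s (1 / 2)) as [L|[L|L]]; [|exact L|].
    - pose proof (Hxpos t (1 - s) Ht ltac:(lra)). rewrite Hxneg in H. lra.
    - pose proof (Hxpos t s Ht L). lra. }
  assert (Hends : forall t e, (e = 1 \/ e = -1) ->
    e * sqrt (1 - tau ^ 2) * x (t, (1 + e) / 2) + tau * z (t, (1 + e) / 2) = C).
  { intros t e He. pose proof (end_on_plane tau Htau C HCs) as Ee. unfold x, z; simpl fst; simpl snd.
    replace (y ((1 + e) / 2)) with e by (unfold y; field).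
    assert (Exe : e * xs (h * e) = xs h /\ zs (h * e) = zs h).
    { destruct He as [->| ->].
      - rewrite Rmult_1_r. split; [ring | reflexivity].
      - replace (h * -1) with (- h) by ring. rewrite xs_opp, zs_opp. split; [ring | reflexivity]. }
    destruct Exe as [Ex Ez]. rewrite Ez.
    assert (He2 : e * e = 1) by (destruct He as [->| ->]; ring).
    transitivity ((1 - t) * ((e * xs (h * e)) * sqrt (1 - tau ^ 2) + zs h * tau)
      + t * (e * e * a * sqrt (1 - tau ^ 2) + tau * (tau * (a ^ 2 * (e * e)) - 1))); [ring|].
    rewrite Ex, Ee, He2, Rmult_1_r, Rmult_1_l, Ea. ring. }
  assert (Hwall : forall t s, 0 <= t <= 1 -> 0 <= C + tau * z (t, s)).
  { intros t s Ht. unfold z; simpl fst; simpl snd.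
    pose proof (obstacle_slack tau Htau C HC' (h * y s)).
    replace (C + _) with ((1 - t) * (C + tau * zs (h * y s))
      + t * (C - tau + (tau * (a * y s)) ^ 2)) by ring.
    pose proof (pow2_ge_0 (tau * (a * y s))).
    apply Rplus_le_le_0_compat; apply Rmult_le_pos; lra. }
  destruct (planar_isotopy x z x' z') as [HF HG].
  - intros q.
    assert (Ht : continuous (fst : R * R -> R) q) by (destruct q; apply continuous_fst).
    assert (Hs : continuous (fun q : R * R => y (snd q)) q).
    { assert (continuous (snd : R * R -> R) q) by (destruct q; apply continuous_snd).
      unfold y. cont. }
    assert (Hhs : continuous (fun q : R * R => h * y (snd q)) q) by cont.
    assert (continuous (fun q : R * R => xs (h * y (snd q))) q)
      by (apply (cont_comp _ q xs Hhs); eapply derive_continuous, is_derive_xs).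
    assert (continuous (fun q : R * R => zs (h * y (snd q))) q)
      by (apply (cont_comp _ q zs Hhs); eapply derive_continuous, is_derive_zs).
    assert (continuous (fun q : R * R => turning (h * y (snd q))) q)
      by (apply (cont_comp _ q turning Hhs), continuous_turning).
    unfold x, z, x', z'. split; [|split; [|split]]; cont.
  - intros t s.
    assert (Hy : is_derive y s (0 * s + 2 * 1 - 0)).
    { apply der_minus; [|apply der_const].
      exact (der_mult (fun _ => 2) (fun s => s) s 0 1 (der_const 2 s) (der_id s)). }
    pose proof (fun k f d => der_scal k f s d) as Hsc.
    pose proof (Hsc h _ _ Hy) as Hhy.
    unfold x, z, x', z'; simpl fst; simpl snd. split.
    + eapply der_eq.
      * exact (der_plus _ _ s _ _
          (Hsc (1 - t) _ _ (der_comp _ s _ xs _ Hhy (is_derive_xs tau Htau _)))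
          (Hsc t _ _ (Hsc a _ _ Hy))).
      * ring.
    + assert (Hsq : forall v : R, is_derive (fun v => tau * (a * v) ^ 2 - 1) v
        (2 * tau * a ^ 2 * v)) by (intros v; auto_derive; [exact I | ring]).
      eapply der_eq.
      * exact (der_plus _ _ s _ _
          (Hsc (1 - t) _ _ (der_comp _ s _ zs _ Hhy (is_derive_zs tau Htau _)))
          (Hsc t _ _ (der_comp y s _ _ _ Hy (Hsq _)))).
      * ring.
  - intros [t s] [Ht Hs] E1 E2. simpl in Ht, Hs. unfold x', z' in *; simpl in E1, E2.
    pose proof (cos_turning_nonneg tau Htau (h * y s)) as Hcos.
    destruct (Req_dec t 0) as [->|Ht0].
    + pose proof (sin2_cos2 (turning (h * y s))) as T. unfold Rsqr in T.
      assert (cos (turning (h * y s)) = 0) by nra.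
      assert (sin (turning (h * y s)) = 0) by nra. nra.
    + assert (0 <= (1 - t) * (2 * h * cos (turning (h * y s)))).
      { apply Rmult_le_pos; [lra|]. apply Rmult_le_pos; lra. }
      assert (0 < t * (2 * a)) by (apply Rmult_lt_0_compat; lra). lra.
  - intros t s s' Ht _ _ E1 E2. unfold x, z in *; simpl in E1, E2.
    destruct (Req_dec t 0) as [->|Ht0].
    + assert (E : h * y s = h * y s') by (apply clasp_arc_inj; lra).
      apply Rmult_eq_reg_l in E; [unfold y in E; lra | lra].
    + assert (Hm : forall s s', s < s' ->
        (1 - t) * xs (h * y s) + t * (a * y s) < (1 - t) * xs (h * y s') + t * (a * y s')).
      { intros r r' Hr. assert (Hy : y r < y r') by (unfold y; lra).
        pose proof (xs_le (h * y r) (h * y r') ltac:(nra)).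
        assert (t * (a * y r) < t * (a * y r')).
        { apply Rmult_lt_compat_l; [lra|]. apply Rmult_lt_compat_l; lra. }
        assert ((1 - t) * xs (h * y r) <= (1 - t) * xs (h * y r'))
          by (apply Rmult_le_compat_l; lra).
        lra. }
      destruct (Rtotal_order s s') as [L|[L|L]]; [|exact L|]; apply Hm in L; lra.
  - exists (fun q => (x q, 0, z q)), (fun q => sym (x q, 0, z q)), a.
    split; [exact Ha|]. split; [exact HF|]. split; [exact HG|]. split; [|split].
    + intros t Ht.
      pose proof (Hends t 1 (or_introl eq_refl)) as H1.
      pose proof (Hends t (-1) (or_intror eq_refl)) as H0.
      replace ((1 + 1) / 2) with 1 in H1 by field.
      replace ((1 + -1) / 2) with 0 in H0 by field.
      unfold admissible, satisfies_constraints, on_plane, clasp_link. simpl.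
      repeat split;
        try solve
          [ etransitivity; [|exact H0]; unfold n_vec, nt_vec, sym, dot, xc, yc, zc; simpl; ring
          | etransitivity; [|exact H1]; unfold n_vec, nt_vec, sym, dot, xc, yc, zc; simpl; ring ].
      * intros g s Hg Hs. pose proof (Hwall t s Ht).
        destruct Hg as [<-|[<-|[]]]; unfold wall, nt_vec, dot, xc, yc, zc; simpl; lra.
      * intros g s Hg Hs. pose proof (Hwall t s Ht).
        destruct Hg as [<-|[<-|[]]]; unfold wall, n_vec, sym, dot, xc, yc, zc; simpl; lra.
    + intros t s s' Ht _ _ E. unfold sym, xc, yc, zc in E; simpl in E.
      injection E as E1 E2 E3.
      rewrite (Hx0 t s Ht E1), (Hx0 t s' Ht (eq_sym E2)) in E3.
      assert (z (t, 1 / 2) = 0) by lra. unfold z in H; simpl in H.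
      replace (y (1 / 2)) with 0 in H by (unfold y; field).
      rewrite !Rmult_0_r in H. pose proof zs_tip. nra.
    + intros s Hs.
      assert (Hls : 0 <= 2 * h * s <= 2 * h) by nra.
      rewrite (len1_eq tau Htau C HCs), (len2_eq tau Htau C HCs),
        (arc1_eq tau Htau C HCs), (arc2_eq tau Htau C HCs), clasp_arc_eq by exact Hls.
      replace (2 * h * s - h) with (h * y s) by (unfold y; ring).
      unfold x, z, model_arc; simpl fst; simpl snd. fold (y s).
      repeat split; apply vector_eq; unfold sym, xc, yc, zc; simpl; ring.
Qed.

End Clasped.

(** * Curvature and length of the curved part *)

Lemma slope_limit (f : R -> R) (x l : R) : is_derive f x l ->
  filterlim (fun q => / (q - x) * (f q - f x)) (locally' x) (locally l).
Proof.
  intros Hf Q [eps HQ]. apply is_derive_Reals in Hf.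
  destruct (Hf eps (cond_pos eps)) as [d Hd].
  exists d. intros q Hq Hne. apply HQ.
  unfold ball in *; simpl in *. unfold AbsRing_ball, minus, plus, opp, abs in *; simpl in *.
  specialize (Hd (q - x) ltac:(lra) Hq). replace (x + (q - x)) with q in Hd by ring.
  replace (/ (q - x) * (f q - f x) + - l) with ((f q - f x) / (q - x) - l)
    by (unfold Rdiv; ring).
  exact Hd.
Qed.

Definition unit_vector (w : R) : R3 := (cos w, 0, sin w).

(** With the tangent angle w as parameter and f w as arclength, this is the derivative of
    the tangent divided by that of the arclength.  Where the latter vanishes, injectivity
    of f keeps the quotients defined, and they tend to infinity. *)
Lemma turning_rate (f : R -> R) (w0 rho : R) :
  is_derive f w0 rho -> (forall w, w <> w0 -> f w <> f w0) ->
  filterlim (fun w => dist3 (unit_vector w) (unit_vector w0) / Rabs (f w - f w0))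
    (locally' w0) (Rbar_locally (if Req_EM_T rho 0 then p_infty else Finite (/ Rabs rho))).
Proof.
  intros Hf Hinj.
  set (k := fun p : R * R * R => sqrt (fst (fst p) ^ 2 + snd (fst p) ^ 2)).
  set (slopes := fun w => (/ (w - w0) * (cos w - cos w0), / (w - w0) * (sin w - sin w0),
                           / (w - w0) * (f w - f w0))).
  assert (Hloc : Filter (locally' w0)) by typeclasses eauto.
  assert (Hs : filterlim slopes (locally' w0) (locally (- sin w0, cos w0, rho))).
  { apply filterlim_locally_pair; [exact Hloc | |now apply slope_limit].
    apply filterlim_locally_pair; [exact Hloc | |]; apply slope_limit;
      [apply is_derive_cos | apply is_derive_sin]. }
  assert (Hk1 : k (- sin w0, cos w0, rho) = 1).
  { unfold k; simpl fst; simpl snd. pose proof (sin2_cos2 w0) as T. unfold Rsqr in T.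
    replace ((- sin w0) ^ 2 + cos w0 ^ 2) with 1 by (rewrite <- T; ring). apply sqrt_1. }
  assert (Hfst : forall (p : R * R * R),
    continuous (fun p : R * R * R => fst (fst p)) p /\
    continuous (fun p : R * R * R => snd (fst p)) p /\
    continuous (fun p : R * R * R => snd p) p).
  { intros p. assert (continuous (fst : R * R * R -> R * R) p)
      by (destruct p; apply continuous_fst).
    split; [|split].
    - apply (continuous_comp fst fst); [assumption|].
      destruct p as [[? ?] ?]; apply continuous_fst.
    - apply (continuous_comp fst snd); [assumption|].
      destruct p as [[? ?] ?]; apply continuous_snd.
    - destruct p; apply continuous_snd. }
  assert (Hk : forall p, continuous k p).
  { intros p. destruct (Hfst p) as (C1 & C2 & _). unfold k.
    apply (cont_comp (fun p : R * R * R => fst (fst p) ^ 2 + snd (fst p) ^ 2) p sqrt);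
      [cont | apply continuous_sqrt]. }
  assert (Hratio : forall w, w <> w0 ->
    dist3 (unit_vector w) (unit_vector w0) / Rabs (f w - f w0)
    = k (slopes w) / Rabs (snd (slopes w))).
  { intros w Hw. rewrite dist3_sqrt. unfold unit_vector, xc, yc, zc, k, slopes; simpl fst; simpl snd.
    assert (Hd : 0 < Rabs (w - w0)) by (apply Rabs_pos_lt; lra).
    assert (Hn : Rabs (f w - f w0) <> 0) by (apply Rabs_no_R0; specialize (Hinj w Hw); lra).
    rewrite Rabs_mult, Rabs_inv.
    replace ((/ (w - w0) * (cos w - cos w0)) ^ 2 + (/ (w - w0) * (sin w - sin w0)) ^ 2)
      with ((/ Rabs (w - w0)) ^ 2 * ((cos w - cos w0) ^ 2 + (0 - 0) ^ 2 + (sin w - sin w0) ^ 2)).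
    2: { rewrite !Rpow_mult_distr, <- Rabs_inv, pow2_abs. ring. }
    rewrite sqrt_mult, sqrt_pow2.
    - field. lra.
    - left. now apply Rinv_0_lt_compat.
    - apply pow2_ge_0.
    - repeat apply Rplus_le_le_0_compat; apply pow2_ge_0. }
  apply (filterlim_ext_loc (fun w => k (slopes w) / Rabs (snd (slopes w)))).
  { exists (mkposreal 1 Rlt_0_1). intros w _ Hw. symmetry. now apply Hratio. }
  destruct (Req_EM_T rho 0) as [->|Hrho].
  - intros Q [M HM]. change (locally' w0 (fun w => Q (k (slopes w) / Rabs (snd (slopes w))))).
    assert (Hbig : locally' w0 (fun w => 1 / 2 < k (slopes w))).
    { apply (filterlim_comp _ _ _ slopes k _ _ _ Hs (Hk _) (fun y => 1 / 2 < y)). rewrite Hk1.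
      exists (mkposreal (1 / 2) ltac:(lra)). intros y Hy. apply Rabs_def2 in Hy.
      unfold minus, plus, opp in Hy; simpl in Hy. lra. }
    assert (HM1 : 0 < / (2 * (Rabs M + 1)))
      by (apply Rinv_0_lt_compat; pose proof (Rabs_pos M); lra).
    assert (Hsmall : locally' w0 (fun w => Rabs (snd (slopes w)) < / (2 * (Rabs M + 1)))).
    { apply (filterlim_comp _ _ _ slopes snd _ _ _ Hs
        (proj2 (proj2 (Hfst (- sin w0, cos w0, 0)))) (fun y => Rabs y < / (2 * (Rabs M + 1)))).
      simpl.
      exists (mkposreal _ HM1). intros y Hy.
      unfold ball in Hy; simpl in Hy. unfold AbsRing_ball, minus, plus, opp, abs in Hy; simpl in Hy.
      now rewrite Ropp_0, Rplus_0_r in Hy. }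
    assert (Hne : locally' w0 (fun w => snd (slopes w) <> 0)).
    { exists (mkposreal 1 Rlt_0_1). intros w _ Hw. unfold slopes; simpl.
      specialize (Hinj w Hw). apply Rmult_integral_contrapositive_currified; [|lra].
      apply Rinv_neq_0_compat. lra. }
    generalize (filter_and _ _ Hbig (filter_and _ _ Hsmall Hne)). apply filter_imp.
    intros w (H1 & H2 & H3). apply HM. apply Rabs_pos_lt in H3.
    apply Rle_lt_trans with (1 := Rle_abs M).
    apply Rmult_lt_reg_r with (Rabs (snd (slopes w))); [exact H3|].
    unfold Rdiv. rewrite Rmult_assoc, Rinv_l, Rmult_1_r by lra.
    pose proof (Rabs_pos M).
    apply Rle_lt_trans with ((Rabs M + 1) * / (2 * (Rabs M + 1))).
    + apply Rmult_le_compat; lra.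
    + replace ((Rabs M + 1) * / (2 * (Rabs M + 1))) with (1 / 2) by (field; lra). exact H1.
  - replace (/ Rabs rho) with (k (- sin w0, cos w0, rho) / Rabs (snd (- sin w0, cos w0, rho)))
      by (rewrite Hk1; simpl; field; now apply Rabs_no_R0).
    apply (filterlim_comp _ _ _ slopes (fun p => k p / Rabs (snd p)) _ _ _ Hs).
    destruct (Hfst (- sin w0, cos w0, rho)) as (_ & _ & C3).
    apply (cont_div k (fun p : R * R * R => Rabs (snd p))); [apply Hk | |].
    + apply (cont_comp _ _ Rabs C3), continuous_Rabs.
    + simpl. now apply Rabs_no_R0.
Qed.

Section CurvedPart.

Variable tau : R.
Hypothesis Htau : 0 <= tau <= 1.
Notation alpha := (max_angle tau).
Notation P := (clasp_arc tau Htau).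
Notation xs := (xs tau Htau).
Notation zs := (zs tau Htau).
Notation arc_at := (arc_at tau).
Notation angle_at := (angle_at tau Htau).
Notation turning := (turning tau Htau).
Notation half := (curved_half tau).

Lemma arc_param_left : arc_param tau (- tau) = - half.
Proof. rewrite arc_param_opp, arc_param_inside by lra. reflexivity. Qed.

Lemma arc_length_gamma u : - tau <= u <= tau ->
  arc_length (gamma tau) (- tau) u = Finite (half + arc_at (asin u)).
Proof.
  intros Hu.
  rewrite (arc_length_reparam turning (z_gamma tau 0) (continuous_turning tau Htau)
    (gamma tau) (arc_param tau) (arc_param_inv tau Htau)).
  - rewrite arc_param_left, arc_param_inside by exact Hu. f_equal. ring.
  - intros v Hv. apply gamma_arc_param. lra.
  - intros v w _ Hvw _. now apply arc_param_incr.
  - intros y Hy. now apply arc_param_inv_between.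
  - lra.
Qed.

Lemma arc_length_gamma_total : arc_length (gamma tau) (- tau) tau = Finite (2 * half).
Proof.
  rewrite arc_length_gamma by lra. f_equal. unfold curved_half, max_angle. ring.
Qed.

Lemma gamma_by_arclength s : 0 <= s <= 2 * half ->
  by_arclength (gamma tau) (- tau) tau s = P (s - half).
Proof.
  intros Hs.
  assert (Er : arc_param tau tau = half) by (rewrite arc_param_inside by lra; reflexivity).
  rewrite (by_arclength_reparam turning (z_gamma tau 0) (gamma tau)
    (arc_param tau) (arc_param_inv tau Htau)).
  - rewrite arc_param_left. unfold clasp_arc. f_equal. ring.
  - apply continuous_turning.
  - lra.
  - intros v Hv. apply gamma_arc_param. lra.
  - intros v w _ Hvw _. now apply arc_param_incr.
  - intros y Hy. now apply arc_param_inv_between.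
  - rewrite Er, arc_param_left. lra.
Qed.

Lemma gamma_curvature u : - tau <= u <= tau ->
  has_curvature (by_arclength (gamma tau) (- tau) tau)
    (real (arc_length (gamma tau) (- tau) tau))
    (real (arc_length (gamma tau) (- tau) u)) (kappa tau u).
Proof.
  intros Hu. rewrite arc_length_gamma_total, arc_length_gamma by exact Hu. simpl.
  exists (fun r => unit_vector (turning (r - half))). split.
  - intros r Hr.
    assert (HF : Filter (within (fun q => 0 <= q <= 2 * half) (locally' r)))
      by (apply within_filter; typeclasses eauto).
    assert (Hshift : is_derive (fun q => q - half) r (1 - 0))
      by (apply der_minus; [apply der_id | apply der_const]).
    assert (Hlim : forall f df, is_derive f (r - half) df ->
      filterlim (fun q => / (q - r) * (f (q - half) - f (r - half)))
        (within (fun q => 0 <= q <= 2 * half) (locally' r)) (locally df)).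
    { intros f df Hf. eapply filterlim_filter_le_1; [apply filter_le_within|].
      apply (slope_limit (fun q => f (q - half))).
      eapply der_eq; [exact (der_comp _ r _ f _ Hshift Hf) | ring]. }
    apply (filterlim_within_ext _ (fun q =>
      (/ (q - r) * (xs (q - half) - xs (r - half)), 0,
       / (q - r) * (zs (q - half) - zs (r - half))))).
    + intros q Hq. rewrite !gamma_by_arclength, !clasp_arc_eq by assumption.
      apply vector_eq; unfold xc, yc, zc; cbn; ring.
    + apply filterlim_locally_pair; [exact HF|apply filterlim_locally_pair; [exact HF| |]|].
      * apply Hlim, is_derive_xs.
      * apply filterlim_const.
      * apply Hlim, is_derive_zs.
  - set (w0 := asin u). set (s0 := half + arc_at w0).
    assert (Hw0 : - alpha <= w0 <= alpha) by (apply asin_le_max_angle; lra).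
    assert (Es0 : s0 - half = arc_at w0) by (unfold s0; ring).
    assert (Hkappa : kappa tau u =
      (if Req_EM_T (radius tau w0) 0 then p_infty else Finite (/ Rabs (radius tau w0)))).
    { pose proof (radius_nonneg tau Htau w0) as Hnn. rewrite Rabs_pos_eq by exact Hnn.
      assert (Er : radius tau w0 = inv_kappa tau u)
        by (rewrite radius_inside by exact Hw0; unfold w0; now rewrite sin_asin by lra).
      rewrite Er in *. destruct (Req_EM_T (inv_kappa tau u) 0) as [E|E];
        [|now apply kappa_of_inv].
      assert (Hsing : ~ (tau < 1 \/ u <> 0)).
      { intros H. apply (inv_kappa_pos tau Htau) in H; [lra|]. now apply Rabs_le. }
      assert (tau = 1) by lra. assert (u = 0) by (destruct (Req_dec u 0); tauto).
      subst u. replace tau with 1 by lra. apply kappa_singular. }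
    rewrite Hkappa.
    assert (Hangle : filterlim (fun r => angle_at (r - half))
      (within (fun r => 0 <= r <= 2 * half) (locally' s0)) (locally' w0)).
    { intros Q HQ.
      assert (Hc : continuous (fun r => angle_at (r - half)) s0).
      { apply (cont_comp (fun r => r - half) s0 angle_at); [cont | apply continuous_angle_at]. }
      assert (E0 : angle_at (s0 - half) = w0) by (rewrite Es0; apply angle_at_arc_at).
      unfold continuous in Hc. rewrite E0 in Hc.
      destruct (Hc _ HQ) as [d Hd]. exists d. intros r Hr Hne _. apply (Hd r Hr).
      intros E. apply Hne. rewrite <- E0 in E. apply (f_equal arc_at) in E.
      rewrite !arc_at_angle_at in E. lra. }
    pose proof (turning_rate arc_at w0 _ (is_derive_arc_at tau Htau w0)
      (fun w Hw E => Hw (arc_at_inj tau Htau _ _ E))) as Hrate.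
    pose proof (filterlim_comp _ _ _ _ _ _ _ _ Hangle Hrate) as Hlim.
    apply (filterlim_within_ext _ _ _ (G := Rbar_locally _)) with (2 := Hlim).
    intros r Hr. rewrite arc_at_angle_at, Es0, turning_arc_at, clamp_id by exact Hw0.
    rewrite turning_eq, clamp_id.
    + replace (r - half - arc_at w0) with (r - s0) by (unfold s0; ring). reflexivity.
    + apply angle_at_curved. lra.
Qed.

Lemma gamma_length_integral :
  is_RInt_gen (fun u => inv_kappa tau u / sqrt (1 - u ^ 2))
    (towards (- tau)) (towards tau) (2 * half).
Proof.
  assert (HF : forall u, Filter (towards u))
    by (intros; apply within_filter, locally_filter).
  assert (H : forall u, - tau <= u <= tau ->
    is_RInt_gen (fun u => inv_kappa tau u / sqrt (1 - u ^ 2)) (at_point 0) (towards u)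
      (arc_at (asin u))).
  { intros u Hu. rewrite arc_at_eq.
    rewrite (RInt_ext _ (fun w => 1 * radius tau w)) by (intros; symmetry; apply Rmult_1_l).
    apply (is_RInt_gen_angle tau Htau (fun _ => 1)); [intros; apply continuous_const | | exact Hu].
    intros v. unfold Rdiv. ring. }
  replace (2 * half) with (plus (opp (arc_at (asin (- tau)))) (arc_at (asin tau))).
  - apply (is_RInt_gen_Chasles (V := R_NormedModule) (Fa := towards (- tau)) (Fc := towards tau) _ 0).
    + apply (is_RInt_gen_swap (V := R_NormedModule) (Fa := towards (- tau)) (Fb := at_point 0)).
      apply H. lra.
    + apply H. lra.
  - rewrite asin_opp, arc_at_opp by exact Htau. unfold plus, opp; simpl.
    unfold curved_half, max_angle. ring.
Qed.

End CurvedPart.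

Theorem theorem9p5 (tau : R) (htau : 0 <= tau <= 1) :
  (exists C0 : R, forall C : R, C0 <= C ->
     is_tau_clasp tau C (len1 tau C) (arc1 tau C) (len2 tau C) (arc2 tau C) /\
     strongly_critical
       (clasp_link tau C (len1 tau C) (arc1 tau C) (len2 tau C) (arc2 tau C))) /\
  (forall u : R, - tau < u < tau ->
     is_derive (x_gamma tau) u (inv_kappa tau u)) /\
  (forall u : R, - tau <= u <= tau ->
     has_curvature
       (by_arclength (gamma tau) (- tau) tau)
       (real (arc_length (gamma tau) (- tau) tau))
       (real (arc_length (gamma tau) (- tau) u))
       (kappa tau u)) /\
  (exists l : R,
     arc_length (gamma tau) (- tau) tau = Finite l /\
     is_RInt_gen (fun u => inv_kappa tau u / sqrt (1 - u ^ 2))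
       (towards (- tau)) (towards tau) l).
Proof.
  split; [|split; [|split]].
  - exists (Rmax (support_height tau htau + 1) (1 + Rabs (z_gamma tau 0))). intros C HC.
    assert (H1 : support_height tau htau + 1 <= C)
      by (eapply Rle_trans; [apply Rmax_l | exact HC]).
    assert (H2 : 1 + Rabs (z_gamma tau 0) <= C)
      by (eapply Rle_trans; [apply Rmax_r | exact HC]).
    assert (H3 : support_height tau htau <= C) by lra.
    split; [split|].
    + exact (clasp_admissible tau htau C H3 H2).
    + exact (clasp_clasped tau htau C H1 H2).
    + exact (clasp_strongly_critical tau htau C H3 H2).
  - intros u Hu. apply is_derive_x_gamma; [exact htau | apply Rabs_def1; lra].
  - exact (gamma_curvature tau htau).
  - exists (2 * curved_half tau). split.
    + exact (arc_length_gamma_total tau htau).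
    + exact (gamma_length_integral tau htau).
Qed.
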